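(* Let $f$ be a random completely multiplicative function (defined below). Then $$\mathbb P\left(\sum_{n\le x}\frac{f(n)}{n}>0 \text{ for every real } x\ge 1\right)\ \ge\ 1-10^{-45}.$$
   Context: A random completely multiplicative function $f$ is defined by choosing the values $f(p)\in\{1,-1\}$ at primes $p$ independently, each with probability $\tfrac12$, and extending completely multiplicatively to all positive integers: $f(1)=1$ and $f(mn)=f(m)f(n)$ for all $m,n\ge1$. *)

(* Defs.v *)
From HB Require Import structures.
From mathcomp Require Import all_boot all_order all_algebra.
From mathcomp Require Import all_classical all_reals all_analysis.

Set Implicit Arguments.
Unset Strict Implicit.
Unset Printing Implicit Defensive.
Import Order.TTheory GRing.Theory Num.Theory.

Local Open Scope classical_set_scope.
Local Open Scope ring_scope.

(* Mutual independence of (X i), i \in D: the product rule over every finite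
   duplicate-free list of indices taken in D. *)
Definition mutually_independent (d : measure_display) (T : measurableType d)
    (R : realType) (P : probability T R) (I : choiceType) (D : set I)
    (X : I -> {RV P >-> R}) : Prop :=
  forall (s : seq I) (B : I -> set R),
    uniq s ->
    (forall i, i \in s -> D i) ->
    (forall i, i \in s -> measurable (B i)) ->
    P (\bigcap_(i in [set` s]) (X i @^-1` B i)) =
    (\prod_(i <- s) P (X i @^-1` B i))%E.

(* A random function on the positive integers; the value f 0 is irrelevant and
   left unconstrained. *)
Record random_completely_multiplicative (d : measure_display)
    (T : measurableType d) (R : realType) (P : probability T R)
    (f : nat -> {RV P >-> R}) : Prop := RandomCompletelyMultiplicative {
  rcm_sign : forall (p : nat) (w : T), prime p -> f p w = 1 \/ f p w = -1;
  rcm_prob1 : forall p : nat, prime p -> P [set w | f p w = 1] = (2^-1)%:E;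
  rcm_probN1 : forall p : nat, prime p -> P [set w | f p w = -1] = (2^-1)%:E;
  rcm_indep : mutually_independent [set p : nat | prime p] f;
  rcm1 : forall w : T, f 1%N w = 1;
  rcmM : forall (m n : nat) (w : T), (0 < m)%N -> (0 < n)%N ->
    f (m * n)%N w = f m w * f n w
}.

(* Main.v *)
(* Write S_f(n) for the sum of f(i)/i over i <= n and let Y = 6000. Compare f with
   the multiplicative function f' given by f'(p^e) = (-1)^e for p <= Y, and by
   f'(p) = f(p), f'(p^e) = 0 (e >= 2) for p > Y. The Dirichlet series of f is that
   of f' times a series with nonnegative coefficients, so positivity of all
   logarithmic sums T(n) of f' gives positivity of all S_f(n). In the same way
   positivity of the logarithmic sums of the Liouville function for n < 400000,
   a finite computation, gives T(n) > 0 for all n < 400000.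

   For larger n, T(n) is the sum of f(b) A(n/b) / b over squarefree b composed of
   primes > Y, where A(n) is the sum of lambda(i)/i over the Y-smooth i <= n.
   Interval arithmetic on a finite grid gives A(n) >= 0.08 for n >= 400000 and
   A(n)^2 <= 13/400 + 1.94/(n+1). Now T(n) - A(n) is a Rademacher polynomial;
   hypercontractivity bounds its 2k-th moment by the k-th power of a weighted
   second moment, which is estimated by Rankin's trick, and Markov's inequality
   bounds the probability that T(n) - A(n) is large.

   The variance of T(n) does not tend to 0, so this only works up to a fixed power
   of 2. Beyond 2^224 the differences T(n) - T(n/256) are used instead: they are
   polynomials with coefficients A(m) - A(m/256) = O(m^(-1/4)), so their moments do
   decay and positivity propagates from n/256 to n outside a set of small
   probability. Every n >= 400000 contributes at most 2^-131 / ((n+1)(n+2)), and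
   these bounds sum to less than 10^-45. *)
Require Import Defs.
From HB Require Import structures.
From Stdlib Require Import ZArith.
From mathcomp Require Import all_boot all_order all_algebra.
From mathcomp Require Import all_classical all_reals all_analysis.
From mathcomp Require Import measurable_realfun.
From mathcomp Require Import lra ring zify ssrZ.
Set Implicit Arguments.
Unset Strict Implicit.
Unset Printing Implicit Defensive.
Import Order.TTheory GRing.Theory Num.Theory.
Local Open Scope ring_scope.
Delimit Scope Z_scope with BZ.

(** * Logarithmic sums of multiplicative functions *)

(** Putting -1 at every p <= Y removes the primes that carry most of the variance, and dropping the
    powers p^e with e >= 2 above Y makes T(n) multilinear in the signs, which hypercontractivity
    requires. The 2k-th moment costs a factor 2k - 1 inside the second moment, so the bound for A^2
    gets multiplied by P - 1, where P is the product of 1 + (2k - 1)/p^2 over p > Y; the result must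
    stay well below 0.08^2. Raising k improves the exponent but enlarges P: hence the limit on n for
    a fixed Y, and the passage to differences, whose second moment has no constant part.

    The length X = 400000 of the Liouville computation is tied to Y by 66 Y <= X <= Y^2. The upper
    inequality means that no p^2 with p > Y is below X, so T is a completely multiplicative sum
    there. The lower one gives n/p >= 66 for n >= X and p <= Y, where the sums over 500-smooth
    integers are at most 0.18; only the primes up to 500 need the grid, and those between 500 and
    6000 are added one at a time by inequalities. *)

Inductive local_type (R : Type) := Zero | Full of R | Sqf of R.
Arguments Zero {R}.

Definition upd (T : Type) (f : nat -> T) (p : nat) (t : T) : nat -> T :=
  fun q => if q == p then t else f q.

Section LogSums.
Variable R : realType.
Implicit Types (tau : nat -> local_type R) (p n i j : nat) (s : R).

(** Coefficients of the Euler factor at p: with u = p^(-z) the three types stand for 1, 1/(1 - s u)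
    and 1 + s u. *)
Definition local_coef (t : local_type R) (e : nat) : R :=
  if e == 0%N then 1 else
  match t with
  | Zero => 0
  | Full s => s ^+ e
  | Sqf s => if e == 1%N then s else 0
  end.

Definition mult_coef tau i : R :=
  \prod_(0 <= q < i.+1 | prime q) local_coef (tau q) (logn q i).

Definition log_sum tau n : R := \sum_(1 <= i < n.+1) mult_coef tau i / i%:R.

Lemma mult_coefE tau N i : (0 < i < N)%N ->
  mult_coef tau i = \prod_(0 <= q < N | prime q) local_coef (tau q) (logn q i).
Proof.
move=> /andP[i0 iN]; rewrite /mult_coef (big_cat_nat (n := i.+1) (p := N)) //=.
rewrite [X in _ = _ * X]big1_seq ?mulr1 // => q /andP[_].
rewrite mem_index_iota => /andP[iq _].
by rewrite /local_coef (ltn_log0 iq).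
Qed.

Lemma mult_coef_split tau p N i : prime p -> (0 < i < N)%N -> (p < N)%N ->
  mult_coef tau i = local_coef (tau p) (logn p i) *
    \prod_(0 <= q < N | prime q && (q != p)) local_coef (tau q) (logn q i).
Proof.
move=> pp iN pN; rewrite (mult_coefE _ iN) big_mkcond (bigD1_seq p) /=.
- rewrite pp; congr (_ * _); rewrite big_mkcond [RHS]big_mkcond.
  by apply: eq_bigr => q _; case: (prime q); case: (q != p).
- by rewrite mem_index_iota.
- exact: iota_uniq.
Qed.

Lemma eq_mult_coef tau tau' i : (0 < i)%N ->
  (forall q, prime q -> (q %| i)%N -> tau q = tau' q) ->
  mult_coef tau i = mult_coef tau' i.
Proof.
move=> i0 H; rewrite /mult_coef; apply: eq_bigr => q qp.
case: (boolP (q %| i)%N) => [/H -> //|qi].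
by rewrite /local_coef (_ : logn q i = 0%N) // lognE qp i0 (negPf qi).
Qed.

Lemma mult_coef_upd_ndvd tau p t i : (0 < i)%N -> ~~ (p %| i)%N ->
  mult_coef (upd tau p t) i = mult_coef tau i.
Proof.
move=> i0 pi; apply: eq_mult_coef => // q _ qi; rewrite /upd.
by case: eqP => // qp; rewrite qp (negPf pi) in qi.
Qed.

Lemma logn_dvd_neq0 p i : prime p -> (0 < i)%N -> (p %| i)%N -> logn p i != 0%N.
Proof. by move=> pp i0 pi; rewrite lognE pp i0 pi. Qed.

Lemma mult_coef_zero tau p i : prime p -> (0 < i)%N -> (p %| i)%N ->
  mult_coef (upd tau p Zero) i = 0.
Proof.
move=> pp i0 pi.
rewrite (@mult_coef_split _ p (i + p).+1) ?i0 ?ltnS ?leq_addr ?leq_addl //.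
by rewrite /upd eqxx /local_coef (negPf (logn_dvd_neq0 pp i0 pi)) mul0r.
Qed.

Lemma mult_coef_full tau p s j : prime p -> (0 < j)%N -> tau p = Full s ->
  mult_coef tau (p * j) = s * mult_coef tau j.
Proof.
move=> pp j0 tp; have p0 := prime_gt0 pp.
have pj0 : (0 < p * j)%N by rewrite muln_gt0 p0.
have jpj : (j <= p * j)%N by rewrite leq_pmull.
rewrite (@mult_coef_split tau p (p * j + p).+1 (p * j)) ?ltnS ?pj0 ?leq_addl ?leq_addr //.
rewrite (@mult_coef_split tau p (p * j + p).+1 j) ?ltnS ?j0 ?leq_addl //=; last first.
  by rewrite (leq_trans jpj) ?leq_addr.
rewrite mulrA; congr (_ * _).
  rewrite lognM // logn_prime // eqxx tp /local_coef add1n /= exprS.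
  by case: (logn p j) => [|e] //=; rewrite expr0.
apply: eq_bigr => q /andP[qp qnp].
by rewrite lognM // (logn_prime _ pp) (negPf qnp).
Qed.

Lemma mult_coef_sqf tau p s j : prime p -> (0 < j)%N -> tau p = Sqf s ->
  mult_coef tau (p * j) = s * mult_coef (upd tau p Zero) j.
Proof.
move=> pp j0 tp; have p0 := prime_gt0 pp.
have pj0 : (0 < p * j)%N by rewrite muln_gt0 p0.
have jpj : (j <= p * j)%N by rewrite leq_pmull.
rewrite (@mult_coef_split tau p (p * j + p).+1 (p * j)) ?ltnS ?pj0 ?leq_addl ?leq_addr //.
rewrite (@mult_coef_split _ p (p * j + p).+1 j) ?ltnS ?j0 ?leq_addl //=; last first.
  by rewrite (leq_trans jpj) ?leq_addr.
rewrite mulrA; congr (_ * _).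
  rewrite lognM // logn_prime // eqxx tp /local_coef add1n /= /upd eqxx.
  by case: (logn p j) => [|e] //=; rewrite ?mulr1 ?mulr0.
apply: eq_bigr => q /andP[qp qnp].
by rewrite lognM // (logn_prime _ pp) (negPf qnp) /upd (negPf qnp).
Qed.

Lemma sum_dvd (F : nat -> R) p n : (0 < p)%N ->
  \sum_(1 <= i < n.+1 | (p %| i)%N) F i = \sum_(1 <= j < (n %/ p).+1) F (p * j)%N.
Proof.
move=> p0; elim: n => [|n IH]; first by rewrite div0n !big_geq.
rewrite [LHS]big_mkcond big_nat_recr //= -big_mkcond /= IH divnS //.
case: (boolP (p %| n.+1)%N) => [pn|]; last by rewrite addr0 add0n.
rewrite add1n [RHS]big_nat_recr //=; congr (_ + F _).
by rewrite -[LHS](divnK pn) mulnC divnS // pn add1n.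
Qed.

Lemma log_sum_ndvd tau p n : prime p ->
  \sum_(1 <= i < n.+1 | ~~ (p %| i)%N) mult_coef tau i / i%:R
  = log_sum (upd tau p Zero) n.
Proof.
move=> pp; rewrite big_mkcond; apply: eq_big_nat => i /andP[i0 _].
case: (boolP (p %| i)%N) => pi /=; last by rewrite mult_coef_upd_ndvd.
by rewrite mult_coef_zero // mul0r.
Qed.

Lemma log_sumID tau p n : prime p ->
  log_sum tau n = log_sum (upd tau p Zero) n
    + \sum_(1 <= j < (n %/ p).+1) mult_coef tau (p * j) / (p * j)%:R.
Proof.
move=> pp; rewrite {1}/log_sum (bigID (fun i => p %| i)%N) /= addrC.
by rewrite log_sum_ndvd // sum_dvd ?prime_gt0.
Qed.

(** Multiplying the Dirichlet series by 1 - s u removes p from it. For the sums: the multiples of p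
    up to n are p j with j <= n / p, and s comes out as a factor. *)
Lemma log_sum_full tau p s n : prime p -> tau p = Full s ->
  log_sum tau n = log_sum (upd tau p Zero) n + s / p%:R * log_sum tau (n %/ p).
Proof.
move=> pp tp; rewrite (log_sumID tau n pp); congr (_ + _).
rewrite /log_sum mulr_sumr; apply: eq_big_nat => j /andP[j0 _].
by rewrite (mult_coef_full pp j0 tp) natrM invfM; ring.
Qed.

Lemma log_sum_sqf tau p s n : prime p -> tau p = Sqf s ->
  log_sum tau n = log_sum (upd tau p Zero) n
    + s / p%:R * log_sum (upd tau p Zero) (n %/ p).
Proof.
move=> pp tp; rewrite (log_sumID tau n pp); congr (_ + _).
rewrite /log_sum mulr_sumr; apply: eq_big_nat => j /andP[j0 _].
by rewrite (mult_coef_sqf pp j0 tp) natrM invfM; ring.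
Qed.

Lemma eq_log_sum tau tau' n :
  (forall q, prime q -> (q <= n)%N -> tau q = tau' q) ->
  log_sum tau n = log_sum tau' n.
Proof.
move=> H; apply: eq_big_nat => i /andP[i0 iN]; congr (_ / _).
apply: eq_mult_coef => // q qp qi; apply: H => //.
by rewrite (leq_trans (dvdn_leq i0 qi)).
Qed.

Lemma log_sum0 tau : log_sum tau 0 = 0.
Proof. by rewrite /log_sum big_geq. Qed.

Lemma log_sum_none tau n :
  (forall q, prime q -> (q <= n)%N -> tau q = Zero) -> (0 < n)%N ->
  log_sum tau n = 1.
Proof.
move=> H n0; rewrite /log_sum big_ltn //= [X in _ + X]big1_seq ?addr0.
  rewrite /mult_coef big1_seq ?divr1 // => q /andP[qp].
  by rewrite /local_coef logn1.
move=> i /andP[_]; rewrite mem_index_iota => /andP[i1 iN].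
have pp := pdiv_prime i1; have i0 : (0 < i)%N by apply: leq_trans i1.
rewrite -(@eq_mult_coef (upd tau (pdiv i) Zero)) ?mult_coef_zero ?pdiv_dvd ?mul0r //.
move=> q qp qi; rewrite /upd; case: eqP => // ->; rewrite H //.
by rewrite (leq_trans (dvdn_leq i0 (pdiv_dvd i))).
Qed.

Lemma updK (tau : nat -> local_type R) p t t' : upd (upd tau p t) p t' =1 upd tau p t'.
Proof. by move=> q; rewrite /upd; case: eqP. Qed.

End LogSums.

Section Comparison.
Variable R : realType.
Implicit Types (tau : nat -> local_type R) (p n i j N : nat) (s : R) (t : local_type R).

Definition pos_upto tau N := forall n, (0 < n <= N)%N -> 0 < log_sum tau n.

Lemma log_sum_upd2 tau p t t' n :
  log_sum (upd (upd tau p t) p t') n = log_sum (upd tau p t') n.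
Proof. by apply: eq_log_sum => q _ _; rewrite updK. Qed.

Lemma log_sum_updE tau p t n : tau p = t -> log_sum (upd tau p t) n = log_sum tau n.
Proof. by move=> <-; apply: eq_log_sum => q _ _; rewrite /upd; case: eqP => // ->. Qed.

Lemma log_sum_upd_full tau p s n : prime p ->
  log_sum (upd tau p (Full s)) n = log_sum (upd tau p Zero) n
    + s / p%:R * log_sum (upd tau p (Full s)) (n %/ p).
Proof.
move=> pp; rewrite (@log_sum_full _ _ p s) ?log_sum_upd2 //.
by rewrite /upd eqxx.
Qed.

Lemma log_sum_upd_sqf tau p s n : prime p ->
  log_sum (upd tau p (Sqf s)) n = log_sum (upd tau p Zero) n
    + s / p%:R * log_sum (upd tau p Zero) (n %/ p).
Proof.
move=> pp; rewrite (@log_sum_sqf _ _ p s) ?log_sum_upd2 //.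
by rewrite /upd eqxx.
Qed.

Lemma pos_upto_ge0 tau N n : pos_upto tau N -> (n <= N)%N -> 0 <= log_sum tau n.
Proof.
case: n => [|n] h nN; first by rewrite log_sum0.
by apply/ltW/h; rewrite nN.
Qed.

(** The series without p is 1 + u times the series with -1 at p, so the sum at n gains the
    nonnegative term at n / p. *)
Lemma pos_upto_zero tau p N : prime p -> tau p = Full (-1) ->
  pos_upto tau N -> pos_upto (upd tau p Zero) N.
Proof.
move=> pp tp h n nN.
have := log_sum_full n pp tp; have := h _ nN.
have : 0 <= p%:R^-1 * log_sum tau (n %/ p).
  apply: mulr_ge0; first by rewrite invr_ge0.
  by apply: pos_upto_ge0 h _; rewrite (leq_trans (leq_div _ _)) //; case/andP: nN.
rewrite mulN1r mulNr; lra.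
Qed.

Lemma pos_upto_full1 tau p N : prime p -> tau p = Full (-1) ->
  pos_upto tau N -> pos_upto (upd tau p (Full 1)) N.
Proof.
move=> pp tp h; have h0 := pos_upto_zero pp tp h.
elim/ltn_ind => n IH nN; rewrite log_sum_upd_full // ltr_pwDl ?h0 //.
rewrite mul1r mulr_ge0 ?invr_ge0 //.
have [->|np] := posnP (n %/ p); first by rewrite log_sum0.
apply/ltW/IH; first by rewrite ltn_Pdiv ?prime_gt1 //; case/andP: nN.
by rewrite np (leq_trans (leq_div _ _)) //; case/andP: nN.
Qed.

(** (1 - s u)(1 + s u) = 1 - u^2 because s^2 = 1: unfolding the full recursion twice yields the
    squarefree sum plus p^(-2) times the new sum at n / p^2. *)
Lemma pos_upto_sqf_full tau p s N : prime p -> s * s = 1 -> tau p = Sqf s ->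
  pos_upto tau N -> pos_upto (upd tau p (Full s)) N.
Proof.
move=> pp ss tp h; elim/ltn_ind => n IH nN.
rewrite log_sum_upd_full // log_sum_upd_full // mulrDr addrA.
rewrite -log_sum_sqf // ltr_pwDl ?h // mulrA.
have -> : s / p%:R * (s / p%:R) = p%:R^-1 * p%:R^-1 :> R by rewrite mulrACA ss mul1r.
rewrite !mulr_ge0 ?invr_ge0 //.
have [->|np] := posnP (n %/ p %/ p); first by rewrite log_sum0.
have lt : (n %/ p %/ p < n)%N.
  by rewrite (leq_ltn_trans (leq_div _ _)) // ltn_Pdiv ?prime_gt1 //; case/andP: nN.
by apply/ltW/IH => //; rewrite np (leq_trans (ltnW lt)) //; case/andP: nN.
Qed.

Definition dominates t t' :=
  [\/ t' = t, t = Full (-1) /\ t' = Full 1, t = Full (-1) /\ t' = Zero |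
      exists2 s, s * s = 1 & t = Sqf s /\ t' = Full s].

(* Each admissible local change multiplies the Dirichlet series by a series
   with nonnegative coefficients. *)
Lemma pos_upto_dominates tau tau' N :
  (forall p, prime p -> (p <= N)%N -> dominates (tau p) (tau' p)) ->
  pos_upto tau N -> pos_upto tau' N.
Proof.
move=> H h.
pose hyb m q := if (q < m)%N then tau' q else tau q.
have step m : (m <= N.+1)%N -> pos_upto (hyb m) N.
  elim: m => [|m IH] mN; first exact: h.
  have /IH {}IH := ltnW mN.
  case: (boolP (prime m)) => [pm|npm]; last first.
    move=> n nN; rewrite (@eq_log_sum _ _ (hyb m)) ?IH // => q qp _.
    rewrite /hyb ltnS (leq_eqVlt q m); case: eqP => //= qm.
    by rewrite qm (negPf npm) in qp.
  suff K : pos_upto (upd (hyb m) m (tau' m)) N.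
    move=> n nN; rewrite (@eq_log_sum _ _ (upd (hyb m) m (tau' m))) ?K // => q qp _.
    by rewrite /hyb /upd ltnS (leq_eqVlt q m); case: eqP => //= ->.
  have tm : hyb m m = tau m by rewrite /hyb ltnn.
  case: (H m pm mN) => [->|[t1 ->]|[t1 ->]|[s ss [t1 ->]]].
  - by move=> n nN; rewrite log_sum_updE ?IH.
  - by apply: pos_upto_full1 => //; rewrite tm.
  - by apply: pos_upto_zero => //; rewrite tm.
  - by apply: pos_upto_sqf_full => //; rewrite tm.
move=> n nN; have {}nN' := nN; have /andP[_ nN2] := nN.
rewrite (@eq_log_sum _ _ (hyb N.+1)) ?step // => q _ qn.
by rewrite /hyb ltnS (leq_trans qn).
Qed.

(** The two Euler factors first differ at u^2. *)
Lemma eq_log_sum_sqf_full tau p s n : prime p -> (n < p * p)%N ->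
  log_sum (upd tau p (Sqf s)) n = log_sum (upd tau p (Full s)) n.
Proof.
move=> pp np; rewrite log_sum_upd_sqf // log_sum_upd_full //.
congr (_ + _ * _); rewrite log_sum_upd_full //.
by rewrite (@divn_small (n %/ p)) ?log_sum0 ?mulr0 ?addr0 // ltn_divLR ?prime_gt0.
Qed.

Lemma eq_log_sum_sqf_full_all tau tau' N n : (n <= N)%N ->
  (forall p, prime p -> (p <= N)%N -> tau p = tau' p \/
     (N < p * p)%N /\ exists s, tau p = Sqf s /\ tau' p = Full s) ->
  log_sum tau n = log_sum tau' n.
Proof.
move=> nN H.
pose hyb m q := if (q < m)%N then tau' q else tau q.
have step m : (m <= N.+1)%N -> log_sum tau n = log_sum (hyb m) n.
  elim: m => [|m IH] mN; first by apply: eq_log_sum.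
  rewrite IH ?(ltnW mN) //.
  case: (boolP (prime m)) => [pm|npm]; last first.
    apply: eq_log_sum => q qp _; rewrite /hyb ltnS (leq_eqVlt q m); case: eqP => //= qm.
    by rewrite qm (negPf npm) in qp.
  have tm : hyb m m = tau m by rewrite /hyb ltnn.
  transitivity (log_sum (upd (hyb m) m (tau' m)) n); last first.
    apply: eq_log_sum => q qp _.
    by rewrite /hyb /upd [RHS]/= ltnS (leq_eqVlt q m); case: eqP => //= ->.
  case: (H m pm mN) => [<-|[Nm [s [t1 ->]]]]; first by rewrite log_sum_updE.
  rewrite -eq_log_sum_sqf_full ?(leq_ltn_trans nN) //.
  by rewrite log_sum_updE // tm.
rewrite (step N.+1) //; apply: eq_log_sum => q _ qn.
by rewrite /hyb ltnS (leq_trans qn).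
Qed.

Lemma mult_coef_cmul (f : nat -> R) i :
  f 1%N = 1 -> (forall m n, (0 < m)%N -> (0 < n)%N -> f (m * n)%N = f m * f n) ->
  (0 < i)%N -> mult_coef (fun p => Full (f p)) i = f i.
Proof.
move=> f1 fM; elim/ltn_ind: i => i IH i0.
have [i1|i1] := leqP i 1.
  have -> : i = 1%N by apply/eqP; rewrite eqn_leq i1.
  rewrite f1 /mult_coef big1_seq // => q _.
  by rewrite /local_coef logn1.
have pp := pdiv_prime i1; have p0 := prime_gt0 pp.
have e : (i = pdiv i * (i %/ pdiv i))%N by rewrite mulnC divnK ?pdiv_dvd.
have q0 : (0 < i %/ pdiv i)%N by rewrite divn_gt0 // dvdn_leq // pdiv_dvd.
rewrite e (@mult_coef_full _ _ _ (f (pdiv i))) // IH ?fM //.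
by rewrite ltn_Pdiv // prime_gt1.
Qed.

Lemma log_sum_cmul (f : nat -> R) n :
  f 1%N = 1 -> (forall m n, (0 < m)%N -> (0 < n)%N -> f (m * n)%N = f m * f n) ->
  log_sum (fun p => Full (f p)) n = \sum_(1 <= i < n.+1) f i / i%:R.
Proof.
by move=> f1 fM; apply: eq_big_nat => i /andP[i0 _]; rewrite mult_coef_cmul.
Qed.

End Comparison.

(** * A hypercontractive moment bound *)

(** The ratio of the two binomials is multiplied by (2k - 2j - 1)/(2j + 1) <= 2k - 1 when j grows by
    one. *)
Lemma bin_double_le k j : (j <= k)%N ->
  ('C(k.*2, j.*2) <= 'C(k, j) * k.*2.-1 ^ j)%N.
Proof.
elim: j => [|j IH] jk; first by rewrite !bin0.
have {}IH := IH (ltnW jk).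
have e1 : ('C(k.*2, j.+1.*2) * (j.*2.+1 * j.*2.+2)
           = 'C(k.*2, j.*2) * ((k.*2 - j.*2) * (k.*2 - j.*2.+1)))%N.
  rewrite doubleS; have h1 := mul_bin_left k.*2 j.*2; have h2 := mul_bin_left k.*2 j.*2.+1.
  by nia.
have e2 := mul_bin_left k j.
have : (j.*2.+1 * j.*2.+2 * 'C(k.*2, j.+1.*2) <=
        j.*2.+1 * j.*2.+2 * ('C(k, j.+1) * k.*2.-1 ^ j.+1))%N.
  have -> : (j.*2.+1 * j.*2.+2 * ('C(k, j.+1) * k.*2.-1 ^ j.+1)
     = 2 * j.*2.+1 * k.*2.-1 * ((k - j) * 'C(k, j)) * k.*2.-1 ^ j)%N.
    by rewrite -e2 expnS -[in RHS]mul2n -!mul2n; nia.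
  rewrite [X in (X <= _)%N]mulnC e1 mulnC.
  have -> : (k.*2 - j.*2 = 2 * (k - j))%N by rewrite -doubleB mul2n.
  apply: (@leq_trans (2 * (k - j) * (k.*2 - j.*2.+1) * ('C(k, j) * k.*2.-1 ^ j))%N).
    by rewrite leq_mul2l IH orbT.
  have h : (k.*2 - j.*2.+1 <= j.*2.+1 * k.*2.-1)%N.
    by apply: (@leq_trans k.*2.-1); [lia | rewrite leq_pmull].
  have -> : (2 * j.*2.+1 * k.*2.-1 * ((k - j) * 'C(k, j)) * k.*2.-1 ^ j =
     2 * (k - j) * (j.*2.+1 * k.*2.-1) * ('C(k, j) * k.*2.-1 ^ j))%N by ring.
  by rewrite leq_mul2r leq_mul2l h !orbT.
by rewrite leq_pmul2l.
Qed.

Section Hypercontractivity.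
Variable R : realType.

Lemma sum_even (F : nat -> R) k : (forall j, odd j -> F j = 0) ->
  \sum_(i < k.*2.+1) F i = \sum_(j < k.+1) F j.*2.
Proof.
move=> H; elim: k => [|k IH]; first by rewrite !big_ord_recr !big_ord0.
rewrite doubleS 2!big_ord_recr IH [RHS]big_ord_recr /=.
by rewrite (H k.*2.+1) /= ?odd_double // addr0.
Qed.

(** Two-point hypercontractive inequality: averaging over the sign of v kills the odd powers, and
    the even ones are compared coefficient by coefficient through [bin_double_le]. *)
Lemma two_point (u v : R) k :
  (u + v) ^+ k.*2 + (u - v) ^+ k.*2 <= 2 * (u ^+ 2 + k.*2.-1%:R * v ^+ 2) ^+ k.
Proof.
rewrite !exprDn -big_split /=.
pose F i := u ^+ (k.*2 - i) * v ^+ i *+ 'C(k.*2, i)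
          + u ^+ (k.*2 - i) * (- v) ^+ i *+ 'C(k.*2, i).
rewrite (@sum_even F); last first.
  by move=> j oj; rewrite /F exprNn -signr_odd oj expr1 mulN1r mulrN mulNrn subrr.
rewrite mulr_sumr; apply: ler_sum => j _; have jk : (j <= k)%N by rewrite -ltnS ltn_ord.
rewrite /F exprNn -signr_odd odd_double expr0 mul1r -doubleB.
rewrite -!mul2n !exprM [(_%:R * _) ^+ _]exprMn !mul2n.
set a := (u ^+ 2) ^+ _; set b := (v ^+ 2) ^+ _.
have ab : 0 <= a * b by rewrite mulr_ge0 // exprn_ge0 // sqr_ge0.
have := bin_double_le jk; rewrite -(ler_nat R) natrM natrX => h.
have := ler_wpM2r ab h; rewrite -!(mulr_natr (_ * _)); lra.
Qed.

(** Jensen's inequality by induction on k: the defect at each step is t (1 - t) (x - y) (x^k - y^k),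
    whose two differences have the same sign. *)
Lemma expr_convex (t x y : R) k : 0 <= t <= 1 -> 0 <= x -> 0 <= y ->
  (t * x + (1 - t) * y) ^+ k <= t * x ^+ k + (1 - t) * y ^+ k.
Proof.
move=> /andP[t0 t1] x0 y0; elim: k => [|k IH]; first by rewrite !expr0; lra.
have t1' : 0 <= 1 - t by lra.
rewrite exprS; apply: (@le_trans _ _ ((t * x + (1 - t) * y) * (t * x ^+ k + (1 - t) * y ^+ k))).
  by rewrite ler_wpM2l // addr_ge0 // mulr_ge0.
have h : 0 <= (x - y) * (x ^+ k - y ^+ k).
  have [xy|/ltW xy] := leP x y.
    by rewrite mulr_le0 ?subr_le0 // lerXn2r.
  by rewrite mulr_ge0 ?subr_ge0 // lerXn2r.
rewrite -subr_ge0 (_ : _ - _ = t * (1 - t) * ((x - y) * (x ^+ k - y ^+ k))); last first.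
  by rewrite !exprS; ring.
by apply: mulr_ge0 h; apply: mulr_ge0.
Qed.

(** Expectation over independent fair signs on [ps], as a finite recursion that keeps measure theory
    out of the moment estimates; coordinates outside [ps] stay 0. *)
Fixpoint avg (ps : seq nat) (F : (nat -> R) -> R) : R :=
  if ps is p :: ps' then
    (avg ps' (fun s => F (upd s p 1)) + avg ps' (fun s => F (upd s p (-1)))) / 2
  else F (fun=> 0).

Lemma le_avg ps (F F' : (nat -> R) -> R) :
  (forall s, F s <= F' s) -> avg ps F <= avg ps F'.
Proof.
elim: ps F F' => [|p ps IH] F F' H //=.
have := IH _ _ (fun s => H (upd s p 1)); have := IH _ _ (fun s => H (upd s p (-1))).
lra.
Qed.

Lemma eq_avg ps (F F' : (nat -> R) -> R) : F =1 F' -> avg ps F = avg ps F'.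
Proof. by move=> H; apply/eqP; rewrite eq_le !le_avg // => s; rewrite H. Qed.

Lemma avgD ps F F' : avg ps (fun s => F s + F' s) = avg ps F + avg ps F'.
Proof. by elim: ps F F' => [|p ps IH] F F' //=; rewrite !IH; field. Qed.

Lemma avgZ ps c F : avg ps (fun s => c * F s) = c * avg ps F.
Proof. by elim: ps F => [|p ps IH] F //=; rewrite !IH; field. Qed.

(** Minkowski's inequality in L^k without k-th roots: A + m B is a + m b times a convex combination
    of A / a and B / b, and the k-th power is convex. *)
Lemma avg_minkowski ps (A B : (nat -> R) -> R) (a b m : R) k :
  (forall s, 0 <= A s) -> (forall s, 0 <= B s) -> 0 < a -> 0 < b -> 0 <= m ->
  avg ps (fun s => A s ^+ k) <= a ^+ k -> avg ps (fun s => B s ^+ k) <= b ^+ k ->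
  avg ps (fun s => (A s + m * B s) ^+ k) <= (a + m * b) ^+ k.
Proof.
move=> A0 B0 a0 b0 m0 hA hB; have mb : 0 <= m * b by rewrite mulr_ge0 // ltW.
have ab : 0 < a + m * b by lra.
pose t := a / (a + m * b).
have t01 : 0 <= t <= 1 by rewrite /t divr_ge0 ?(ltW a0) ?(ltW ab) //= ler_pdivrMr //; lra.
have t1 : 1 - t = m * b / (a + m * b) by rewrite /t; field; lra.
apply: (@le_trans _ _ (avg ps (fun s => (a + m * b) ^+ k *
   (t * (a ^- k * A s ^+ k) + (1 - t) * (b ^- k * B s ^+ k))))).
  apply: le_avg => s.
  have -> : A s + m * B s = (a + m * b) * (t * (A s / a) + (1 - t) * (B s / b)).
    by rewrite t1 /t; field; rewrite !gt_eqF.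
  rewrite exprMn ler_wpM2l ?exprn_ge0 ?(ltW ab) //.
  have := @expr_convex t (A s / a) (B s / b) k t01.
  rewrite !exprMn !exprVn ![_ / _ ^+ k]mulrC; apply; by rewrite divr_ge0 // ltW.
rewrite avgZ avgD !avgZ.
have ak : a ^- k * avg ps (fun s => A s ^+ k) <= 1.
  by rewrite mulrC ler_pdivrMr ?exprn_gt0 // mul1r.
have bk : b ^- k * avg ps (fun s => B s ^+ k) <= 1.
  by rewrite mulrC ler_pdivrMr ?exprn_gt0 // mul1r.
rewrite -[leRHS]mulr1 ler_wpM2l ?exprn_ge0 ?(ltW ab) //.
move: t01 => /andP[t0 t1']; have t1'' : 0 <= 1 - t by lra.
have := ler_wpM2l t0 ak; have := ler_wpM2l t1'' bk; lra.
Qed.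

(* chaos p1 .. pr s i is the Rademacher polynomial obtained by summing
   (prod of s p / p over p in b) * g (i / b) over sublists b; weight bounds the
   second moment of the same polynomial with s p replaced by sqrt m * s p. *)
Section Chaos.
Variables (I : Type) (div : nat -> I -> option I) (g G : I -> R).
Hypothesis G_gt0 : forall i, 0 < G i.
Hypothesis le_gG : forall i, g i ^+ 2 <= G i.

Fixpoint chaos (ps : seq nat) (s : nat -> R) (i : I) : R :=
  if ps is p :: ps' then
    chaos ps' s i + (if div p i is Some j then s p / p%:R * chaos ps' s j else 0)
  else g i.

Fixpoint weight (m : R) (ps : seq nat) (i : I) : R :=
  if ps is p :: ps' then
    weight m ps' i + (if div p i is Some j then m / p%:R ^+ 2 * weight m ps' j else 0)
  else G i.

Lemma weight_gt0 m ps i : 0 <= m -> 0 < weight m ps i.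
Proof.
move=> m0; elim: ps i => [|p ps IH] i //=; rewrite ltr_pwDl //.
by case: (div p i) => // j; rewrite mulr_ge0 ?divr_ge0 ?exprn_ge0 // ltW.
Qed.

Lemma eq_chaos ps s s' i : {in ps, s =1 s'} -> chaos ps s i = chaos ps s' i.
Proof.
elim: ps i => [|p ps IH] i H //=.
have H' : {in ps, s =1 s'} by move=> q qps; apply: H; rewrite inE qps orbT.
rewrite (IH i H') (H p) ?mem_head //.
by case: (div p i) => // j; rewrite (IH j H').
Qed.

Lemma chaos_upd ps s p t i : p \notin ps -> chaos ps (upd s p t) i = chaos ps s i.
Proof.
move=> pps; apply: eq_chaos => q qps; rewrite /upd; case: eqP => // qp.
by rewrite -qp qps in pps.
Qed.

(** Bonami's induction: with the other signs fixed, the two-point inequality handles the sign of p;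
    the resulting sum of two squares is bounded in L^k by Minkowski's inequality and the induction
    hypothesis. *)
Lemma hypercontractivity k ps i : uniq ps ->
  avg ps (fun s => chaos ps s i ^+ k.*2) <= weight k.*2.-1%:R ps i ^+ k.
Proof.
elim: ps i => [|p ps IH] i.
  by move=> _ /=; rewrite -mul2n exprM lerXn2r // ?nnegrE ?sqr_ge0 // ltW.
rewrite cons_uniq => /andP[pps ups] /=.
have {}IH j := IH j ups.
case E: (div p i) => [j|]; last first.
  rewrite addr0 (@eq_avg _ _ (fun s => chaos ps s i ^+ k.*2)); last first.
    by move=> s; rewrite chaos_upd // addr0.
  rewrite [X in _ + X](@eq_avg _ _ (fun s => chaos ps s i ^+ k.*2)); last first.
    by move=> s; rewrite chaos_upd // addr0.
  by have := IH i; lra.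
pose U s := chaos ps s i; pose V s := p%:R^-1 * chaos ps s j.
rewrite -avgD -[X in X <= _]mulrC -avgZ.
apply: (@le_trans _ _ (avg ps (fun s => (U s ^+ 2 + k.*2.-1%:R * V s ^+ 2) ^+ k))).
  apply: le_avg => s; rewrite !chaos_upd // /upd eqxx mulN1r mulNr mul1r.
  by have := two_point (U s) (V s) k; rewrite /U /V; lra.
have -> : k.*2.-1%:R / p%:R ^+ 2 * weight k.*2.-1%:R ps j
        = k.*2.-1%:R * (p%:R ^- 2 * weight k.*2.-1%:R ps j) by rewrite mulrA.
(* For p = 0 the convention 0^-1 = 0 makes the second summand vanish, while Minkowski needs a
   positive bound for it. *)
have [p0|p0] := posnP p.
  rewrite (@eq_avg _ _ (fun s => chaos ps s i ^+ k.*2)); last first.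
    by move=> s; rewrite /U /V p0 mulr0n invr0 mul0r expr0n mulr0 addr0 -exprM mul2n.
  by rewrite p0 mulr0n expr0n invr0 mul0r mulr0 addr0.
apply: avg_minkowski => //.
- by move=> s; rewrite sqr_ge0.
- by move=> s; rewrite sqr_ge0.
- exact: weight_gt0.
- by rewrite mulr_gt0 ?invr_gt0 ?exprn_gt0 ?ltr0n ?weight_gt0.
- by rewrite (@eq_avg _ _ (fun s => chaos ps s i ^+ k.*2)) // => s; rewrite -exprM mul2n.
- rewrite (@eq_avg _ _ (fun s => (p%:R ^- 2) ^+ k * chaos ps s j ^+ k.*2)).
    by rewrite avgZ exprMn ler_wpM2l // exprn_ge0 // invr_ge0 exprn_ge0.
  move=> s; have -> : V s ^+ 2 = p%:R ^- 2 * chaos ps s j ^+ 2 by rewrite exprMn exprVn.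
  by rewrite [LHS]exprMn -[_ ^+ 2 ^+ k in LHS]exprM mul2n.
Qed.

Lemma chaos_tail k ps i (t : R) : uniq ps -> 0 < t ->
  avg ps (fun s => (t <= `|chaos ps s i|)%R%:R) <= (weight k.*2.-1%:R ps i / t ^+ 2) ^+ k.
Proof.
move=> ups t0; rewrite exprMn exprVn -exprM mul2n.
rewrite ler_pdivlMr ?exprn_gt0 // mulrC -avgZ.
apply: le_trans (hypercontractivity k i ups); apply: le_avg => s.
rewrite -mul2n !exprM -[chaos ps s i ^+ 2]real_normK ?num_real //.
case: (leP t) => ht; last by rewrite /= mulr0 exprn_ge0 // exprn_ge0.
by rewrite /= mulr1 lerXn2r ?nnegrE ?exprn_ge0 ?(ltW t0) // lerXn2r ?nnegrE ?(ltW t0).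
Qed.

End Chaos.
End Hypercontractivity.

(** * Interval bounds on a grid *)

(* A cell (b, lo, hi) asserts lo <= sc * S n <= hi for all n from b up to the
   start of the next cell; the last cell of a list extends to infinity. *)
Definition cell := (Z * Z * Z)%type.

Section GridCode.
Local Open Scope Z_scope.

Definition next_start (L : seq cell) (B : Z) : Z :=
  match L with (b, _, _) :: _ => b | nil => B end.

(** The quotient n / p never decreases along the sweep, so cells lying wholly before it are
    discarded for good. *)
Fixpoint advance (q : Z) (L : seq cell) : seq cell :=
  match L with
  | _ :: L' => match L' with
               | (b, _, _) :: _ => if Z.leb b q then advance q L' else L
               | nil => L
               end
  | nil => nil
  end.

(** [B] is where the processed range ends. With [None] more cells are waiting in the back of the
    queue, so running off the list proves nothing and the call fails. *)
Fixpoint hull (q : Z) (L : seq cell) (B : option Z) (c d : Z) : option (Z * Z) :=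
  match L with
  | (b, lo, hi) :: L' =>
      if Z.leb b q then hull q L' B (Z.min c lo) (Z.max d hi) else Some (c, d)
  | nil => match B with
           | Some B => if Z.ltb q B then Some (c, d) else None
           | None => None
           end
  end.

(** A quotient 0 is covered by S 0 = 0, which is why the hull then starts from the interval reduced
    to 0. *)
Definition hull_from (q0 q1 : Z) (L : seq cell) (B : option Z) : option (Z * Z) :=
  match L with
  | (b, lo, hi) :: L' =>
      if Z.eqb q0 0 then (if Z.leb b 1 then hull q1 L B 0 0 else None)
      else if Z.leb b q0 then hull q1 L' B lo hi else None
  | nil => None
  end.

(* In the infinite cell S (n / p) is bounded by the very bounds sought for S n:
   enlarge them until they are stable. *)
Fixpoint fixp (fuel : nat) (p lo hi c d : Z) : Z * Z :=
  match fuel with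
  | O => (c, d)
  | S f => let c' := Z.min c (lo + (- d) / p) in
           let d' := Z.max d (hi - c / p) in
           if Z.eqb c' c && Z.eqb d' d then (c, d) else fixp f p lo hi c' d'
  end.

(** Nothing depends on the fuel being sufficient: [sweep] tests the stability of the interval
    returned. *)
Definition fixp_fuel := 200%nat.

(** Two-list queue; the back is reversed only when the front is down to at most three cells. *)
Definition refill (L back : seq cell) : seq cell * seq cell :=
  match L with
  | _ :: _ :: _ :: _ :: _ => (L, back)
  | _ => (L ++ rev back, nil)
  end.

Definition all_back (back : seq cell) (b : Z) : option Z :=
  match back with nil => Some b | _ => None end.

(* front ++ rev back is the queue of the processed cells still needed to bound
   S (n / p); out is the reversed output. *)
Fixpoint sweep (p : Z) (old front back out : seq cell) : option (seq cell) :=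
  match old with
  | nil => None
  | (b, lo, hi) :: nil =>
      let q0 := b / p in
      match hull_from q0 (b - 1) (advance q0 (front ++ rev back)) (Some b) with
      | None => None
      | Some cd =>
          let cd := fixp fixp_fuel p lo hi cd.1 cd.2 in
          let lo' := lo + (- cd.2) / p in let hi' := hi - cd.1 / p in
          if Z.ltb 0 q0 && Z.leb cd.1 lo' && Z.leb hi' cd.2
          then Some (rev ((b, lo', hi') :: out)) else None
      end
  | (b, lo, hi) :: ((b', _, _) :: _) as old' =>
      let q0 := b / p in let q1 := (b' - 1) / p in
      if Z.eqb q1 0 then
        let x := (b, lo, hi) in sweep p old' front (x :: back) (x :: out)
      else
        let fb := refill (advance q0 front) back in
        let front := advance q0 fb.1 in
        match hull_from q0 q1 front (all_back fb.2 b) with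
        | None => None
        | Some cd =>
            let x := (b, lo + (- cd.2) / p, hi - cd.1 / p) in
            sweep p old' front (x :: fb.2) (x :: out)
        end
  end.

(* Unit cells up to 64, then 32 cells per dyadic block. *)
Fixpoint starts (fuel : nat) (zmax b s : Z) : seq cell :=
  match fuel with
  | O => nil
  | S f => (b, s, s) :: if Z.ltb b zmax then
      starts f zmax (if Z.ltb b 64 then b + 1 else b + 2 ^ (Z.log2 b - 5)) s else nil
  end.

Fixpoint sweeps (ps : seq Z) (L : seq cell) : option (seq cell) :=
  match ps with
  | nil => Some L
  | p :: ps' => match sweep p L nil nil nil with
                | Some L' => sweeps ps' L' | None => None end
  end.
End GridCode.
Arguments fixp : simpl never.

(** * Soundness of the interval sweep *)

Section GridSpec.
Variable R : realType.

Definition ZtoR (z : Z) : R := (int_of_Z z)%:~R.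

Lemma ZtoRD x y : ZtoR (x + y)%BZ = ZtoR x + ZtoR y.
Proof. by rewrite /ZtoR -intrD -raddfD. Qed.
Lemma ZtoRN x : ZtoR (- x)%BZ = - ZtoR x.
Proof. by rewrite /ZtoR -mulrNz -raddfN. Qed.
Lemma ZtoRB x y : ZtoR (x - y)%BZ = ZtoR x - ZtoR y.
Proof. by rewrite -ZtoRN -ZtoRD. Qed.
Lemma ZtoRM x y : ZtoR (x * y)%BZ = ZtoR x * ZtoR y.
Proof. by rewrite /ZtoR -intrM -rmorphM. Qed.
Lemma ZtoR_le x y : (x <= y)%BZ -> ZtoR x <= ZtoR y.
Proof. by move=> h; rewrite /ZtoR ler_int; lia. Qed.
Lemma ZtoR_gt0 z : (0 < z)%BZ -> 0 < ZtoR z.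
Proof. by move=> h; rewrite /ZtoR ltr0z; lia. Qed.
Lemma ZtoR_nat n : ZtoR (Z.of_nat n) = n%:R.
Proof. by rewrite /ZtoR pmulrn; congr (_%:~R); lia. Qed.
Lemma ZtoR0 : ZtoR 0 = 0. Proof. by []. Qed.

Lemma ZtoR_div x p : (0 < p)%BZ -> ZtoR (x / p)%BZ <= ZtoR x / ZtoR p.
Proof.
move=> p0; have p0' : 0 < ZtoR p by rewrite -ZtoR0 /ZtoR ltr_int; lia.
rewrite ler_pdivlMr // -ZtoRM; apply: ZtoR_le.
by rewrite Z.mul_comm; apply: Z.mul_div_le.
Qed.

Variable (sc : R).

Definition bounds_between (S : nat -> R) (b B lo hi : Z) := forall n : nat,
  (b <= Z.of_nat n < B)%BZ -> ZtoR lo <= sc * S n <= ZtoR hi.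

Definition bounds_from (S : nat -> R) (b lo hi : Z) := forall n : nat,
  (b <= Z.of_nat n)%BZ -> ZtoR lo <= sc * S n <= ZtoR hi.

Fixpoint valid (S : nat -> R) (L : seq cell) (B : Z) : Prop :=
  match L with
  | nil => True
  | (b, lo, hi) :: L' => bounds_between S b (next_start L' B) lo hi /\ valid S L' B
  end.

Fixpoint valid_inf (S : nat -> R) (L : seq cell) : Prop :=
  match L with
  | nil => False
  | (b, lo, hi) :: L' =>
      match L' with
      | nil => bounds_from S b lo hi
      | (b', _, _) :: _ => bounds_between S b b' lo hi /\ valid_inf S L'
      end
  end.

Lemma valid_cat S L L' B :
  valid S (L ++ L') B <-> valid S L (next_start L' B) /\ valid S L' B.
Proof.
elim: L => [|[[b lo] hi] L IH] /=; first by split=> // -[].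
have -> : next_start (L ++ L') B = next_start L (next_start L' B) by case: (L).
tauto.
Qed.

Lemma valid_inf_rev S out b lo hi : bounds_from S b lo hi -> valid S (rev out) b ->
  valid_inf S (rev ((b, lo, hi) :: out)).
Proof.
rewrite rev_cons -cats1; elim: (rev out) => [|[[b1 lo1] hi1] L IH] //= h [h1 h2].
by case: L IH h1 h2 => [|[[b2 lo2] hi2] L] /= IH h1 h2; split=> //; apply: IH.
Qed.

Lemma advance_suffix q L : exists L0, L = L0 ++ advance q L.
Proof.
elim: L => [|x L [L0 IH]] /=; first by exists nil.
case: L IH => [|[[b lo] hi] L] IH; first by exists nil.
case: Z.leb; last by exists nil.
by exists (x :: L0); rewrite cat_cons -IH.
Qed.

Lemma valid_advance S q L L' B : valid S (L ++ L') B -> valid S (advance q L ++ L') B.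
Proof.
by case: (advance_suffix q L) => L0 {1}->; rewrite -catA valid_cat => -[].
Qed.

Lemma refill_cat L back :
  (refill L back).1 ++ rev (refill L back).2 = L ++ rev back.
Proof. by case: L => [|a [|b [|c [|d L]]]] //=; rewrite cats0. Qed.

Lemma hullP S q L B B' c d c' d' : valid S L B ->
  (forall x, B' = Some x -> x = B) ->
  hull q L B' c d = Some (c', d') ->
  [/\ (c' <= c)%BZ, (d <= d')%BZ & forall n : nat,
    (next_start L B <= Z.of_nat n <= q)%BZ -> ZtoR c' <= sc * S n <= ZtoR d'].
Proof.
move=> + HB; elim: L c d => [|[[b lo] hi] L IH] c d /=.
  case: B' HB => // x /(_ x erefl) ->.
  by move=> _; case: ifP => // h [<- <-]; split; try lia; move=> n; lia.
move=> [h1 h2]; case: ifP => hb.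
  move=> /(IH _ _ h2) [e1 e2 e3]; split; try lia.
  move=> n hn; have [hn'|hn'] := Z_lt_le_dec (Z.of_nat n) (next_start L B).
    have /h1/andP[l1 l2] : (b <= Z.of_nat n < next_start L B)%BZ by lia.
    apply/andP; split; [apply: le_trans l1|apply: (le_trans l2)]; apply: ZtoR_le; lia.
  by apply: e3; lia.
by move=> [<- <-]; split; try lia; move=> n; lia.
Qed.

Lemma hull_fromP S q0 q1 L B B' c d : valid S L B -> S 0%N = 0 ->
  (forall x, B' = Some x -> x = B) -> (0 <= q0)%BZ ->
  hull_from q0 q1 L B' = Some (c, d) ->
  forall n : nat, (q0 <= Z.of_nat n <= q1)%BZ -> ZtoR c <= sc * S n <= ZtoR d.
Proof.
case: L => [|[[b lo] hi] L] // hv S0 HB q00; rewrite /hull_from.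
case: ifP => hq.
  case: ifP => // hb /(hullP hv HB) [e1 e2 e3] n hn.
  case: n hn => [|n] hn; last by apply: e3; rewrite /=; lia.
  by rewrite S0 mulr0 -ZtoR0 !ZtoR_le.
case: ifP => // hb; case: hv => h1 h2 /(hullP h2 HB) [e1 e2 e3] n hn.
have [hn'|hn'] := Z_lt_le_dec (Z.of_nat n) (next_start L B).
  have /h1/andP[l1 l2] : (b <= Z.of_nat n < next_start L B)%BZ by lia.
  by apply/andP; split; [apply: le_trans l1|apply: (le_trans l2)]; apply: ZtoR_le.
by apply: e3; lia.
Qed.

Lemma fixp_le f p lo hi c d :
  ((fixp f p lo hi c d).1 <= c)%BZ /\ (d <= (fixp f p lo hi c d).2)%BZ.
Proof.
elim: f c d => [|f IH] c d; rewrite /fixp -/fixp; first by split; apply: Z.le_refl.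
case: ifP => _; first by split; apply: Z.le_refl.
by have [] := IH (Z.min c (lo + - d / p)) (Z.max d (hi - c / p)); lia.
Qed.

Section Sweep.
Variables (Sold Snew : nat -> R) (p : nat).
Hypothesis p_gt1 : (1 < p)%N.
Hypothesis Snew0 : Snew 0%N = 0.
Hypothesis Snew_rec : forall n, Snew n = Sold n - p%:R^-1 * Snew (n %/ p)%N.

Let P := Z.of_nat p.

(** [Z.div] rounds down, so the lower end adds (- d) / P and the upper end subtracts c / P: both
    errors go outward. *)
Lemma bounds_step n lo hi c d :
  ZtoR lo <= sc * Sold n <= ZtoR hi -> ZtoR c <= sc * Snew (n %/ p)%N <= ZtoR d ->
  ZtoR (lo + (- d) / P)%BZ <= sc * Snew n <= ZtoR (hi - c / P)%BZ.
Proof.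
move=> /andP[a1 a2] /andP[b1 b2]; have P0 : (0 < P)%BZ by rewrite /P; lia.
have := ZtoR_div (- d) P0; have := ZtoR_div c P0.
rewrite !ZtoRD !ZtoRN {2 4}/P ZtoR_nat Snew_rec.
have p0 : 0 < p%:R^-1 :> R by rewrite invr_gt0 ltr0n; lia.
have := ler_wpM2l (ltW p0) b1; have := ler_wpM2l (ltW p0) b2.
rewrite mulrBr mulrCA ![_ / _]mulrC mulrN => h1 h2 h3 h4.
by apply/andP; split; lra.
Qed.

Lemma divZ_nat n : Z.of_nat (n %/ p) = (Z.of_nat n / P)%BZ.
Proof.
have e := divn_eq n p; have h : (n %% p < p)%N by rewrite ltn_mod; lia.
apply: (Z.div_unique _ _ _ (Z.of_nat (n %% p))); first by rewrite /P; lia.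
by rewrite {1}e /P; lia.
Qed.

Lemma sweepP old front back out L : valid_inf Sold old ->
  valid Snew (front ++ rev back) (next_start old 0) ->
  valid Snew (rev out) (next_start old 0) -> (0 <= next_start old 0)%BZ ->
  (forall b lo hi, (b, lo, hi) \in old -> (0 <= b)%BZ) ->
  sweep P old front back out = Some L -> valid_inf Snew L.
Proof.
have P0 : (1 < P)%BZ by rewrite /P; lia.
elim: old front back out => [//|[[b lo] hi] old IH] front back out.
case: old IH => [|[[b' lo'] hi'] old] IH.
  move=> hold hq hout b0 _; rewrite [sweep _ _ _ _ _]/=.
  case E : hull_from => [[c0 d0]|//].
  rewrite [(c0, d0).1]/= [(c0, d0).2]/=; case Efix : (fixp _ _ _ _ _ _) => [c d].
  rewrite [(c, d).1]/= [(c, d).2]/=; case: ifP => // /andP[/andP[q0 hc] hd] [<-].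
  apply: valid_inf_rev => //.
  have hadv : valid Snew (advance (b / P) (front ++ rev back)) b.
    by have := @valid_advance Snew (b / P) (front ++ rev back) nil b; rewrite !cats0; apply.
  have b00 : (0 <= b / P)%BZ by lia.
  have hh := hull_fromP hadv Snew0 _ b00 E.
  have [f1 f2] := fixp_le fixp_fuel P lo hi c0 d0; rewrite Efix /= in f1 f2.
  (* In the infinite cell the recursion closes on itself: n / p either falls before b, where the
     queue applies, or is a smaller index of the same cell, where the stable interval applies. *)
  elim/ltn_ind => n IHn hn; apply: bounds_step; first exact: hold.
  have [hnb|hnb] := Z_lt_le_dec (Z.of_nat (n %/ p)) b.
    have /hh : (b / P <= Z.of_nat (n %/ p) <= b - 1)%BZ.
      split; last by lia.
      by rewrite divZ_nat; apply: Z.div_le_mono => //; apply: Z.lt_trans P0.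
    move=> /(_ (fun x e => esym (Some_inj e)))/andP[l1 l2].
    by apply/andP; split; [apply: le_trans l1|apply: (le_trans l2)]; apply: ZtoR_le; lia.
  (* The test 0 < b / p excludes b = 0, so n > 0 and n / p < n. *)
  have hb0 : (0 < b)%BZ.
    have [e|ne] := Z.eq_dec b 0; last by rewrite /= in b0; lia.
    by rewrite e Z.div_0_l in q0 => //; lia.
  have /IHn/(_ hnb)/andP[l1 l2] : (n %/ p < n)%N by rewrite ltn_Pdiv //; lia.
  by apply/andP; split; [apply: le_trans l1|apply: (le_trans l2)]; apply: ZtoR_le; lia.
move=> hold hq hout b0 hbs.
have b'0 : (0 <= b')%BZ by apply: (hbs b' lo' hi'); rewrite !inE eqxx orbT.
have hbs' : forall b1 lo1 hi1, (b1, lo1, hi1) \in (b', lo', hi') :: old -> (0 <= b1)%BZ.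
  by move=> b1 lo1 hi1 h; apply: (hbs b1 lo1 hi1); rewrite inE h orbT.
have [hc hold'] := hold.
have push x y (fr bk : seq cell) : bounds_between Snew b b' x y -> valid Snew (fr ++ rev bk) b ->
    valid Snew (fr ++ rev ((b, x, y) :: bk)) b'.
  move=> h1 h2; rewrite rev_cons -cats1 catA valid_cat /=; split=> //; exact: conj h1 I.
rewrite [sweep _ _ _ _ _]/=; case: ifP => hq1.
  have okb : bounds_between Snew b b' lo hi.
    move=> n hn; rewrite Snew_rec divn_small; first by rewrite Snew0 mulr0 subr0; apply: hc.
    have /Z.div_small_iff : ((b' - 1) / P = 0)%BZ by apply/Z.eqb_eq.
    by move=> /(_ ltac:(lia)); move: hn; rewrite /P; lia.
  by apply: IH => //=; [apply: push|apply: (push lo hi nil out)].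
case E : hull_from => [[c d]|//] /=.
set fb := refill _ _ in E *.
have hfb : valid Snew (advance (b / P) fb.1 ++ rev fb.2) b.
  by apply: valid_advance; rewrite refill_cat; apply: valid_advance.
have hfront : valid Snew (advance (b / P) fb.1) (next_start (rev fb.2) b).
  by move: hfb; rewrite valid_cat => -[].
have b00 : (0 <= b / P)%BZ by apply: Z.div_pos; [exact: b0|lia].
have hh := hull_fromP hfront Snew0 _ b00 E.
have okb : bounds_between Snew b b' (lo + - d / P)%BZ (hi - c / P)%BZ.
  move=> n hn; apply: bounds_step; first exact: hc.
  apply: hh; first by case: (fb.2) => //= x [->].
  by rewrite divZ_nat; split; apply: Z.div_le_mono => //; lia.
by apply: IH => //=; [apply: push|apply: (push _ _ nil out)].
Qed.

Lemma sweep_starts (q : Z) old front back out L : sweep q old front back out = Some L ->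
  [seq c.1.1 | c <- L] = [seq c.1.1 | c <- rev out ++ old].
Proof.
elim: old front back out => [//|[[b lo] hi] old IH] front back out.
case: old IH => [|[[b' lo'] hi'] old] IH.
  rewrite /=; case: hull_from => // cd; case: ifP => // _ [<-].
  by rewrite rev_cons -cats1 !map_cat.
rewrite [sweep _ _ _ _ _]/=; case: ifP => _.
  by move=> /IH ->; rewrite rev_cons cat_rcons.
case: hull_from => // cd /IH ->.
by rewrite rev_cons cat_rcons !map_cat.
Qed.

End Sweep.

Definition full_on (ps : seq nat) : nat -> local_type R :=
  fun q => if q \in ps then Full (-1) else Zero.

Lemma log_sum_full_on_cons p ps n : prime p -> p \notin ps ->
  log_sum (full_on (p :: ps)) n =
  log_sum (full_on ps) n - p%:R^-1 * log_sum (full_on (p :: ps)) (n %/ p).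
Proof.
move=> pp nps; rewrite (@log_sum_full _ _ p (-1)) //; last by rewrite /full_on mem_head.
rewrite mulN1r mulNr; congr (_ - _); apply: eq_log_sum => q _ _.
by rewrite /upd /full_on inE; case: eqP => // ->; rewrite (negPf nps).
Qed.

Lemma sweepsP ps0 ps L L' : all prime ps -> uniq (rev ps ++ ps0) ->
  all (Z.leb 0) [seq c.1.1 | c <- L] ->
  valid_inf (log_sum (full_on ps0)) L -> sweeps (map Z.of_nat ps) L = Some L' ->
  valid_inf (log_sum (full_on (rev ps ++ ps0))) L'.
Proof.
elim: ps ps0 L => [|p ps IH] ps0 L /=; first by move=> _ _ _ hL [<-].
move=> /andP[pp aps]; rewrite rev_cons cat_rcons => u hb hL.
case E : sweep => [L1|//] h.
have u2 : uniq (p :: ps0) by apply: subseq_uniq u; exact: suffix_subseq.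
have hb' : forall b lo hi, (b, lo, hi) \in L -> (0 <= b)%BZ.
  move=> b lo hi hin; apply/Z.leb_le.
  by apply: (allP hb); apply/mapP; exists (b, lo, hi).
apply: (IH (p :: ps0) L1) => //; first by rewrite (sweep_starts E).
apply: (sweepP _ _ _ hL _ _ _ hb' E); rewrite ?prime_gt1 ?log_sum0 //.
- by move=> n; rewrite log_sum_full_on_cons //; case/andP: u2.
- by case: L hb {E hL hb'} => [|[[b lo] hi] L] //= /andP[/Z.leb_le].
Qed.

Lemma valid_inf_starts fuel zmax b s : (0 < fuel)%N -> (0 < b)%BZ ->
  sc = ZtoR s ->
  valid_inf (log_sum (full_on [::])) (starts fuel zmax b s).
Proof.
move=> + + scs; have ok1 : forall b, (0 < b)%BZ -> forall n : nat, (b <= Z.of_nat n)%BZ ->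
    ZtoR s <= sc * log_sum (full_on [::]) n <= ZtoR s.
  move=> b0 hb0 n hn; rewrite log_sum_none ?mulr1 ?scs ?lexx //; lia.
elim: fuel b => [//|[|fuel] IH] b _ hb /=.
  by case: ifP => _; exact: ok1.
case: ifP => _; last exact: ok1.
set b' := (if _ then _ else _) in IH *.
have hb' : (0 < b')%BZ.
  by rewrite /b'; case: ifP => _; first lia; have := Z.pow_nonneg 2 (Z.log2 b - 5); lia.
have := IH b' isT hb'; rewrite /=; set tl := (if _ then _ else _).
by move=> h; split=> // n hn; apply: (ok1 b) => //; lia.
Qed.

End GridSpec.

(** * Certified bounds with the primes up to 500 *)

Definition primes500 : seq nat := [seq p <- iota 2 499 | prime p].

Section GridCheck.
Local Open Scope Z_scope.
(** Cells are in units of 2^-22. The tests below use 9/64 > 0.14, 23/128 < 0.18 and 776/400 =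
    1.94. *)
Definition grid_scale : Z := 64 * 65536.
Definition grid_unit : Z := 65536.
Definition final_cell (lo hi : Z) :=
  Z.leb (9 * grid_unit) lo && Z.leb (2 * hi) (23 * grid_unit) &&
  Z.leb (400 * (hi * hi)) (13 * (grid_scale * grid_scale)).
(** b' is the next start, so n + 1 <= b' in the cell and 1/b' may replace 1/(n + 1) in the bound for
    the square. The disjunctions exempt cells ending by 400000 and by 66. *)
Definition mid_cell (b' lo hi : Z) :=
  (Z.leb b' (400 * 1000) || Z.leb (9 * grid_unit) lo) && (Z.leb b' 66 || Z.leb (2 * hi) (23 * grid_unit)) &&
  Z.leb (400 * (hi * hi) * b') ((13 * b' + 776) * (grid_scale * grid_scale)).
Fixpoint good_cells (L : seq cell) : bool :=
  match L with
  | nil => false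
  | (b, lo, hi) :: L' =>
    match L' with
    | nil => final_cell lo hi
    | (b', _, _) :: _ => mid_cell b' lo hi && good_cells L'
    end
  end.
Definition start_cells := starts 1000 grid_scale 1 grid_scale.
Definition check_cells (o : option (seq cell)) : bool :=
  if o is Some L then Z.leb (next_start L 0) 1 && good_cells L else false.
End GridCheck.

Lemma grid_checkE : check_cells (sweeps (map Z.of_nat primes500) start_cells) = true.
Proof. by vm_cast_no_check (erefl true). Qed.

Section Bounds.
Variable R : realType.
Lemma ZtoR_cst (k : nat) z : z = Z.of_nat k -> ZtoR R z = k%:R.
Proof. by move=> ->; rewrite ZtoR_nat. Qed.

Definition A500_spec (S : nat -> R) (n : nat) :=
  [/\ (400 * 1000 <= n)%N -> 14 / 100 <= S n,
      (66 <= n)%N -> S n <= 18 / 100 &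
      0 <= S n -> S n ^+ 2 <= 13 / 400 + 194 / 100 / n.+1%:R].

(** [sc] and [u] stay abstract and enter only through the stated equations, which keeps the large
    numerals of the grid out of the real arithmetic. *)
Lemma good_cellsP (sc u : R) (S : nat -> R) L n : 0 < u ->
  (forall z, ZtoR R (z * grid_unit) = ZtoR R z * u) -> sc = 64 * u ->
  (forall z, ZtoR R (z * (grid_scale * grid_scale)) = ZtoR R z * sc ^+ 2) ->
  valid_inf sc S L -> good_cells L ->
  (next_start L 0 <= Z.of_nat n)%BZ -> A500_spec S n.
Proof.
move=> u0 uE scE pow44; elim: L => [//|[[b lo] hi] L IH].
have sc0 : 0 < sc by rewrite scE; lra.
have lo_le lo1 : (9 * grid_unit <= lo1)%BZ -> ZtoR R lo1 <= sc * S n -> 14 / 100 <= S n.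
  move=> /(ZtoR_le R); rewrite uE (@ZtoR_cst 9 9%BZ erefl) scE => h1 h2.
  by rewrite -(ler_pM2l u0); lra.
have hi_le hi1 : (2 * hi1 <= 23 * grid_unit)%BZ -> sc * S n <= ZtoR R hi1 -> S n <= 18 / 100.
  move=> /(ZtoR_le R); rewrite uE ZtoRM (@ZtoR_cst 2 2%BZ erefl) (@ZtoR_cst 23 23%BZ erefl) scE => h1 h2.
  by rewrite -(ler_pM2l u0); lra.
case: L IH => [|[[b' lo'] hi'] L] IH.
  move=> hv /andP[/andP[/Z.leb_le h1 /Z.leb_le h2] /Z.leb_le h3] hn.
  have /andP[l1 l2] := hv n hn; split.
  - by move=> _; apply: lo_le l1.
  - by move=> _; apply: hi_le l2.
  move=> S0; have : ZtoR R (400 * (hi * hi)) <= ZtoR R (13 * (grid_scale * grid_scale)) by exact: ZtoR_le.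
  rewrite pow44 !ZtoRM (@ZtoR_cst 400 400%BZ erefl) (@ZtoR_cst 13 13%BZ erefl) => h.
  have : (sc * S n) ^+ 2 <= ZtoR R hi * ZtoR R hi.
    by rewrite expr2 ler_pM // mulr_ge0 // ltW.
  have : 0 <= 194 / 100 / n.+1%:R :> R by rewrite !divr_ge0.
  have sc2 : 0 < sc ^+ 2 by rewrite exprn_gt0.
  rewrite exprMn => g1 g2; apply: (@le_trans _ _ (13 / 400)); last by rewrite lerDl.
  by rewrite -(ler_pM2l sc2); lra.
move=> [hv1 hv2] /andP[hm hg] hn.
have [hn'|hn'] := Z_lt_le_dec (Z.of_nat n) b'; last exact: IH.
have /andP[l1 l2] := hv1 n (conj hn hn').
move: hm => /andP[/andP[/orP h1 /orP h2] /Z.leb_le h3]; split.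
- move=> n1; case: h1 => /Z.leb_le h1; first by exfalso; lia.
  exact: lo_le l1.
- move=> n1; case: h2 => /Z.leb_le h2; first by exfalso; lia.
  exact: hi_le l2.
move=> S0.
have : ZtoR R (400 * (hi * hi) * b') <= ZtoR R ((13 * b' + 776) * (grid_scale * grid_scale)) by exact: ZtoR_le.
rewrite pow44 !(ZtoRM, ZtoRD) (@ZtoR_cst 400 400%BZ erefl) (@ZtoR_cst 13 13%BZ erefl) (@ZtoR_cst 776 776%BZ erefl) => h.
have : (sc * S n) ^+ 2 <= ZtoR R hi * ZtoR R hi.
  by rewrite expr2 ler_pM // mulr_ge0 // ltW.
have nb : n.+1%:R <= ZtoR R b' by rewrite -ZtoR_nat; apply: ZtoR_le; clear -hn'; lia.
have n0 : 0 < n.+1%:R :> R by rewrite ltr0n.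
have b0 : 0 < ZtoR R b' by apply: lt_le_trans nb.
have sc2 : 0 < sc ^+ 2 by rewrite exprn_gt0.
rewrite exprMn => g1.
have g2 : S n ^+ 2 <= 13 / 400 + 194 / 100 / ZtoR R b'.
  rewrite -(ler_pM2l sc2) -(ler_pM2l b0).
  have -> : ZtoR R b' * (sc ^+ 2 * (13 / 400 + 194 / 100 / ZtoR R b'))
    = (13 * ZtoR R b' + 776) * sc ^+ 2 / 400 by field; rewrite gt_eqF.
  have := ler_wpM2l (ltW b0) g1; lra.
apply: (le_trans g2); rewrite lerD2l; apply: ler_wpM2l; first by rewrite divr_ge0.
by rewrite lef_pV2 ?posrE.
Qed.

Lemma primes500_uniq : uniq (rev primes500).
Proof. by rewrite rev_uniq; apply: filter_uniq; apply: iota_uniq. Qed.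

Lemma primes500_prime : all prime primes500.
Proof. exact: filter_all. Qed.

Lemma start_cells_ge0 : all (Z.leb 0) [seq c.1.1 | c <- start_cells].
Proof. by vm_compute. Qed.

Lemma check_cellsP (sc u : R) ps L0 n : 0 < u ->
  (forall z, ZtoR R (z * grid_unit) = ZtoR R z * u) -> sc = 64 * u ->
  (forall z, ZtoR R (z * (grid_scale * grid_scale)) = ZtoR R z * sc ^+ 2) ->
  all prime ps -> uniq (rev ps) -> all (Z.leb 0) [seq c.1.1 | c <- L0] ->
  valid_inf sc (log_sum (full_on R [::])) L0 ->
  check_cells (sweeps (map Z.of_nat ps) L0) -> (0 < n)%N ->
  A500_spec (log_sum (full_on R (rev ps))) n.
Proof.
move=> u0 uE scE sqE hp hu hb hv; case E : sweeps => [L|//] /andP[/Z.leb_le hs hg] n0.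
rewrite -[rev ps]cats0 in hu.
have := sweepsP hp hu hb hv E; rewrite cats0 => hL.
by apply: (good_cellsP u0 uE scE sqE hL hg); clear -hs n0; lia.
Qed.

Lemma A500P n : (0 < n)%N -> A500_spec (log_sum (full_on R (rev primes500))) n.
Proof.
refine (@check_cellsP (ZtoR R grid_scale) (ZtoR R grid_unit) primes500 start_cells n _ _ _ _ _ _ _ _ _).
- by apply: ZtoR_gt0.
- by move=> z; apply: ZtoRM.
- by rewrite -(@ZtoR_cst 64 64%BZ erefl) -ZtoRM.
- by move=> z; rewrite expr2 -ZtoRM -ZtoRM.
- exact: primes500_prime.
- exact: primes500_uniq.
- exact: start_cells_ge0.
- exact: valid_inf_starts.
- exact: grid_checkE.
Qed.

End Bounds.

(** * Positivity of the logarithmic sums of the Liouville function *)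

Lemma pos_eqP : Equality.axiom Pos.eqb.
Proof. by move=> x y; apply: (iffP idP) => /Pos.eqb_eq. Qed.

HB.instance Definition _ := hasDecEq.Build positive pos_eqP.

(* The bits of j lead from the root to the node of the odd number 2 j + 1; a
   node carries the flags "touched" and "parity of the number of flips". *)
Inductive ptree := Leaf | Node of ptree & bool & bool & ptree.

Fixpoint flip (n : positive) (t : ptree) {struct n} : ptree :=
  match n with
  | xH => match t with
          | Leaf => Node Leaf true true Leaf
          | Node l _ b r => Node l true (negb b) r end
  | xO n => match t with
            | Leaf => Node (flip n Leaf) false false Leaf
            | Node l c b r => Node (flip n l) c b r end
  | xI n => match t with
            | Leaf => Node Leaf false false (flip n Leaf)
            | Node l c b r => Node l c b (flip n r) end
  end.

Fixpoint parity (n : positive) (t : ptree) {struct t} : bool :=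
  match t with
  | Leaf => false
  | Node l _ b r => match n with xH => b | xO n => parity n l | xI n => parity n r end
  end.

Fixpoint touched (n : positive) (t : ptree) {struct t} : bool :=
  match t with
  | Leaf => false
  | Node l c _ r => match n with xH => c | xO n => touched n l | xI n => touched n r end
  end.

Fixpoint flips (k : nat) (q j : positive) (t : ptree) : ptree :=
  match k with O => t | S k => flips k q (Pos.add j q) (flip j t) end.

(** Index j stands for 2 j + 1, so the odd q starts at index q / 2, a step of q in the index is a
    step of 2 q, and there are (N / q + 1) / 2 odd multiples up to N. *)
Definition flip_multiples (N : N) (t : ptree) (q : positive) : ptree :=
  flips (N.to_nat (N.div2 (N.div N (Npos q) + 1))) q (Pos.div2 q) t.

Fixpoint powers (k : nat) (N p q : positive) : seq positive :=
  match k with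
  | O => nil
  | S k => if Pos.leb q N then q :: powers k N p (Pos.mul q p) else nil
  end.

Fixpoint untouched (k : nat) (j : positive) (t : ptree) (acc : seq positive) :=
  match k with
  | O => acc
  | S k => untouched k (Pos.pred j) t (if touched j t then acc else xI j :: acc)
  end.

Fixpoint omega_odd (n : positive) (t : ptree) : bool :=
  match n with xH => false | xO n => negb (omega_odd n t) | xI j => parity j t end.

Definition small_powers (k : nat) (N : positive) (ps : seq nat) : seq positive :=
  flatten [seq powers k N (Pos.of_nat p) (Pos.of_nat p) | p <- ps].

(* Flipping the odd multiples of every odd prime power computes the parity of
   omega on odd numbers. Odd numbers untouched by the primes up to sqrt N are
   the remaining primes. *)
Definition omega_tree (k : nat) (N : positive) (ps : seq nat) : ptree :=
  let t := foldl (flip_multiples (Npos N)) Leaf (small_powers k N ps) in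
  foldl (flip_multiples (Npos N)) t (untouched (Pos.to_nat (Pos.div2 N)) (Pos.div2 N) t nil).

(** * Correctness of the parity tree *)

Section TreeSpec.
Implicit Types (i j q : positive) (t : ptree) (k n : nat).

Lemma parity_flip i j t : parity i (flip j t) = Pos.eqb i j (+) parity i t.
Proof.
elim: j i t => [j IH|j IH|] [i|i|] [|l c b r] //=; rewrite ?IH ?addbF //.
Qed.

Lemma touched_flip i j t : touched i (flip j t) = Pos.eqb i j || touched i t.
Proof.
by elim: j i t => [j IH|j IH|] [i|i|] [|l c b r] //=; rewrite ?IH ?orbF.
Qed.

Fixpoint hit k q j i : bool :=
  match k with O => false | S k => Pos.eqb i j || hit k q (Pos.add j q) i end.

Lemma hitP k q j i : reflect (exists2 m, (m < k)%N &
   Pos.to_nat i = (Pos.to_nat j + m * Pos.to_nat q)%N) (hit k q j i).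
Proof.
elim: k j => [|k IH] j /=; first by right => -[].
apply: (iffP orP) => [[/Pos.eqb_eq ->|/IH [m mk e]]|[[|m] mk e]].
- by exists 0%N => //; lia.
- by exists m.+1 => //; rewrite e; lia.
- by left; apply/Pos.eqb_eq; lia.
- by right; apply/IH; exists m => //; lia.
Qed.

Lemma parity_flips k q j i t : parity i (flips k q j t) = hit k q j i (+) parity i t.
Proof.
elim: k j t => [|k IH] j t //=; rewrite IH parity_flip.
case: (Pos.eqb_spec i j) => [->|//]; rewrite addbA; congr (_ (+) _).
suff -> : hit k q (Pos.add j q) j = false by [].
by apply/negbTE/hitP => -[m _ h]; lia.
Qed.

Lemma touched_flips k q j i t : touched i (flips k q j t) = hit k q j i || touched i t.
Proof.
elim: k j t => [|k IH] j t //=; rewrite IH touched_flip.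
by case: hit; case: Pos.eqb.
Qed.

Definition odd_pos q := odd (Pos.to_nat q) && (2 < Pos.to_nat q)%N.

Lemma odd_posE q : odd_pos q -> exists h, q = xI h.
Proof.
rewrite /odd_pos; case: q => [h|h|] /andP[]; [by exists h| |by []].
by rewrite Pos2Nat.inj_xO; lia.
Qed.

Lemma hit_dvd (N : positive) q i : odd_pos q -> (Pos.to_nat (xI i) <= Pos.to_nat N)%N ->
  hit (N.to_nat (N.div2 (N.div (Npos N) (Npos q) + 1))) q (Pos.div2 q) i
  = (Pos.to_nat q %| Pos.to_nat (xI i))%N.
Proof.
move=> /odd_posE [h ->] iN.
have ek : N.to_nat (N.div2 (N.div (Npos N) (Npos (xI h)) + 1)) =
    ((Pos.to_nat N %/ Pos.to_nat (xI h)).+1 %/ 2)%N.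
  have e : N.to_nat (N.div (Npos N) (Npos (xI h))) = (Pos.to_nat N %/ Pos.to_nat (xI h))%N.
    have := N.div_mod (Npos N) (Npos (xI h)); have := N.mod_lt (Npos N) (Npos (xI h)).
    move: (N.div _ _) (N.modulo _ _) => x y /(_ ltac:(done)) h1 /(_ ltac:(done)) h2.
    have h3 : Pos.to_nat N = (N.to_nat x * Pos.to_nat (xI h) + N.to_nat y)%N by lia.
    by rewrite h3 divnMDl ?divn_small; lia.
  rewrite -e; move: (N.div _ _) => a; have := N.div2_odd (a + 1).
  by move: (N.div2 _) (N.odd _) => x [] hb; rewrite divn2 /N.b2n in hb *; lia.
rewrite ek [Pos.div2 _]/=.
have e1 j : Pos.to_nat (xI j) = (Pos.to_nat j).*2.+1 by rewrite Pos2Nat.inj_xI; lia.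
apply/hitP/dvdnP => [[m _ e]|[x e]].
  by exists (m.*2.+1); rewrite !e1 e e1; lia.
have ox : odd x.
  have : odd (Pos.to_nat (xI i)) by rewrite e1 /= odd_double.
  by rewrite e oddM => /andP[].
have hx := odd_double_half x; rewrite ox in hx.
have hy : (x <= Pos.to_nat N %/ Pos.to_nat (xI h))%N.
  by rewrite leq_divRL ?e1 // -e1 -e.
exists (x./2); first by move: hy; move: (_ %/ Pos.to_nat _)%N => y hy; rewrite divn2; lia.
move: e; rewrite !e1 -hx => e; clear -e; nia.
Qed.

Lemma parity_multiples N t q i : odd_pos q -> (Pos.to_nat (xI i) <= Pos.to_nat N)%N ->
  parity i (flip_multiples (Npos N) t q)
  = (Pos.to_nat q %| Pos.to_nat (xI i))%N (+) parity i t.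
Proof. by move=> h1 h2; rewrite /flip_multiples parity_flips hit_dvd. Qed.

Lemma touched_multiples N t q i : odd_pos q -> (Pos.to_nat (xI i) <= Pos.to_nat N)%N ->
  touched i (flip_multiples (Npos N) t q)
  = (Pos.to_nat q %| Pos.to_nat (xI i))%N || touched i t.
Proof. by move=> h1 h2; rewrite /flip_multiples touched_flips hit_dvd. Qed.

Lemma parity_foldl N t Q i : all odd_pos Q -> (Pos.to_nat (xI i) <= Pos.to_nat N)%N ->
  parity i (foldl (flip_multiples (Npos N)) t Q)
  = odd (count (fun q => Pos.to_nat q %| Pos.to_nat (xI i))%N Q) (+) parity i t.
Proof.
elim: Q t => [|q Q IH] t //= /andP[oq oQ] iN.
rewrite IH // parity_multiples // oddD addbA; congr (_ (+) _).
by rewrite addbC; case: (_ %| _)%N.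
Qed.

Lemma touched_foldl N t Q i : all odd_pos Q -> (Pos.to_nat (xI i) <= Pos.to_nat N)%N ->
  touched i (foldl (flip_multiples (Npos N)) t Q)
  = has (fun q => Pos.to_nat q %| Pos.to_nat (xI i))%N Q || touched i t.
Proof.
elim: Q t => [|q Q IH] t //= /andP[oq oQ] iN.
by rewrite IH // touched_multiples // orbCA orbA.
Qed.

Lemma untouchedE k j t acc : (k <= Pos.to_nat j)%N ->
  [seq Pos.to_nat q | q <- untouched k j t acc] =
  [seq m.*2.+1 | m <- iota (Pos.to_nat j - k).+1 k & ~~ touched (Pos.of_nat m) t]
    ++ [seq Pos.to_nat q | q <- acc].
Proof.
elim: k j acc => [//|k IH] j acc kj; rewrite [untouched _ _ _ _]/=.
have e0 : ((Pos.to_nat j - k.+1).+1 = Pos.to_nat j - k)%N by lia.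
have ej : Pos.of_nat (Pos.to_nat j - k + k) = j by rewrite subnK ?Pos2Nat.id //; lia.
have -> : iota (Pos.to_nat j - k.+1).+1 k.+1
  = iota (Pos.to_nat j - k) k ++ [:: (Pos.to_nat j - k + k)%N].
  by rewrite e0 -(addn1 k) iotaD.
rewrite filter_cat map_cat -catA.
have exI : Pos.to_nat (xI j) = (Pos.to_nat j - k + k).*2.+1.
  by rewrite subnK; [rewrite Pos2Nat.inj_xI; lia | lia].
have -> : [seq m.*2.+1 | m <- [:: (Pos.to_nat j - k + k)%N] & ~~ touched (Pos.of_nat m) t]
    ++ [seq Pos.to_nat q | q <- acc]
  = [seq Pos.to_nat q | q <- if touched j t then acc else xI j :: acc].
  by rewrite /= ej; case: touched => //=; rewrite exI.
have [j1|j1] := Pos.eq_dec j 1.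
  by have -> : k = 0%N by move: kj; rewrite j1 /=; lia.
have e : Pos.to_nat (Pos.pred j) = (Pos.to_nat j).-1 by rewrite Pos2Nat.inj_pred //; lia.
rewrite IH e; last by lia.
by have -> : ((Pos.to_nat j).-1 - k).+1 = (Pos.to_nat j - k)%N by lia.
Qed.

(** The valuation counts the powers of p dividing n. [a] is the exponent reached by q, and since p
    >= 2 the bound 2^(k + a) says that the fuel outlasts the powers up to N. *)
Lemma powersE k (N p q : positive) (a n : nat) : prime (Pos.to_nat p) ->
  Pos.to_nat q = (Pos.to_nat p ^ a)%N -> (0 < n <= Pos.to_nat N)%N ->
  (Pos.to_nat N < 2 ^ (k + a))%N ->
  count (fun x => Pos.to_nat x %| n)%N (powers k N p q)
    = ((logn (Pos.to_nat p) n).+1 - a)%N.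
Proof.
move=> pp eq0 /andP[n0 nN]; have p1 := prime_gt1 pp.
have le_n : (Pos.to_nat p ^ logn (Pos.to_nat p) n <= Pos.to_nat N)%N.
  by apply: leq_trans nN; apply: dvdn_leq => //; exact: pfactor_dvdnn.
have lt_a a' : (Pos.to_nat N < Pos.to_nat p ^ a')%N ->
    ((logn (Pos.to_nat p) n).+1 - a')%N = 0%N.
  move=> h; apply/eqP; rewrite subn_eq0 -(ltn_exp2l _ _ p1).
  exact: leq_ltn_trans le_n h.
elim: k a q eq0 => [|k IH] a q eq0 hk.
  rewrite lt_a //; apply: leq_trans hk _.
  by case: a {eq0} => [|a] //; rewrite leq_exp2r.
rewrite [powers _ _ _ _]/=; case: (Pos.leb_spec q N) => hq; last first.
  by rewrite lt_a // -eq0; lia.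
have e1 : Pos.to_nat (Pos.mul q p) = (Pos.to_nat p ^ a.+1)%N.
  by rewrite Pos2Nat.inj_mul eq0 expnSr.
have e2 : (Pos.to_nat N < 2 ^ (k + a.+1))%N by rewrite addnS -addSn.
rewrite [count _ _]/= (IH _ _ e1 e2) eq0 pfactor_dvdn //; case: (leqP a) => h; lia.
Qed.

Lemma powers_odd k (N p q : positive) : odd_pos p -> odd_pos q ->
  all odd_pos (powers k N p q).
Proof.
move=> op; elim: k q => [|k IH] q oq //=; case: Pos.leb => //=.
rewrite oq IH // /odd_pos; move: op oq => /andP[p1 p2] /andP[q1 q2].
by rewrite Pos2Nat.inj_mul; apply/andP; split; [rewrite oddM q1 p1 | nia].
Qed.

Lemma powers_mem k (N p q : positive) : (Pos.to_nat q <= Pos.to_nat N)%N ->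
  q \in powers k.+1 N p q.
Proof. by move=> h /=; rewrite (_ : Pos.leb q N) ?mem_head //; lia. Qed.

Lemma powers_dvd k (N p q x : positive) : (Pos.to_nat p %| Pos.to_nat q)%N ->
  x \in powers k N p q -> (Pos.to_nat p %| Pos.to_nat x)%N.
Proof.
move=> pq; elim: k q pq => [|k IH] q pq //=; case: Pos.leb => //.
rewrite inE => /orP[/eqP -> //|]; apply: IH.
by rewrite Pos2Nat.inj_mul dvdn_mulr.
Qed.

(** This is Omega, counting prime factors with multiplicity. *)
Definition omega (n : nat) : nat := \sum_(0 <= p < n.+1 | prime p) logn p n.

Lemma omegaE n M : (0 < n)%N -> (n < M)%N ->
  omega n = (\sum_(0 <= p < M | prime p) logn p n)%N.
Proof.
move=> n0 nM; rewrite /omega (big_cat_nat (n := n.+1) (p := M)) //=.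
rewrite [X in (_ = _ + X)%N]big1_seq ?addn0 // => q /andP[_].
by rewrite mem_index_iota => /andP[nq _]; rewrite ltn_log0.
Qed.

Lemma div2_half (n : positive) : (1 < Pos.to_nat n)%N ->
  Pos.to_nat (Pos.div2 n) = (Pos.to_nat n)./2.
Proof.
case: n => [h|h|] // _; rewrite [Pos.div2 _]/=.
  have -> : Pos.to_nat (xI h) = (Pos.to_nat h).*2.+1 by rewrite Pos2Nat.inj_xI; lia.
  by rewrite -[RHS]/(uphalf _) uphalf_double.
have -> : Pos.to_nat (xO h) = (Pos.to_nat h).*2 by rewrite Pos2Nat.inj_xO; lia.
by rewrite doubleK.
Qed.

Section OmegaTree.
Variables (k : nat) (N : positive) (B : nat) (ps : seq nat).
Hypothesis oddN : odd (Pos.to_nat N).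
Hypothesis N_lt : (Pos.to_nat N < 2 ^ k)%N.
Hypothesis BN : (Pos.to_nat N < B.+1 * B.+1)%N.
Hypothesis BleN : (B <= Pos.to_nat N)%N.
Hypothesis psE : ps = [seq p <- iota 3 (B - 2) | prime p].

Let M := Pos.to_nat N.

Lemma mem_ps p : (p \in ps) = [&& prime p, 2 < p & p <= B]%N.
Proof.
rewrite psE mem_filter mem_iota; case: prime => //=.
by case: (ltnP 2 p) => //= h; lia.
Qed.

Lemma ps_odd p : p \in ps -> odd_pos (Pos.of_nat p) /\ Pos.to_nat (Pos.of_nat p) = p.
Proof.
rewrite mem_ps => /and3P[pp p2 _]; have e : Pos.to_nat (Pos.of_nat p) = p.
  by rewrite Nat2Pos.id //; lia.
by split=> //; rewrite /odd_pos e p2 andbT; case: (even_prime pp) => // h; lia.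
Qed.

Lemma small_powers_odd : all odd_pos (small_powers k N ps).
Proof.
apply/allP => x /flattenP[s /mapP[p pin ->]].
by have [h _] := ps_odd pin; move/(allP (powers_odd k N h h)).
Qed.

Lemma has_small_powers n : 
  has (fun q => Pos.to_nat q %| n)%N (small_powers k N ps) = has (fun p => p %| n)%N ps.
Proof.
apply/hasP/hasP => [[x /flattenP[s /mapP[p pin ->]] xs xn]|[p pin pn]].
  exists p => //; have [h e] := ps_odd pin; apply: dvdn_trans xn; rewrite -{1}e.
  by apply: powers_dvd xs.
have [h e] := ps_odd pin; exists (Pos.of_nat p); last by rewrite e.
apply/flattenP; exists (powers k N (Pos.of_nat p) (Pos.of_nat p)).
  by apply/mapP; exists p.
have k0 : (0 < k)%N by case: (k) N_lt; lia.
rewrite -(prednK k0); apply: powers_mem; rewrite e; move: pin; rewrite mem_ps => /and3P[_ _ h'].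
exact: leq_trans h' BleN.
Qed.

Lemma count_small_powers n : (0 < n <= M)%N ->
  count (fun q => Pos.to_nat q %| n)%N (small_powers k N ps) = (\sum_(p <- ps) logn p n)%N.
Proof.
move=> hn; rewrite /small_powers count_flatten -map_comp sumnE big_map.
apply: eq_big_seq => p pin; have [h e] := ps_odd pin.
move: (pin); rewrite mem_ps => /and3P[pp _ _].
rewrite /= (@powersE k N _ _ 1) ?e ?expn1 //; first by rewrite subn1.
by apply: leq_trans N_lt _; rewrite leq_exp2l ?leq_addr.
Qed.

Let t1 := foldl (flip_multiples (Npos N)) Leaf (small_powers k N ps).

(** Sieve of Eratosthenes: a composite odd number up to N < (B + 1)^2 has an odd prime factor at
    most B. *)
Lemma touched_t1 m : (0 < m)%N -> (m.*2.+1 <= M)%N ->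
  ~~ touched (Pos.of_nat m) t1 = prime m.*2.+1 && (B < m.*2.+1)%N.
Proof.
move=> m0 mM; have e : Pos.to_nat (xI (Pos.of_nat m)) = m.*2.+1.
  by rewrite Pos2Nat.inj_xI Nat2Pos.id; lia.
rewrite touched_foldl ?small_powers_odd ?e // orbF has_small_powers.
apply/hasPn/andP => [h|[pm Bm] p].
  have hp p : prime p -> (2 < p)%N -> (p <= B)%N -> ~~ (p %| m.*2.+1)%N.
    by move=> pp p2 pB; apply: h; rewrite mem_ps pp p2.
  have gt2 p : prime p -> (p %| m.*2.+1)%N -> (2 < p)%N.
    move=> pp pd; case: (even_prime pp) => [p2|op].
      by rewrite p2 dvdn2 /= odd_double in pd.
    by have := prime_gt1 pp; case: p op {pp pd} => [|[|[|]]].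
  have m1 : (1 < m.*2.+1)%N by lia.
  have pr : prime m.*2.+1.
    apply: contraT => npr; have pp := pdiv_prime m1.
    have sq : (pdiv m.*2.+1 ^ 2 <= m.*2.+1)%N.
      by rewrite leqNgt; apply: contra npr; apply: ltn_pdiv2_prime.
    have hB : (pdiv m.*2.+1 <= B)%N.
      by move: sq BN mM; rewrite /M -mulnn; move: (pdiv _) => x; nia.
    by have := hp _ pp (gt2 _ pp (pdiv_dvd _)) hB; rewrite pdiv_dvd.
  split=> //; rewrite ltnNge; apply/negP => mB.
  by have := hp _ pr (gt2 _ pr (dvdnn _)) mB; rewrite dvdnn.
rewrite mem_ps => /and3P[pp p2 pB]; rewrite dvdn_prime2 //.
by apply/eqP => pe; rewrite pe leqNgt Bm in pB.
Qed.

Lemma sum_odd (F : nat -> nat) m :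
  (\sum_(0 <= p < m.+1.*2) F p = \sum_(0 <= i < m.+1) F i.*2 + \sum_(0 <= i < m.+1) F i.*2.+1)%N.
Proof.
elim: m => [|m IH].
  by rewrite doubleS double0 !(big_nat_recr 1, big_nat_recr 0) // !big_geq.
rewrite doubleS !(big_nat_recr m.+1.*2.+1, big_nat_recr m.+1.*2) // IH.
rewrite !(big_nat_recr m.+1) //; set a := (\sum_(_ <= i < _) _)%N.
by move: a (\sum_(0 <= i < m.+1) F i.*2.+1)%N (F m.+1.*2) (F m.+1.*2.+1) => a b c d /=; lia.
Qed.

(** A prime above B divides n <= N < (B + 1)^2 at most once, so its exponent is a divisibility
    indicator and its higher powers need no flips. *)
Lemma omega_sum n : odd n -> (0 < n <= M)%N ->
  omega n = (\sum_(p <- ps) logn p n +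
     \sum_(i <- iota 1 M./2 | ~~ touched (Pos.of_nat i) t1) (i.*2.+1 %| n))%N.
Proof.
move=> on /andP[n0 nM].
rewrite (@omegaE n M.+1) // (bigID (fun p => p <= B)%N) /=; congr (_ + _)%N.
  rewrite psE big_filter.
  rewrite (big_cat_nat (n := B.+1)) //=.
  rewrite [X in (_ + X)%N]big1_seq ?addn0; last first.
    by move=> q /andP[/andP[_ qB]]; rewrite mem_index_iota ltnNge qB.
  rewrite (eq_bigl (fun p => prime p && (p <= B)%N)) //.
  rewrite big_nat_cond [RHS]big_seq_cond /index_iota subn0.
  have l2 : logn 2 n = 0%N by rewrite lognE dvdn2 on /= andbF.
  have [B2|B2] := leqP B 2.
    have -> : (B - 2 = 0)%N by lia.
    rewrite [RHS]big1_seq //; apply: big1_seq => q /andP[/and3P[/andP[_ qB] qp _]] _.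
    have -> : q = 2%N by have := prime_gt1 qp; lia.
    exact: l2.
  have -> : iota 0 B.+1 = [:: 0; 1; 2]%N ++ iota 3 (B - 2).
    by rewrite -(@iotaD 0 3); congr (iota _ _); clear -B2; lia.
  rewrite big_cat /= big1_seq ?add0n; last first.
    move=> q /andP[/and3P[_ qp _]]; rewrite !inE.
    by move=> /or3P[] /eqP qe; move: qp; rewrite qe // => _; exact: l2.
  rewrite [LHS]big_seq_cond; apply: eq_bigl => q.
  case E: (q \in iota 3 (B - 2)) => //=; move: E; rewrite mem_iota => /andP[_ E].
  have qB : (q <= B)%N by clear -E B2; lia.
  by rewrite ltnS qB andbT.
rewrite [RHS]big_mkcond.
have -> : M.+1 = (M./2).+1.*2 by have := odd_double_half M; rewrite oddN; lia.
rewrite [LHS](_ : _ = (\sum_(0 <= p < M./2.+1.*2)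
  (if prime p && ~~ (p <= B) then logn p n else 0))%N); last by rewrite big_mkcond.
rewrite sum_odd [X in (X + _)%N]big1_seq ?add0n; last first.
  move=> i _; case: ifP => // /andP[ip iB]; have := prime_gt1 ip => i1.
  case: (even_prime ip) => [i2|]; last by rewrite odd_double.
  by rewrite i2 lognE dvdn2 on andbF.
rewrite big_ltn // [X in (X + _)%N]/= add0n /index_iota subSS subn0; apply: eq_big_seq => i.
rewrite mem_iota => /andP[i0 iM].
have iM' : (i.*2.+1 <= M)%N by have := odd_double_half M; rewrite oddN; lia.
rewrite touched_t1 // -ltnNge; case: ifP => // /andP[ip iB].
have [id|nid] := boolP (i.*2.+1 %| n)%N; last by rewrite lognE (negPf nid) !andbF.
apply/eqP; rewrite eqn_leq lognE ip n0 id /= ltnS leqn0 andbT.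
rewrite lognE ip; case: ifP => // /and3P[_ _ /dvdnP[x xe]]; exfalso.
have ne : n = (x * i.*2.+1 * i.*2.+1)%N by rewrite -xe divnK.
have x0 : (0 < x)%N by move: n0; rewrite ne; case: x {xe ne}.
by move: iB BN nM; rewrite -/M {1}ne; nia.
Qed.

Lemma untouched_odd : all odd_pos (untouched (Pos.to_nat (Pos.div2 N)) (Pos.div2 N) t1 nil).
Proof.
suff h j acc k' : all odd_pos acc -> all odd_pos (untouched k' j t1 acc) by exact: h.
elim: k' j acc => [//|k' IH] j acc h /=; apply: IH; case: touched => //=.
have e1 : Pos.to_nat (xI j) = (Pos.to_nat j).*2.+1 by rewrite Pos2Nat.inj_xI; lia.
by rewrite h andbT /odd_pos e1 oddS odd_double /=; lia.
Qed.

Lemma omega_treeP i : (Pos.to_nat (xI i) <= M)%N ->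
  parity i (omega_tree k N ps) = odd (omega (Pos.to_nat (xI i))).
Proof.
move=> iM; have e1 : Pos.to_nat (xI i) = (Pos.to_nat i).*2.+1 by rewrite Pos2Nat.inj_xI; lia.
have on : odd (Pos.to_nat (xI i)) by rewrite e1 /= odd_double.
have hn : (0 < Pos.to_nat (xI i) <= M)%N by rewrite iM andbT; lia.
rewrite /omega_tree -/t1 parity_foldl ?untouched_odd // parity_foldl ?small_powers_odd //=.
rewrite addbF count_small_powers // (omega_sum on hn) oddD addbC; congr (_ (+) odd _).
have eH : Pos.to_nat (Pos.div2 N) = M./2.
  by apply: div2_half; move: iM; rewrite e1 /M; lia.
have ec (s : seq positive) : count (fun q => Pos.to_nat q %| Pos.to_nat (xI i))%N s
    = (\sum_(m <- [seq Pos.to_nat q | q <- s]) (m %| Pos.to_nat (xI i)))%N.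
  by elim: s => [|q s IH] /=; rewrite ?big_nil // big_cons IH.
rewrite ec untouchedE // cats0 subnn big_map big_filter eH.
exact: eq_bigr.
Qed.

End OmegaTree.
End TreeSpec.

(** * Scanning the partial sums of the Liouville function *)

Section ScanCode.
Local Open Scope Z_scope.
Variable C : Z.

(** A correction by one unit that preserves C = q n + r and e = d n. Whether two corrections are
    enough is not proved: [scan_fast] tests the range of the remainder. *)
Definition adjust (n : Z) (x : Z * Z * Z * Z) : Z * Z * Z * Z :=
  let '(q, r, d, e) := x in
  if Z.ltb r 0 then (q - 1, r + n, d + 1, e + n)
  else if Z.leb n r then (q + 1, r - n, d - 1, e - n) else x.

(** Rounds against positivity, with q the floor of C / n: the accumulator never exceeds C times the
    true sum. *)
Definition add_term (t : ptree) (n : positive) (q acc : Z) : Z :=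
  if omega_odd n t then acc - q - 1 else acc + q.

(* The quotient q and remainder r of C by n are carried along; d is the
   expected decrease of q and e = d (n + 1). *)
Fixpoint scan_fast (k : nat) (t : ptree) (n : positive) (q r d e acc : Z) : bool :=
  match k with
  | O => true
  | S k =>
      let n' := Pos.succ n in
      let '(q', r', d', e') := adjust (Zpos n') (adjust (Zpos n') (q - d, r - q + e, d, e)) in
      let acc' := add_term t n' q' acc in
      if Z.ltb 0 acc' && Z.leb 0 r' && Z.ltb r' (Zpos n')
      then scan_fast k t n' q' r' d' (e' + d') acc' else false
  end.

Fixpoint scan (k1 k2 : nat) (t : ptree) (n : positive) (acc : Z) : bool :=
  match k1 with
  | O => let q := C / Zpos n in let d := q / Zpos (Pos.succ n) in
         scan_fast k2 t n q (C - q * Zpos n) d (d * Zpos (Pos.succ n)) acc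
  | S k1 => let n' := Pos.succ n in
            let acc' := add_term t n' (C / Zpos n') acc in
            if Z.ltb 0 acc' then scan k1 k2 t n' acc' else false
  end.
End ScanCode.

Lemma omega_double n : (0 < n)%N -> omega n.*2 = (omega n).+1.
Proof.
move=> n0; have n2 : (n < n.*2.+1)%N by lia.
have h2 : (2 < n.*2.+1)%N by lia.
rewrite (@omegaE n.*2 n.*2.+1) ?double_gt0 // (omegaE n0 n2).
rewrite (eq_bigr (fun p => logn p 2 + logn p n)%N); last first.
  by move=> p _; rewrite -mul2n lognM.
have o2 : omega 2 = 1%N by rewrite /omega big_mkcond !big_nat_recr //= big_geq.
by rewrite big_split /= -(@omegaE 2 n.*2.+1) // o2.
Qed.

Lemma mult_coef_liouville (R : realType) n : (0 < n)%N ->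
  mult_coef (fun=> Full (-1 : R)) n = (-1) ^+ omega n.
Proof.
move=> n0; rewrite /mult_coef /omega -prodrXr; apply: eq_bigr => p _.
by rewrite /local_coef; case: logn => [|e] /=; rewrite ?expr0.
Qed.

Section ScanSpec.
Variable (R : realType) (C : Z) (t : ptree) (M : nat).
Hypothesis C_gt0 : (0 < C)%BZ.
Hypothesis tP : forall n : positive, (Pos.to_nat n <= M)%N ->
  omega_odd n t = odd (omega (Pos.to_nat n)).

Let S n := log_sum (fun=> Full (-1 : R)) n.

Lemma S_succ n : S n.+1 = S n + (-1) ^+ omega n.+1 / n.+1%:R.
Proof. by rewrite /S /log_sum big_nat_recr //= mult_coef_liouville. Qed.

Definition below (n : positive) (acc : Z) :=
  ZtoR R acc <= ZtoR R C * S (Pos.to_nat n).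

Lemma below_step n q r acc : (Pos.to_nat (Pos.succ n) <= M)%N -> below n acc ->
  C = (q * Zpos (Pos.succ n) + r)%BZ -> (0 <= r < Zpos (Pos.succ n))%BZ ->
  below (Pos.succ n) (add_term t (Pos.succ n) q acc).
Proof.
move=> nM h e [r0 rn]; have en : Pos.to_nat (Pos.succ n) = (Pos.to_nat n).+1 by lia.
rewrite /below /add_term tP // en S_succ -signr_odd mulrDr.
have nE : ZtoR R (Zpos (Pos.succ n)) = (Pos.to_nat n).+1%:R by rewrite -en -ZtoR_nat; congr ZtoR; lia.
have n0 : 0 < (Pos.to_nat n).+1%:R :> R by [].
have CE : ZtoR R C = ZtoR R q * (Pos.to_nat n).+1%:R + ZtoR R r.
  by rewrite {1}e ZtoRD ZtoRM nE.
have r0' : 0 <= ZtoR R r by rewrite -(ZtoR0 R); apply: ZtoR_le.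
have rn' : ZtoR R r <= (Pos.to_nat n).+1%:R by rewrite -nE; apply: ZtoR_le; lia.
have l1 : ZtoR R q <= ZtoR R C / (Pos.to_nat n).+1%:R by rewrite ler_pdivlMr // CE lerDl.
have l2 : ZtoR R C / (Pos.to_nat n).+1%:R <= ZtoR R q + 1.
  by rewrite ler_pdivrMr // CE mulrDl mul1r lerD2l.
rewrite /below in h; case: (odd _).
  rewrite expr1 mulN1r mulrN !ZtoRB -[ZtoR R 1]/(1%:~R) -addrA -opprD lerB //.
rewrite expr0 mul1r ZtoRD; exact: lerD.
Qed.

Lemma below_pos n acc : (0 < acc)%BZ -> below n acc -> 0 < S (Pos.to_nat n).
Proof.
move=> a0 h; have c0 := ZtoR_gt0 R C_gt0; rewrite -(pmulr_rgt0 _ c0).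
by apply: lt_le_trans h; apply: ZtoR_gt0.
Qed.

Definition quad (n c : Z) (x : Z * Z * Z * Z) : Prop :=
  let '(q, r, d, e) := x in (c = q * n + r)%BZ /\ (e = d * n)%BZ.

Lemma adjustP n c x : quad n c x -> quad n c (adjust n x).
Proof.
case: x => [[[q r] d] e] /= [-> ->]; case: ifP => _ /=; first by lia.
by case: ifP => _ /=; lia.
Qed.

Lemma scan_fastP k n q r d e acc : (Pos.to_nat n + k <= M)%N -> below n acc ->
  C = (q * Zpos n + r)%BZ -> e = (d * Zpos (Pos.succ n))%BZ ->
  scan_fast k t n q r d e acc ->
  forall m, (Pos.to_nat n < m <= Pos.to_nat n + k)%N -> 0 < S m.
Proof.
elim: k n q r d e acc => [|k IH] n q r d e acc nM h eC ee.
  by move=> _ m; rewrite addn0 => /andP[h1]; rewrite leqNgt h1.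
rewrite [scan_fast _ _ _ _ _ _ _ _]/=.
have : quad (Zpos (Pos.succ n)) C (q - d, r - q + e, d, e)%BZ.
  by split=> //; rewrite ee eC; lia.
move=> /adjustP/adjustP; case: (adjust _ _) => [[[q' r'] d'] e'] [eq' ee'].
case: ifP => // /andP[/andP[/Z.ltb_lt a0 /Z.leb_le r0] /Z.ltb_lt rn] hscan m hm.
have hb : below (Pos.succ n) (add_term t (Pos.succ n) q' acc).
  by apply: (@below_step n q' r') => //; lia.
have [em|ne] := eqVneq m (Pos.to_nat (Pos.succ n)); first by rewrite em; apply: below_pos hb.
apply: (IH _ _ _ _ _ _ _ hb eq' _ hscan); [by lia | by rewrite ee'; lia | by lia].
Qed.

Lemma scanP k1 k2 n acc : (Pos.to_nat n + k1 + k2 <= M)%N -> below n acc ->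
  scan C k1 k2 t n acc ->
  forall m, (Pos.to_nat n < m <= Pos.to_nat n + k1 + k2)%N -> 0 < S m.
Proof.
elim: k1 n acc => [|k1 IH] n acc nM h.
  rewrite [scan _ _ _ _ _ _]/= => hs m; rewrite addn0.
  by apply: (scan_fastP _ h _ _ hs) => //; rewrite ?addn0 // in nM *; lia.
rewrite [scan _ _ _ _ _ _]/=; case: ifP => // /Z.ltb_lt a0 hscan m hm.
have hb : below (Pos.succ n) (add_term t (Pos.succ n) (C / Zpos (Pos.succ n))%BZ acc).
  apply: (@below_step n _ (C mod Zpos (Pos.succ n))%BZ) => //; first by lia.
    by rewrite Z.mul_comm; apply: Z.div_mod.
  exact: Z.mod_pos_bound.
have [em|ne] := eqVneq m (Pos.to_nat (Pos.succ n)); first by rewrite em; apply: below_pos hb.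
by apply: (IH _ _ _ hb hscan); lia.
Qed.

Lemma below1 : below 1 C.
Proof.
by rewrite /below /S /log_sum big_nat1 divr1 mult_coef_liouville // /omega
  big1_seq ?expr0 ?mulr1 // => p _; rewrite logn1.
Qed.

End ScanSpec.

Lemma omega_odd_treeP (k : nat) (N : positive) (B : nat) (ps : seq nat) :
  odd (Pos.to_nat N) -> (Pos.to_nat N < 2 ^ k)%N -> (Pos.to_nat N < B.+1 * B.+1)%N ->
  (B <= Pos.to_nat N)%N -> ps = [seq p <- iota 3 (B - 2) | prime p] ->
  forall n : positive, (Pos.to_nat n <= Pos.to_nat N)%N ->
  omega_odd n (omega_tree k N ps) = odd (omega (Pos.to_nat n)).
Proof.
move=> oN Nk NB BN psE; elim=> [i _|i IH|] hn.
- exact: (omega_treeP oN Nk NB BN psE).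
- have e : Pos.to_nat (xO i) = (Pos.to_nat i).*2 by rewrite Pos2Nat.inj_xO; lia.
  by rewrite [omega_odd _ _]/= IH ?e ?omega_double ?oddS //; lia.
- by rewrite /omega big1_seq // => p _; rewrite logn1.
Qed.

(** 632 is the integer square root of 399999. *)
Definition odd_primes632 : seq nat := [seq p <- iota 3 (632 - 2) | prime p].

Lemma odd_primes632E : odd_primes632 = [seq p <- iota 3 (632 - 2) | prime p].
Proof. by []. Qed.

Definition liouville_check (K1 K2 : positive) (C : Z) (N : positive) : bool :=
  scan C (Pos.to_nat K1) (Pos.to_nat K2) (omega_tree 20 N odd_primes632) 1 C.

(** With C = 2^34, at most one unit is lost per term, under 3/10^5 in all. The quotients up to n =
    2^13 are computed by division; beyond, the second difference of C / n, about 2 C / n^3, is at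
    most about 2^-4, so the prediction is nearly exact. *)
Lemma liouville_checkE : liouville_check 8191 391807 17179869184 399999 = true.
Proof. by vm_cast_no_check (erefl true). Qed.

(** The parameters are variables and the tree is generalised, so that no step evaluates the tree or
    turns the numerals into unary numbers. *)
Lemma liouville_check_gt0 (R : realType) (K1 K2 : positive) (C : Z) (N : positive) n :
  odd (Pos.to_nat N) -> (Pos.to_nat N < 2 ^ 20)%N ->
  (Pos.to_nat N < 632.+1 * 632.+1)%N -> (632 <= Pos.to_nat N)%N -> (0 < C)%BZ ->
  (1 + Pos.to_nat K1 + Pos.to_nat K2 = Pos.to_nat N)%N ->
  liouville_check K1 K2 C N -> (0 < n <= Pos.to_nat N)%N ->
  0 < log_sum (fun=> Full (-1 : R)) n.
Proof.
move=> h1 h2 h3 h4 C0 h5 h6 /andP[n0 nN].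
have hb := @below1 R C.
have tP := @omega_odd_treeP 20 N 632 odd_primes632 h1 h2 h3 h4 odd_primes632E.
unfold liouville_check in h6.
revert tP h6.
generalize (omega_tree 20 N odd_primes632).
intros t tP h6.
have [e|n1] := eqVneq n 1%N.
  by rewrite e; apply: (below_pos C0 C0 hb).
apply: (scanP C0 tP _ hb h6); first by rewrite h5.
by rewrite h5; lia.
Qed.

Lemma N_odd : odd (Pos.to_nat 399999).
Proof.
have h (q : positive) : odd (Pos.to_nat (xI q)).
  have -> : Pos.to_nat (xI q) = (Pos.to_nat q).*2.+1 by rewrite Pos2Nat.inj_xI; lia.
  by rewrite oddS odd_double.
exact: h.
Qed.
Lemma N_lt1 : (Pos.to_nat 399999 < 2 ^ 20)%N.
Proof.
have h x : (x < 2 ^ 10 * 2 ^ 10)%N -> (x < 2 ^ 20)%N by rewrite -expnD.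
apply: h; have -> : (2 ^ 10 = 32 * 32)%N by [].
by clear; lia.
Qed.
Lemma N_lt2 : (Pos.to_nat 399999 < 632.+1 * 632.+1)%N.
Proof. lia. Qed.
Lemma N_ge : (632 <= Pos.to_nat 399999)%N.
Proof. lia. Qed.
Lemma N_sum : (1 + Pos.to_nat 8191 + Pos.to_nat 391807 = Pos.to_nat 399999)%N.
Proof. lia. Qed.
Lemma le_399999 n : (0 < n < 400 * 1000)%N -> (0 < n <= Pos.to_nat 399999)%N.
Proof. lia. Qed.

Lemma liouville_sum_gt0 (R : realType) n : (0 < n < 400 * 1000)%N ->
  0 < log_sum (fun=> Full (-1 : R)) n.
Proof.
move=> /le_399999; move: (erefl true) N_odd N_lt1 N_lt2 N_ge N_sum liouville_checkE => _.
move: (399999%positive) (8191%positive) (391807%positive) => N K1 K2 h1 h2 h3 h4 h5 h6.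
have C0 : (0 < 17179869184)%BZ by [].
by move=> hn; exact: (liouville_check_gt0 R h1 h2 h3 h4 C0 h5 h6 hn).
Qed.

(** * Extending the grid bounds to more primes *)

(** Every term c / n is rounded upward. Trial division by [ds] lets every prime above its members
    survive, and an overcount would be harmless for an upper bound. *)
Fixpoint sieve_inv_sum (ds : seq Z) (c : Z) (k : nat) (n acc : Z) : Z :=
  match k with
  | O => acc
  | S k => sieve_inv_sum ds c k (Z.succ n)
      (if all (fun d => ~~ Z.eqb (Z.modulo n d) 0) ds then Z.succ (acc + c / n)%BZ else acc)
  end.

Definition small_divisors : seq Z :=
  [:: 2; 3; 5; 7; 11; 13; 17; 19; 23; 29; 31; 37; 41; 43; 47; 53; 59; 61; 67; 71; 73]%BZ.

Lemma inv_sum_checkE :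
  Z.leb (3 * sieve_inv_sum small_divisors (2 ^ 24) (Z.to_nat 5500) 501 0) (2 ^ 24) = true.
Proof. by vm_cast_no_check (erefl true). Qed.

Section Extension.
Variable R : realType.

Definition lam_upto (y : nat) : nat -> local_type R :=
  fun q => if (q <= y)%N then Full (-1) else Zero.

Definition inv_prime_sum (a b : nat) : R := \sum_(a <= p < b | prime p) p%:R^-1.

Lemma sieve_inv_sumP ds (c : Z) (k a : nat) acc : (0 < c)%BZ -> (0 < a)%N ->
  (forall d, d \in ds -> (1 < d < Z.of_nat a)%BZ) ->
  ZtoR R acc + ZtoR R c * inv_prime_sum a (a + k)
  <= ZtoR R (sieve_inv_sum ds c k (Z.of_nat a) acc).
Proof.
move=> c0; elim: k a acc => [|k IH] a acc a0 hd /=.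
  by rewrite /inv_prime_sum addn0 big_geq // mulr0 addr0.
have ea : Z.succ (Z.of_nat a) = Z.of_nat a.+1 by lia.
rewrite ea; set acc' := (if _ then _ else _).
have hd' d : d \in ds -> (1 < d < Z.of_nat a.+1)%BZ by move=> /hd; lia.
apply: le_trans (IH a.+1 acc' isT hd'); rewrite addSnnS.
rewrite /inv_prime_sum (@big_ltn_cond _ _ _ a); last by lia.
have step : ZtoR R acc + (if prime a then ZtoR R c / a%:R else 0) <= ZtoR R acc'.
  rewrite /acc'; case: (boolP (all _ _)) => hall; last first.
    case: ifP => pa; last by rewrite addr0.
    move: hall; rewrite -has_predC => /hasP[d din hd2].
    have [d1 da] := hd d din; move: hd2; rewrite /= negbK => hd2; exfalso.
    have hmod : (Z.of_nat a mod d = 0)%BZ by apply/Z.eqb_eq.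
    have /primeP[_ /(_ (Z.to_nat d))] := pa.
    have -> : (Z.to_nat d %| a)%N.
      apply/dvdnP; exists (Z.to_nat (Z.of_nat a / d)).
      have := Z.div_mod (Z.of_nat a) d; nia.
    by move=> /(_ isT)/orP[/eqP|/eqP]; lia.
  have l : ZtoR R c / a%:R <= ZtoR R (Z.succ (c / Z.of_nat a)).
    rewrite ler_pdivrMr ?ltr0n // -ZtoR_nat -ZtoRM; apply: ZtoR_le.
    have := Z.div_mod c (Z.of_nat a); have := Z.mod_pos_bound c (Z.of_nat a); nia.
  have -> : (Z.succ (acc + c / Z.of_nat a) = acc + Z.succ (c / Z.of_nat a))%BZ by lia.
  rewrite ZtoRD lerD2l; case: ifP => _; first exact: l.
  by apply: le_trans l; rewrite divr_ge0 // ltW // ZtoR_gt0.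
case: ifP step => pa step; last by rewrite -[ZtoR R acc]addr0 lerD2r.
by rewrite mulrDr addrA lerD2r.
Qed.

Lemma inv_prime_sum_le : inv_prime_sum 501 (60 * 100).+1 <= 3^-1.
Proof.
have hd d : d \in small_divisors -> (1 < d < Z.of_nat 501)%BZ.
  have /allP h : all (fun d => Z.ltb 1 d && Z.ltb d (Z.of_nat 501)) small_divisors by [].
  by move=> /h/andP[/Z.ltb_lt h1 /Z.ltb_lt h2].
have := inv_sum_checkE.
have c0 : (0 < 2 ^ 24)%BZ by [].
move: (2 ^ 24)%BZ c0 => c c0 /Z.leb_le h1.
have := @sieve_inv_sumP small_divisors c (Z.to_nat 5500) 501 0 c0 isT hd.
rewrite -[Z.of_nat 501]/(501%BZ) (_ : (501 + Z.to_nat 5500)%N = (60 * 100).+1); last by lia.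
move: (sieve_inv_sum _ _ _ _ _) h1 => s /(ZtoR_le R); rewrite ZtoRM (@ZtoR_cst _ 3 3%BZ erefl).
have := ZtoR_gt0 R c0; rewrite ZtoR0 add0r => c0' h1 h2.
rewrite -(ler_pM2l c0'); apply: (le_trans h2).
by rewrite ler_pdivlMr // mulrC.
Qed.

Lemma lam_upto_primes500 n :
  log_sum (full_on R (rev primes500)) n = log_sum (lam_upto 500) n.
Proof.
apply: eq_log_sum => q qp _; rewrite /full_on /lam_upto mem_rev mem_filter qp mem_iota.
by have := prime_gt1 qp; case: (leqP q 500) => h1 h2; [rewrite ifT | rewrite ifF] => //; lia.
Qed.

Lemma lam_uptoS_nprime y n : ~~ prime y.+1 ->
  log_sum (lam_upto y.+1) n = log_sum (lam_upto y) n.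
Proof.
move=> np; apply: eq_log_sum => q qp _; rewrite /lam_upto leq_eqVlt.
by case: eqP => //= e; rewrite e (negPf np) in qp.
Qed.

Lemma lam_uptoS_prime y n : prime y.+1 -> log_sum (lam_upto y.+1) n =
  log_sum (lam_upto y) n - y.+1%:R^-1 * log_sum (lam_upto y.+1) (n %/ y.+1).
Proof.
move=> yp; rewrite (@log_sum_full _ _ y.+1 (-1)) //; last by rewrite /lam_upto leqnn.
rewrite mulN1r mulNr; congr (_ - _); apply: eq_log_sum => q _ _.
rewrite /upd /lam_upto; case: eqP => [->|]; first by rewrite ltnn.
by rewrite leq_eqVlt => /eqP/negPf ->.
Qed.

Lemma inv_prime_sumS a b : (a <= b)%N ->
  inv_prime_sum a b.+1 = inv_prime_sum a b + (if prime b then b%:R^-1 else 0).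
Proof. by move=> ab; rewrite /inv_prime_sum big_mkcond big_nat_recr //= -big_mkcond. Qed.

Lemma le_inv_prime_sum a b c : (a <= b)%N -> (b <= c)%N ->
  inv_prime_sum a b <= inv_prime_sum a c.
Proof.
move=> ab; elim: c => [|c IH]; first by rewrite leqn0 => /eqP ->.
rewrite leq_eqVlt => /orP[/eqP -> //|bc]; rewrite inv_prime_sumS ?(leq_trans ab) //.
by apply: le_trans (IH bc) _; rewrite lerDl; case: ifP => // _; rewrite invr_ge0.
Qed.

Section Generic.
Variables X Y : nat.
Hypothesis liouX : forall n, (0 < n < X)%N -> 0 < log_sum (fun=> Full (-1 : R)) n.
Hypothesis XY : (66 * Y <= X)%N.
Hypothesis X0 : (0 < X)%N.
Hypothesis low500 : forall n, (X <= n)%N -> 14 / 100 <= log_sum (lam_upto 500) n.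
Hypothesis up500 : forall n, (66 <= n)%N -> log_sum (lam_upto 500) n <= 18 / 100.
Hypothesis inv_sum13 : inv_prime_sum 501 Y.+1 <= 3^-1.

Lemma lam_upto_small y n : (n < X)%N -> 0 <= log_sum (lam_upto y) n.
Proof.
move=> hn; have h : pos_upto (fun=> Full (-1 : R)) n.
  by move=> m /andP[m0 mn]; apply: liouX; rewrite m0 (leq_ltn_trans mn).
apply: pos_upto_ge0 (leqnn n); apply: pos_upto_dominates h => p _ _.
by rewrite /lam_upto; case: ifP => _; [constructor 1 | constructor 3].
Qed.

(** Adding the prime p = y + 1 subtracts A_p(n/p)/p. Nonnegativity makes the sums decrease with y;
    for n >= X the loss is then at most 0.18/p, as n / p >= 66, and 0.14 - 0.18/3 = 0.08 remains.
    Below X nonnegativity comes from the Liouville sums by domination. The claims feed one another,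
    hence the joint induction. *)
Lemma lam_upto_bounds y : (500 <= y)%N -> (y <= Y)%N -> forall n,
  [/\ 0 <= log_sum (lam_upto y) n, log_sum (lam_upto y) n <= log_sum (lam_upto 500) n &
  (X <= n)%N -> 14 / 100 - 18 / 100 * inv_prime_sum 501 y.+1 <= log_sum (lam_upto y) n].
Proof.
elim: y => [//|y IH] y0 y1.
have [e|y5] := eqVneq y.+1 500%N.
  move=> n; rewrite e; split=> //; last by rewrite /inv_prime_sum big_geq // mulr0 subr0; exact: low500.
  have [hn|hn] := ltnP n X; first exact: lam_upto_small.
  by apply: le_trans (low500 hn); rewrite divr_ge0.
have y0' : (500 <= y)%N by rewrite -ltnS ltn_neqAle eq_sym y5.
have {}IH := IH y0' (ltnW y1).
have [yp|ynp] := boolP (prime y.+1); last first.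
  move=> n; have [h1 h2 h3] := IH n; rewrite lam_uptoS_nprime //; split=> //.
  by rewrite inv_prime_sumS ?(negPf ynp) ?addr0.
have s13 : inv_prime_sum 501 y.+2 <= 3^-1.
  by apply: le_trans inv_sum13; apply: le_inv_prime_sum.
elim/ltn_ind => n IHn.
have [h1 h2 h3] := IH n; have yi : 0 < y.+1%:R^-1 :> R by rewrite invr_gt0.
have [n0|n0] := posnP n.
  by rewrite n0 !log_sum0; split=> //; rewrite leqNgt X0.
have lt : (n %/ y.+1 < n)%N by rewrite ltn_Pdiv // ltnS (leq_trans _ y0').
have [g1 g2 _] := IHn _ lt.
have rec := lam_uptoS_prime n yp.
have low : (X <= n)%N ->
    14 / 100 - 18 / 100 * inv_prime_sum 501 y.+2 <= log_sum (lam_upto y.+1) n.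
  move=> hn; have {}h3 := h3 hn; rewrite inv_prime_sumS ?yp //.
  have n66 : (66 <= n %/ y.+1)%N.
    by rewrite leq_divRL // (leq_trans _ hn) // (leq_trans _ XY) // leq_mul2l y1 orbT.
  have := ler_wpM2l (ltW yi) (le_trans g2 (up500 n66)).
  by move: h3; rewrite rec; move: (y.+1%:R^-1 : R) => iv a b; lra.
split=> //.
  have [hn|hn] := ltnP n X; first exact: lam_upto_small.
  by apply: le_trans (low hn); lra.
by apply: le_trans h2; rewrite rec gerBl mulr_ge0 // ltW.
Qed.

Definition A_Y n := log_sum (lam_upto Y) n.
Hypothesis Y500 : (500 <= Y)%N.

Lemma A_Y_ge0 n : 0 <= A_Y n.
Proof. by have [] := lam_upto_bounds Y500 (leqnn _) n. Qed.

Lemma A_Y_sqr_le n : (forall n, (0 < n)%N -> 0 <= log_sum (lam_upto 500) n ->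
    log_sum (lam_upto 500) n ^+ 2 <= 13 / 400 + 194 / 100 / n.+1%:R) ->
  A_Y n ^+ 2 <= 13 / 400 + 194 / 100 / n.+1%:R.
Proof.
move=> H; have [n0|n0] := posnP n.
  by rewrite n0 /A_Y log_sum0 expr0n /= divr1; lra.
have [h1 h2 _] := lam_upto_bounds Y500 (leqnn _) n.
apply: le_trans (H _ n0 (le_trans h1 h2)).
by rewrite lerXn2r // nnegrE // (le_trans h1 h2).
Qed.

Lemma A_Y_ge n : (X <= n)%N -> 8 / 100 <= A_Y n.
Proof.
move=> hn; have [_ _ /(_ hn)] := lam_upto_bounds Y500 (leqnn _) n.
by apply: le_trans; have := inv_sum13; lra.
Qed.
End Generic.

Lemma lam_upto500_spec n : (0 < n)%N -> A500_spec (log_sum (lam_upto 500)) n.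
Proof. by move=> n0; have := A500P R n0; rewrite /A500_spec lam_upto_primes500. Qed.

Lemma lam_upto_facts X Y :
  (forall n, (0 < n < X)%N -> 0 < log_sum (fun=> Full (-1 : R)) n) ->
  (forall n, (0 < n)%N -> [/\ (X <= n)%N -> 14 / 100 <= log_sum (lam_upto 500) n,
     (66 <= n)%N -> log_sum (lam_upto 500) n <= 18 / 100 &
     0 <= log_sum (lam_upto 500) n ->
       log_sum (lam_upto 500) n ^+ 2 <= 13 / 400 + 194 / 100 / n.+1%:R]) ->
  inv_prime_sum 501 Y.+1 <= 3^-1 -> (66 * Y <= X)%N -> (500 <= Y)%N -> (0 < X)%N ->
  forall n, [/\ 0 <= A_Y Y n, A_Y Y n ^+ 2 <= 13 / 400 + 194 / 100 / n.+1%:R &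
   (X <= n)%N -> 8 / 100 <= A_Y Y n].
Proof.
move=> hl hs h13 e1 e2 e3 n.
have low n' : (X <= n')%N -> 14 / 100 <= log_sum (lam_upto 500) n'.
  by move=> h; have [h1 _ _] := hs n' (leq_trans e3 h); apply: h1.
have up n' : (66 <= n')%N -> log_sum (lam_upto 500) n' <= 18 / 100.
  by move=> h; have [_ h1 _] := hs n' (leq_trans (isT : (0 < 66)%N) h); apply: h1.
split.
- exact: (A_Y_ge0 hl e1 e3 low up h13 e2).
- by apply: (A_Y_sqr_le hl e1 e3 low up h13 e2) => n' n0; have [] := hs n' n0.
- exact: (A_Y_ge hl e1 e3 low up h13 e2).
Qed.

Definition tail_start := (400 * 1000)%N.
Definition prime_cut := (60 * 100)%N.

Lemma lam_upto_cut_facts n : [/\ 0 <= A_Y prime_cut n,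
  A_Y prime_cut n ^+ 2 <= 13 / 400 + 194 / 100 / n.+1%:R &
  (tail_start <= n)%N -> 8 / 100 <= A_Y prime_cut n].
Proof.
refine (@lam_upto_facts tail_start prime_cut _ _ _ _ _ _ n).
- exact: liouville_sum_gt0.
- exact: lam_upto500_spec.
- exact: inv_prime_sum_le.
- by rewrite /tail_start /prime_cut; lia.
- by rewrite /prime_cut; lia.
- by rewrite /tail_start; lia.
Qed.

End Extension.

(** * Second moment weights *)

(** The quotient 0 is dropped because the sums vanish there while the positive weights would not. *)
Definition fdiv (p n : nat) : option nat := if (p <= n)%N then Some (n %/ p)%N else None.

Lemma fdiv_some p n j : fdiv p n = Some j -> (p <= n)%N /\ j = (n %/ p)%N.
Proof. by rewrite /fdiv; case: ifP => // h [->]. Qed.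

Section Weights.
Variable R : realType.
Implicit Types (p n j z : nat) (ps : seq nat) (m : R).

(** This is why all decay is measured in n + 1: replacing n by the floor of n / p loses at most the
    factor p. *)
Lemma div_succ_ge p z : (0 < p)%N -> z.+1%:R <= p%:R * (z %/ p).+1%:R :> R.
Proof.
by move=> p0; rewrite -natrM ler_nat mulnC ltn_ceil.
Qed.

Lemma sqrt_div_succ p z : (0 < p)%N ->
  (Num.sqrt (z %/ p).+1%:R)^-1 <= Num.sqrt p%:R / Num.sqrt z.+1%:R :> R.
Proof.
move=> p0; rewrite ler_pdivlMr ?sqrtr_gt0 ?ltr0n //.
rewrite mulrC ler_pdivrMr ?sqrtr_gt0 ?ltr0n // -sqrtrM ?ler0n //.
by rewrite ler_wsqrtr // div_succ_ge.
Qed.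

Definition prod2 m ps : R := \prod_(p <- ps) (1 + m / p%:R ^+ 2).
Definition prod3 m ps : R := \prod_(p <- ps) (1 + m / (p%:R * Num.sqrt p%:R)).

Lemma prod2_ge0 m ps : 0 <= m -> 0 <= prod2 m ps.
Proof.
by move=> m0; apply: prodr_ge0 => p _; rewrite addr_ge0 // divr_ge0 // exprn_ge0.
Qed.

Lemma prod3_ge0 m ps : 0 <= m -> 0 <= prod3 m ps.
Proof.
move=> m0; apply: prodr_ge0 => p _.
by rewrite addr_ge0 // divr_ge0 // mulr_ge0 // sqrtr_ge0.
Qed.

Lemma rankin_step m b p z P : 0 <= m -> 0 <= b -> 0 <= P -> (0 < p)%N ->
  m / p%:R ^+ 2 * (b / Num.sqrt (z %/ p).+1%:R * P)
  <= b / Num.sqrt z.+1%:R * (m / (p%:R * Num.sqrt p%:R) * P).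
Proof.
move=> m0 b0 P0 p0; have p0' : 0 < p%:R :> R by rewrite ltr0n.
have s0 : 0 < Num.sqrt p%:R :> R by rewrite sqrtr_gt0.
have -> : b / Num.sqrt z.+1%:R * (m / (p%:R * Num.sqrt p%:R) * P) =
  m / p%:R ^+ 2 * (b * (Num.sqrt p%:R / Num.sqrt z.+1%:R) * P).
  have e : p%:R = Num.sqrt p%:R ^+ 2 :> R by rewrite sqr_sqrtr // ltW.
  have s1 : 0 < Num.sqrt z.+1%:R :> R by rewrite sqrtr_gt0.
  by rewrite {1 3}e; field; rewrite !gt_eqF.
rewrite ler_wpM2l ?divr_ge0 ?exprn_ge0 //.
by rewrite ler_wpM2r // ler_wpM2l // sqrt_div_succ.
Qed.

(** Rankin's trick with exponent 1/2: a constant part of G yields the factors 1 + m/p^2, while a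
    part decaying like (z + 1)^(-1/2) gains sqrt p at each division and yields 1 + m/p^(3/2). *)
Lemma weight_rankin m (G : nat -> R) (a b : R) ps z : 0 <= m -> 0 <= a -> 0 <= b ->
  (forall z, (0 < z)%N -> G z <= a + b / Num.sqrt z.+1%:R) ->
  all (leq 1) ps -> (0 < z)%N ->
  weight fdiv G m ps z <= a * prod2 m ps + b / Num.sqrt z.+1%:R * prod3 m ps.
Proof.
move=> m0 a0 b0 hG; elim: ps z => [|p ps IH] z /=.
  by rewrite /prod2 /prod3 !big_nil !mulr1 => _; apply: hG.
move=> /andP[p0 hps] z0; rewrite /prod2 /prod3 !big_cons -/(prod2 m ps) -/(prod3 m ps).
have := IH z hps z0; have P2 := prod2_ge0 ps m0; have P3 := prod3_ge0 ps m0.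
have i1 : 0 <= m / p%:R ^+ 2 by rewrite divr_ge0 ?exprn_ge0.
have i2 : 0 <= m / (p%:R * Num.sqrt p%:R) by rewrite divr_ge0 ?mulr_ge0 ?sqrtr_ge0.
have h0 : 0 <= b / Num.sqrt z.+1%:R by rewrite divr_ge0 ?sqrtr_ge0.
case E: (fdiv p z) => [j|] IHz.
  have [pz ->] := fdiv_some E.
  have j0 : (0 < z %/ p)%N by rewrite divn_gt0.
  have := ler_wpM2l i1 (IH _ hps j0).
  have := rankin_step z m0 b0 P3 p0.
  rewrite mulrDr; lra.
rewrite addr0; apply: (le_trans IHz).
rewrite lerD // ler_wpM2l // ler_peMl //; lra.
Qed.

(** At z = n only the value e is charged, so both Euler products lose their leading term 1. *)
Lemma weight_rankin1 m (G : nat -> R) (a b e : R) ps n : 0 <= m -> 0 <= a -> 0 <= b ->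
  (forall z, (0 < z)%N -> z != n -> G z <= a + b / Num.sqrt z.+1%:R) -> G n = e ->
  e <= a ->
  all (leq 2) ps -> (0 < n)%N ->
  weight fdiv G m ps n <=
    e + a * (prod2 m ps - 1) + b / Num.sqrt n.+1%:R * (prod3 m ps - 1).
Proof.
move=> m0 a0 b0 hG Ge ea; elim: ps => [|p ps IH] /=.
  by rewrite /prod2 /prod3 !big_nil !subrr !mulr0 !addr0 Ge.
move=> /andP[p0 hps] n0; rewrite /prod2 /prod3 !big_cons -/(prod2 m ps) -/(prod3 m ps).
have := IH hps n0; have P2 := prod2_ge0 ps m0; have P3 := prod3_ge0 ps m0.
have i1 : 0 <= m / p%:R ^+ 2 by rewrite divr_ge0 ?exprn_ge0.
have i2 : 0 <= m / (p%:R * Num.sqrt p%:R) by rewrite divr_ge0 ?mulr_ge0 ?sqrtr_ge0.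
have h0 : 0 <= b / Num.sqrt n.+1%:R by rewrite divr_ge0 ?sqrtr_ge0.
case E: (fdiv p n) => [j|] IHn.
  have [pz ->] := fdiv_some E.
  have j0 : (0 < n %/ p)%N by rewrite divn_gt0 // (leq_trans _ p0).
  have hps1 : all (leq 1) ps by apply: sub_all hps => q; apply: ltnW.
  have := @weight_rankin m G a b ps (n %/ p) m0 a0 b0 _ hps1 j0.
  have hG' z : (0 < z)%N -> G z <= a + b / Num.sqrt z.+1%:R.
    have [->|zn] := eqVneq z n; last by move=> z0; apply: hG.
    by rewrite Ge => _; rewrite ler_wpDr.
  move=> /(_ hG') h.
  have := ler_wpM2l i1 h; have := rankin_step n m0 b0 P3 (ltnW p0).
  rewrite mulrDr; lra.
rewrite addr0; apply: (le_trans IHn).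
have := mulr_ge0 i1 P2; have := mulr_ge0 i2 P3 => g1 g2.
rewrite lerD // ?lerD2l; rewrite ler_wpM2l //; lra.
Qed.

Lemma weight_small m (G : nat -> R) ps z : all (ltn z) ps -> weight fdiv G m ps z = G z.
Proof.
elim: ps => [//|p ps IH] /= /andP[pz h]; rewrite IH // /fdiv leqNgt pz addr0 //.
Qed.

(** Products of two primes of the list exceed n, so b is 1 or a single prime and the decay 1/(z + 1)
    is kept without Rankin's loss. *)
Lemma weight_linear m (G : nat -> R) (a b e : R) ps n : 0 <= m -> 0 <= a -> 0 <= b ->
  (forall z, z != n -> G z <= a + b / z.+1%:R) -> G n = e ->
  all (leq 2) ps -> (forall p q, p \in ps -> q \in ps -> (n < p * q)%N) ->
  weight fdiv G m ps n <=
    e + \sum_(p <- ps) (m * (a / p%:R ^+ 2 + b / n.+1%:R / p%:R)).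
Proof.
move=> m0 a0 b0 hG Ge; elim: ps => [|p ps IH] /=; first by rewrite big_nil addr0 Ge.
move=> /andP[p0 hps] hpq; rewrite big_cons addrCA.
have {}IH : weight fdiv G m ps n <= e + \sum_(p <- ps) (m * (a / p%:R ^+ 2 + b / n.+1%:R / p%:R)).
  by apply: IH => // q r hq hr; apply: hpq; rewrite inE ?hq ?hr orbT.
rewrite addrC lerD //.
have p1 : (0 < p)%N by apply: ltnW.
case E: (fdiv p n) => [j|]; last first.
  by rewrite mulr_ge0 // addr_ge0 // divr_ge0 // ?exprn_ge0 // divr_ge0.
have [pz ->] := fdiv_some E; rewrite weight_small; last first.
  apply/allP => q hq; rewrite /= ltn_divLR // mulnC; apply: hpq; first exact: mem_head.
  by rewrite inE hq orbT.
have p0' : 0 < p%:R :> R by rewrite ltr0n.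
rewrite -mulrA ler_wpM2l //.
have nn : (n %/ p != n)%N.
  by rewrite neq_ltn ltn_Pdiv // (leq_trans p1).
apply: le_trans (_ : p%:R ^- 2 * (a + b * (p%:R / n.+1%:R)) <= _).
  rewrite ler_wpM2l ?invr_ge0 ?exprn_ge0 ?(ltW p0') //.
  apply: le_trans (hG _ nn) _; rewrite lerD2l ler_wpM2l //.
  rewrite ler_pdivlMr ?ltr0n // mulrC ler_pdivrMr ?ltr0n //.
  exact: div_succ_ge.
rewrite le_eqVlt; apply/orP; left; apply/eqP.
have n0 : n.+1%:R != 0 :> R by rewrite pnatr_eq0.
by move: n0; move: (n.+1%:R : R) => N n0; field; rewrite n0 gt_eqF.
Qed.

End Weights.

(** * Sums over primes by residue classes modulo 6 *)

Lemma prime_mod6 j i : (0 < j)%N -> prime (6 * j + i) -> (i < 6)%N -> i = 1%N \/ i = 5%N.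
Proof.
move=> j0 pr i6.
have e d : (1 < d < 6)%N -> (d %| 6)%N -> (d %| i)%N -> False.
  move=> d1 d6 di; have dd : (d %| 6 * j + i)%N by rewrite dvdn_add // dvdn_mulr.
  by have /primeP[_ /(_ _ dd)] := pr; case/orP => /eqP; lia.
case: i i6 e {pr} => [|[|[|[|[|[|]]]]]] // _ e; first by case: (e 2%N).
- by left.
- by case: (e 2%N).
- by case: (e 3%N).
- by case: (e 2%N).
- by right.
Qed.

Definition primes_in (y n : nat) : seq nat := [seq p <- index_iota y.+1 n.+1 | prime p].

Section PrimeSums.
Variable R : realType.
Implicit Types (F : nat -> R) (a b n p : nat).

Lemma sum_nat6 F m : \sum_(m <= p < m + 6) F p =
  F m + F (m + 1)%N + F (m + 2)%N + F (m + 3)%N + F (m + 4)%N + F (m + 5)%N.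
Proof.
rewrite addnC -{1}[m]add0n big_addn addnK !big_nat_recr //= big_geq //.
by rewrite !add0n add0r addnC [in (2 + m)%N]addnC [in (3 + m)%N]addnC
  [in (4 + m)%N]addnC [in (5 + m)%N]addnC.
Qed.

(** Each block from 6 j to 6 j + 5 holds at most two primes, 6 j + 1 and 6 j + 5, each with value at
    most F(6 j). *)
Lemma sum_primes_mod6 F a b : (0 < a)%N -> (a <= b)%N ->
  (forall p, 0 <= F p) -> (forall p q, (0 < p <= q)%N -> F q <= F p) ->
  \sum_(6 * a <= p < 6 * b | prime p) F p <= \sum_(a <= j < b) 2 * F (6 * j)%N.
Proof.
move=> a0 ab F0 Fle; elim: b ab => [|b IH]; first by rewrite leqn0 => /eqP e; rewrite e in a0.
rewrite leq_eqVlt => /orP[/eqP ->|ab]; first by rewrite !big_geq.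
rewrite big_nat_recr //= (big_cat_nat (n := (6 * b)%N)) /=; [|lia|lia].
rewrite lerD ?IH //; have b0 : (0 < b)%N by lia.
have -> : (6 * b.+1 = 6 * b + 6)%N by lia.
rewrite big_mkcond sum_nat6.
have np i : (i < 6)%N -> i != 1%N -> i != 5%N -> prime (6 * b + i) = false.
  move=> i6 i1 i5; apply/negP => pr; case: (prime_mod6 b0 pr i6) => e; by rewrite e in i1 i5.
have := np 0%N isT isT isT; have := np 2%N isT isT isT.
have := np 3%N isT isT isT; have := np 4%N isT isT isT.
rewrite addn0 => -> -> -> ->.
have h i : (if prime (6 * b + i) then F (6 * b + i)%N else 0) <= F (6 * b)%N.
  by case: ifP => // _; apply: Fle; lia.
have := h 1%N; have := h 5%N; lra.
Qed.

Lemma sum_primes_in F a n : (0 < a)%N -> (6 * a <= n)%N ->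
  (forall p, 0 <= F p) -> (forall p q, (0 < p <= q)%N -> F q <= F p) ->
  \sum_(p <- primes_in (6 * a) n) F p <= \sum_(a <= j < (n %/ 6).+1) 2 * F (6 * j)%N.
Proof.
move=> a0 an F0 Fle; rewrite /primes_in big_filter.
have hb : (n.+1 <= 6 * (n %/ 6).+1)%N by lia.
have ab : (a <= (n %/ 6).+1)%N by lia.
apply: le_trans (sum_primes_mod6 a0 ab F0 Fle).
rewrite [leRHS](big_cat_nat (n := n.+1)) /=; [|lia|exact: hb].
rewrite [X in X + _](@big_ltn_cond _ _ _ (6 * a)%N) ?ltnS // ifF.
  by rewrite lerDl sumr_ge0.
by apply/negP => pr; case: (@prime_mod6 a 0 a0) => //; rewrite addn0.
Qed.

Lemma sum_telescope_le F (g : nat -> R) a b : (a <= b)%N ->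
  (forall j, (a <= j < b)%N -> F j <= g j.+1 - g j) ->
  \sum_(a <= j < b) F j <= g b - g a.
Proof.
move=> ab h; rewrite -telescope_sumr //; rewrite big_nat [leRHS]big_nat.
exact: ler_sum.
Qed.

(** Here and in the next two lemmas 2 F(6 x) is compared with its integral: g is a primitive
    evaluated at j - 1, and the sum telescopes. *)
Lemma sum_primes_sqr a n : (1 < a)%N -> (6 * a <= n)%N ->
  \sum_(p <- primes_in (6 * a) n) p%:R ^- 2 <= 18^-1 / a.-1%:R :> R.
Proof.
move=> a1 an; apply: le_trans (sum_primes_in _ an _ _) _; first by lia.
- by move=> p; rewrite invr_ge0 exprn_ge0.
- move=> p q /andP[p0 pq]; rewrite lef_pV2 ?posrE ?exprn_gt0 ?ltr0n //; last by lia.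
  by rewrite lerXn2r ?nnegrE ?ler0n // ler_nat.
pose g j : R := - (18^-1 / j.-1%:R).
apply: le_trans (sum_telescope_le (g := g) _ _) _; first by lia.
  move=> j /andP[aj _]; case: j aj => [|[|j]] aj; try lia.
  have e1 : j.+1%:R = 1 + j%:R :> R by rewrite -natr1 addrC.
  have e2 : j.+2%:R = 2 + j%:R :> R by rewrite -natr1 e1; ring.
  rewrite /g /= natrM e1 e2; have : 0 <= (j%:R : R) by [].
  move: (j%:R : R) => J J0.
  rewrite -subr_ge0.
  have -> : - (18^-1 / (2 + J)) - - (18^-1 / (1 + J)) - 2 / (6 * (2 + J)) ^+ 2 =
     18^-1 / ((1 + J) * (2 + J) ^+ 2).
    by field; rewrite !gt_eqF //; lra.
  by rewrite divr_ge0 ?invr_ge0 ?mulr_ge0 ?exprn_ge0 //; lra.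
by rewrite /g opprK addrC gerBl !divr_ge0 ?invr_ge0.
Qed.

Lemma sum_primes_sqrt a n : (1 < a)%N -> (6 * a <= n)%N ->
  \sum_(p <- primes_in (6 * a) n) (p%:R * Num.sqrt p%:R)^-1
  <= 2 / (3 * Num.sqrt 6) / Num.sqrt a.-1%:R :> R.
Proof.
move=> a1 an; apply: le_trans (sum_primes_in _ an _ _) _; first by lia.
- by move=> p; rewrite invr_ge0 mulr_ge0 ?sqrtr_ge0.
- move=> p q /andP[p0 pq].
  have q0 : (0 < q)%N by lia.
  rewrite lef_pV2 ?posrE ?mulr_gt0 ?sqrtr_gt0 ?ltr0n //.
  by rewrite ler_pM ?sqrtr_ge0 // ?ler_wsqrtr // ler_nat.
have s6 : 0 < Num.sqrt 6 :> R by rewrite sqrtr_gt0.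
pose g j : R := - (2 / (3 * Num.sqrt 6) / Num.sqrt j.-1%:R).
apply: le_trans (sum_telescope_le (g := g) _ _) _; first by lia.
  move=> j /andP[aj _]; case: j aj => [|[|j]] aj; try lia.
  rewrite /g /= natrM sqrtrM //.
  have t0 : 0 < Num.sqrt j.+1%:R :> R by rewrite sqrtr_gt0.
  have u0 : 0 < Num.sqrt j.+2%:R :> R by rewrite sqrtr_gt0.
  have e : j.+2%:R = j.+1%:R + 1 :> R by rewrite natr1.
  have et := sqr_sqrtr (ler0n R j.+1); have eu := sqr_sqrtr (ler0n R j.+2).
  rewrite -[in X in X * (_ * _)]eu.
  move: (Num.sqrt 6) s6 => s s0.
  move: (Num.sqrt j.+1%:R) (Num.sqrt j.+2%:R) t0 u0 et eu => t u t0 u0 et eu.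
  have tu : (u - t) * (u + t) = 1 by rewrite -subr_sqr et eu e addrC addKr.
  have tu0 : t < u.
    rewrite -subr_gt0 -(pmulr_lgt0 _ (_ : 0 < u + t)) ?tu //; lra.
  rewrite -subr_ge0.
  have -> : - (2 / (3 * s) / u) - - (2 / (3 * s) / t) - 2 / (6 * u ^+ 2 * (s * u)) =
     (3 * s * u ^+ 3 * t)^-1 * (2 * u ^+ 2 * (u - t) - t).
    by field; rewrite !gt_eqF.
  rewrite mulr_ge0 ?invr_ge0 ?mulr_ge0 ?exprn_ge0 ?(ltW s0) ?(ltW u0) ?(ltW t0) //.
  have -> : 2 * u ^+ 2 * (u - t) - t = 2 * u ^+ 2 * (u - t) - t * ((u - t) * (u + t)).
    by rewrite tu mulr1.
  have -> : 2 * u ^+ 2 * (u - t) - t * ((u - t) * (u + t)) =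
    (u - t) * ((u - t) * (u + u + t)) by ring.
  by repeat apply: mulr_ge0; lra.
by rewrite /g opprK addrC gerBl !divr_ge0 ?mulr_ge0 ?sqrtr_ge0.
Qed.

Lemma sum_primes_inv a n : (1 < a)%N -> (6 * a <= n)%N ->
  \sum_(p <- primes_in (6 * a) n) p%:R^-1
  <= 3^-1 * (ln (n%:R / 6) - ln a.-1%:R) :> R.
Proof.
move=> a1 an; apply: le_trans (sum_primes_in _ an _ _) _; first by lia.
- by move=> p; rewrite invr_ge0.
- by move=> p q /andP[p0 pq]; rewrite lef_pV2 ?posrE ?ltr0n ?ler_nat //; lia.
pose g j : R := 3^-1 * ln j.-1%:R.
apply: le_trans (sum_telescope_le (g := g) _ _) _; first by lia.
  move=> j /andP[aj _]; case: j aj => [|[|j]] aj; try lia.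
  rewrite /g /= -mulrBr natrM.
  have j1 : 0 < j.+1%:R :> R by [].
  have j2 : 0 < j.+2%:R :> R by [].
  rewrite (_ : 2 / (6 * j.+2%:R) = 3^-1 * j.+2%:R^-1); last first.
    by move: (j.+2%:R : R) j2 => x x0; field; rewrite gt_eqF.
  have -> : ln j.+2%:R = ln j.+1%:R - ln (1 + - j.+2%:R^-1) :> R.
    have -> : 1 + - j.+2%:R^-1 = j.+1%:R / j.+2%:R :> R.
      have e : j.+2%:R = j.+1%:R + 1 :> R by rewrite natr1.
      move: (j.+2%:R : R) (j.+1%:R : R) j2 e => x y x0 e; have {e} -> : y = x - 1 by rewrite e addrK.
      by field; rewrite gt_eqF.
    by rewrite ln_div ?posrE // opprB addrC subrK.
  rewrite ler_wpM2l ?invr_ge0 // addrAC subrr add0r lerNr le_ln1Dx //.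
  by rewrite ltrN2 invf_lt1 // ltr1n.
rewrite /g -mulrBr ler_wpM2l ?invr_ge0 // lerD2r ler_ln ?posrE ?ltr0n ?divr_gt0 ?ltr0n //; try lia.
by rewrite ler_pdivlMr // -natrM ler_nat; lia.
Qed.

End PrimeSums.

(** * Numerical constants *)

Section Numeric.
Variable R : realType.
Implicit Types (x y : R) (m : R) (n p : nat) (ps : seq nat).

Lemma prod_le_expR (f : nat -> R) ps : (forall p, 0 <= f p) ->
  \prod_(p <- ps) (1 + f p) <= expR (\sum_(p <- ps) f p).
Proof.
move=> f0; elim: ps => [|p ps IH]; first by rewrite !big_nil expR0.
rewrite !big_cons expRD ler_pM ?expR_ge1Dx ?addr_ge0 //.
by apply: prodr_ge0 => q _; rewrite addr_ge0.
Qed.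

Lemma expR_le_inv x y : 0 < y -> y <= 1 - x -> expR x <= y^-1.
Proof.
move=> y0 yx; rewrite -[x]opprK expRN lef_pV2 ?posrE ?expR_gt0 //.
by apply: le_trans yx _; rewrite expR_ge1Dx.
Qed.

(** Powers are bounded by repeated squaring with rounding at each step, so that [lra] meets short
    rationals only. *)
Lemma sqrn_le x y z (k : nat) : 0 <= x -> x ^+ k <= y -> y * y <= z -> x ^+ k.*2 <= z.
Proof.
move=> x0 h; apply: le_trans; rewrite -addnn exprD.
by rewrite ler_pM // exprn_ge0.
Qed.

Lemma sqrn_ge x y z (k : nat) : 0 <= y -> y <= x ^+ k -> z <= y * y -> z <= x ^+ k.*2.
Proof.
move=> y0 h zy; apply: (le_trans zy); rewrite -addnn exprD.
by rewrite ler_pM.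
Qed.

Lemma expR1_le3 : expR 1 <= 3 :> R.
Proof.
have -> : 1 = 8%:R * (1 / 8) :> R by field.
rewrite expRM_natl.
have h : expR (1 / 8) <= 8 / 7 :> R.
  by rewrite (_ : 8 / 7 = (7 / 8)^-1) ?expR_le_inv //; [lra..|field].
have h0 := expR_ge0 (1 / 8 : R).
have h1 : expR (1 / 8) ^+ 1 <= 8 / 7 :> R by [].
have h2 : expR (1 / 8) ^+ 2 <= 131 / 100 :> R by apply: (sqrn_le h0 h1); lra.
have h4 : expR (1 / 8) ^+ 4 <= 172 / 100 :> R by apply: (sqrn_le h0 h2); lra.
by apply: (sqrn_le h0 h4); lra.
Qed.

(** 127 is 2 k - 1 for k = 64, and 4.307/500 bounds the sum of p^(-3/2) over p > 6000; the result
    bounds [prod3]. *)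
Lemma expR_rankin : expR (127 * ((43 * 100 + 7) / (100 * 10)) / (5 * 100)) <= (3 * 100 + 5) / 100 :> R.
Proof.
have h0 := expR_ge0 ((85 * 100 + 47) / (25 * 100 * 100) : R).
have h1 : expR ((85 * 100 + 47) / (25 * 100 * 100)) ^+ 1 <= (103 * 100 + 54) / (100 * 100) :> R.
  rewrite expr1; apply: le_trans (expR_le_inv (y := ((103 * 100 + 54) / (100 * 100))^-1) _ _) _.
  - by rewrite invf_div divr_gt0; lra.
  - by rewrite invf_div ler_pdivrMr; lra.
  - by rewrite invrK.
set e := expR _ in h0 h1.
have h2 : e ^+ 2 <= (107 * 100 + 21) / (100 * 100) by apply: (sqrn_le h0 h1); lra.
have h4 : e ^+ 4 <= (114 * 100 + 94) / (100 * 100) by apply: (sqrn_le h0 h2); lra.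
have h8 : e ^+ 8 <= (132 * 100 + 12) / (100 * 100) by apply: (sqrn_le h0 h4); lra.
have h16 : e ^+ 16 <= (174 * 100 + 56) / (100 * 100) by apply: (sqrn_le h0 h8); lra.
have h32 : e ^+ 32 <= (3 * 100 + 5) / 100 by apply: (sqrn_le h0 h16); lra.
apply: le_trans h32.
by rewrite -expRM_natl ler_expR; lra.
Qed.

Section Bounds.
Variables X a : nat.
(** a = 1000 and Y = 6 a = 6000; the telescoped sums start at a - 1 = 999, which is 27 times 37. *)
Hypothesis a1 : a.-1%:R = 27 * 37 :> R.
Hypothesis aX : (6 * a <= X)%N.
Hypothesis XE : X%:R = 40 * 100 * 100 :> R.
Local Notation Y := (6 * a)%N.

Lemma a_gt1 : (1 < a)%N.
Proof.
case: a a1 => [|[|//]] /=; move/eqP; rewrite lt_eqF //; lra.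
Qed.

Lemma aE : Y%:R = 60 * 100 :> R.
Proof.
have e : a%:R = a.-1%:R + 1 :> R by rewrite natr1 prednK // ltnW // a_gt1.
by rewrite natrM e a1; lra.
Qed.

Lemma primes_in_gt n p : p \in primes_in Y n -> (Y < p)%N.
Proof. by rewrite mem_filter mem_index_iota => /andP[_ /andP[]]. Qed.

Lemma primes_in_ge2 n : all (leq 2) (primes_in Y n).
Proof. by apply/allP => p; rewrite mem_filter => /andP[/prime_gt1]. Qed.

Definition micro : R := 1 / (100 * 100 * 100).

Lemma S2_le n : (Y <= n)%N ->
  \sum_(p <- primes_in Y n) p%:R ^- 2 <= 557 / 10 * micro.
Proof.
move=> Yn; apply: le_trans (sum_primes_sqr R a_gt1 Yn) _.
by rewrite a1 /micro; lra.
Qed.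

Lemma S3_le n : (Y <= n)%N ->
  \sum_(p <- primes_in Y n) (p%:R * Num.sqrt p%:R)^-1 <= ((43 * 100 + 7) / (100 * 10)) / (5 * 100) :> R.
Proof.
move=> Yn; apply: le_trans (sum_primes_sqrt R a_gt1 Yn) _.
rewrite a1 -[leLHS]mulrA -invfM -[3 * _ * _]mulrA -sqrtrM //.
have h : 774 / 10 <= Num.sqrt (6 * (27 * 37)) :> R.
  have c0 : 0 <= 774 / 10 :> R by lra.
  by rewrite -(ger0_norm c0) -sqrtr_sqr; apply: ler_wsqrtr; rewrite expr2; lra.
rewrite ler_pdivrMr; last by rewrite mulr_gt0 //; lra.
by move: (Num.sqrt _) h => s h; lra.
Qed.

(** The sum is only used divided by n + 1, so the logarithm is traded for a linear bound: ln t <= t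
    - 1 with t = n / X, and ln(400000/5994) <= 4.35. *)
Lemma S1_le n : (X <= n)%N -> 3 * \sum_(p <- primes_in Y n) p%:R^-1 <= 435 / 100 * (n%:R / X%:R) :> R.
Proof.
move=> Xn; have n0 : (X%:R : R) <= n%:R by rewrite ler_nat.
rewrite XE in n0 *.
have := sum_primes_inv R a_gt1 (leq_trans aX Xn); rewrite a1.
rewrite -ln_div ?posrE; [|lra|lra].
set t := n%:R / (40 * 100 * 100).
have t1 : 1 <= t by rewrite /t; lra.
have -> : n%:R / 6 / (27 * 37) = (1 + (t - 1)) * ((40 * 100 * 100) / (6 * (27 * 37))).
  by rewrite /t; field.
have q0 : 0 < (40 * 100 * 100) / (6 * (27 * 37)) :> R by rewrite divr_gt0; lra.
rewrite lnM ?posrE //; last by lra.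
have h1 : ln (1 + (t - 1)) <= t - 1 by apply: le_ln1Dx; lra.
have h2 : ln ((40 * 100 * 100) / (6 * (27 * 37))) <= 435 / 100 :> R.
  rewrite -[leRHS]expRK ler_ln ?posrE ?expR_gt0 //.
  have k : 0 <= 1 + 435 / (64 * 100) :> R by lra.
  have : expR (435 / (64 * 100)) ^+ 64 = expR (435 / 100) :> R.
    by rewrite -expRM_natl; congr expR; lra.
  move=> <-; apply: le_trans (_ : (1 + 435 / (64 * 100)) ^+ 64 <= _); last first.
    by rewrite lerXn2r ?nnegrE ?expR_ge0 ?expR_ge1Dx.
  set e := 1 + _.
  have h1' : (106 * 100 + 79) / (100 * 100) <= e ^+ 1 by rewrite expr1 /e; lra.
  have h2' : (114 * 100 + 4) / (100 * 100) <= e ^+ 2 by apply: (sqrn_ge _ h1'); lra.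
  have h4' : (130 * 100 + 5) / (100 * 100) <= e ^+ 4 by apply: (sqrn_ge _ h2'); lra.
  have h8' : (169 * 100 + 13) / (100 * 100) <= e ^+ 8 by apply: (sqrn_ge _ h4'); lra.
  have h16' : (286 * 100 + 4) / (100 * 100) <= e ^+ 16 by apply: (sqrn_ge _ h8'); lra.
  have h32' : (818 * 100 + 18) / (100 * 100) <= e ^+ 32 by apply: (sqrn_ge _ h16'); lra.
  have h64 : 669 / 10 <= e ^+ 64 by apply: (sqrn_ge _ h32'); lra.
  by apply: le_trans h64; rewrite ler_pdivrMr; lra.
by move: (ln _) (ln _) h1 h2 => u v; lra.
Qed.

End Bounds.
End Numeric.

(** * Tail bounds for n below 2^224 *)

Section Regimes.
Variable R : realType.
Lemma micro_gt0 : 0 < (micro R). Proof. by rewrite /(micro R); lra. Qed.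

Lemma sum_scale (m : R) ps (F : nat -> R) (u v : R) : 
  \sum_(p <- ps) m * (u / p%:R ^+ 2 + v / p%:R) =
  m * (u * (\sum_(p <- ps) p%:R ^- 2) + v * (\sum_(p <- ps) p%:R^-1)) :> R.
Proof. by rewrite -mulr_sumr big_split /= -!mulr_sumr. Qed.

Lemma prod_ge1 (f : nat -> R) ps : (forall p, 0 <= f p) -> 1 <= \prod_(p <- ps) (1 + f p).
Proof.
move=> f0; elim: ps => [|p ps IH]; first by rewrite big_nil.
by rewrite big_cons (le_trans IH) // ler_peMl ?lerDl // (le_trans ler01 IH).
Qed.

(* The sum of quota n over n >= X telescopes to 2 ^- 131 / (X + 1). *)
Definition quota (n : nat) : R := 2 ^- 131 / (n.+1%:R * n.+2%:R).

Lemma le_quota n (N j : nat) : n.+2%:R <= (2 : R) ^+ N -> (131 + (N + N) <= j)%N ->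
  2 ^- j <= quota n.
Proof.
move=> hn hj; rewrite /quota ler_pdivlMr ?mulr_gt0 ?ltr0n // mulrC.
rewrite ler_pdivrMr ?exprn_gt0 ?ltr0n // [leRHS]mulrC ler_pdivlMr ?exprn_gt0 ?ltr0n //.
have h1 : n.+1%:R <= (2 : R) ^+ N by apply: le_trans hn; rewrite ler_nat.
apply: le_trans (_ : 2 ^+ N * 2 ^+ N * 2 ^+ 131 <= _).
  by rewrite ler_wpM2r ?exprn_ge0 // ler_pM.
by rewrite -!exprD ler_weXn2l ?ler1n // addnC.
Qed.

Lemma natr_lt2 n (N : nat) : n%:R < (2 : R) ^+ N -> n.+2%:R <= (2 : R) ^+ N.+1.
Proof.
rewrite -!natrX ltr_nat ler_nat expnS mul2n -addnn => h.
case: n h => [|n] h; last by apply: leq_trans (leq_add h h); lia.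
by have := expn_gt0 2 N; lia.
Qed.

Lemma pow_low : (9 / 25) ^+ 128 <= 2 ^- 184 :> R.
Proof.
(* 0.36^2 is close to 2^-3, so x is close to 1 and coarse rounding of its powers suffices. *)
pose x : R := (9 / 25) ^+ 2 * 2 ^+ 3.
have x0 : 0 <= x by rewrite mulr_ge0 // exprn_ge0 //; lra.
have h1 : x ^+ 1 <= 1037 / 1000 by rewrite expr1 /x expr2 !exprS expr0; lra.
have h2 : x ^+ 2 <= 1076 / 1000 by apply: (sqrn_le x0 h1); lra.
have h4 : x ^+ 4 <= 1158 / 1000 by apply: (sqrn_le x0 h2); lra.
have h8 : x ^+ 8 <= 2 by apply: (sqrn_le x0 h4); lra.
have h : x ^+ 64 <= 2 ^+ 8 by rewrite (exprM _ 8 8) lerXn2r ?nnegrE ?exprn_ge0.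
rewrite -[leRHS]mul1r ler_pdivlMr ?exprn_gt0 // -(@ler_pM2r _ (2 ^+ 8)) ?exprn_gt0 //.
rewrite mul1r -mulrA -exprD; apply: le_trans h.
by rewrite /x (exprMn 64) -[(_ ^+ 2) ^+ 64]exprM -[(_ ^+ 3) ^+ 64]exprM.
Qed.

Lemma pow_mid : (1 / 9) ^+ 64 <= 2 ^- 200 :> R.
Proof.
pose x : R := 1 / 9 * 2 ^+ 3.
have x0 : 0 <= x by rewrite /x !exprS expr0; lra.
have h1 : x ^+ 1 <= 8 / 9 by rewrite expr1 /x !exprS expr0; lra.
have h2 : x ^+ 2 <= 4 / 5 by apply: (sqrn_le x0 h1); lra.
have h4 : x ^+ 4 <= 2 / 3 by apply: (sqrn_le x0 h2); lra.
have h8 : x ^+ 8 <= 2^-1 by apply: (sqrn_le x0 h4); lra.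
have h : x ^+ 64 <= 2^-1 ^+ 8 by rewrite (exprM _ 8 8) lerXn2r ?nnegrE ?exprn_ge0 ?invr_ge0.
rewrite -[leRHS]mul1r ler_pdivlMr ?exprn_gt0 // (exprD _ 192 8) mulrA.
rewrite -ler_pdivlMr ?exprn_gt0 // [1 / 2 ^+ 8]mul1r -[(2 ^+ 8)^-1]exprVn; apply: le_trans h.
by rewrite /x [leRHS](exprMn 64) -[(_ ^+ 3) ^+ 64]exprM.
Qed.

Lemma pow2_inv (i j : nat) : (2 ^- i) ^+ j = 2 ^- (i * j) :> R.
Proof. by rewrite exprVn exprM. Qed.

Lemma sqrt_pow2_le n (N : nat) : (2 : R) ^+ N.*2 <= n%:R -> 2 ^+ N <= Num.sqrt n.+1%:R :> R.
Proof.
move=> h; rewrite -[2 ^+ N]ger0_norm ?exprn_ge0 // -sqrtr_sqr ler_wsqrtr //.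
by rewrite -exprM muln2 (le_trans h) // ler_nat.
Qed.

Variables (A : nat -> R) (X a : nat).
Hypothesis A_sqr : forall n, A n ^+ 2 <= 13 / 400 + 194 / 100 / n.+1%:R.
Hypothesis a1 : a.-1%:R = 27 * 37 :> R.
Hypothesis aX : (6 * a <= X)%N.
Hypothesis XE : X%:R = 40 * 100 * 100 :> R.
Local Notation Y := (6 * a)%N.

(* off A n is A with its value at n erased: its chaos at n is the chaos of A
   without the deterministic term. The bound at n must be positive for the
   hypercontractive estimate, hence the tiny constant (micro R). *)
Definition off (n z : nat) : R := if z == n then 0 else A z.
Definition off_bound (n z : nat) : R :=
  if z == n then (micro R) else 13 / 400 + 194 / 100 / z.+1%:R.

Lemma off_tail k n (t r : R) : 0 < t ->
  weight fdiv (off_bound n) k.*2.-1%:R (primes_in Y n) n <= r * t ^+ 2 ->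
  avg (primes_in Y n) (fun s => (t <= `|chaos fdiv (off n) (primes_in Y n) s n|)%R%:R) <= r ^+ k.
Proof.
move=> t0 hw; have G0 z : 0 < off_bound n z.
  rewrite /off_bound; case: ifP => _; first exact: micro_gt0.
  by rewrite addr_gt0 ?divr_gt0 ?ltr0n //; lra.
have gG z : off n z ^+ 2 <= off_bound n z.
  rewrite /off /off_bound; case: ifP => _; last exact: A_sqr.
  by rewrite expr0n /= ltW // micro_gt0.
have u : uniq (primes_in Y n) by rewrite filter_uniq // iota_uniq.
apply: le_trans (chaos_tail fdiv G0 gG k n u t0) _.
have w0 : 0 < weight fdiv (off_bound n) k.*2.-1%:R (primes_in Y n) n by apply: weight_gt0.
have t2 : 0 < t ^+ 2 by rewrite exprn_gt0.
rewrite lerXn2r ?nnegrE ?divr_ge0 ?(ltW w0) ?(ltW t2) //; last by rewrite ler_pdivrMr.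
by rewrite -(pmulr_lge0 _ t2) (le_trans (ltW w0)).
Qed.

(** n < Y^2 leaves b = 1 or b prime. The factor 255 belongs to k = 128, and the total, about
    0.00226, is just below 0.36 times 0.08^2. *)
Lemma weight_low n : (X <= n)%N -> (n < Y * Y)%N ->
  weight fdiv (off_bound n) 255 (primes_in Y n) n <= 9 / 25 * (8 / 100) ^+ 2.
Proof.
move=> Xn nY2; have m0 := micro_gt0.
apply: le_trans (@weight_linear R 255 (off_bound n) (13 / 400) (194 / 100) (micro R) _ n _ _ _ _ _ _ _) _.
- exact: ler0n.
- by lra.
- by lra.
- by move=> z zn; rewrite /off_bound (negPf zn).
- by rewrite /off_bound eqxx.
- exact: primes_in_ge2.
- move=> p q hp hq; apply: (ltn_trans nY2).
  by apply: ltn_mul; apply: primes_in_gt; eassumption.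
rewrite sum_scale //.
have s2 := S2_le a1 (leq_trans aX Xn); have s1 := S1_le a1 aX XE Xn.
have n0 : (X%:R : R) <= n%:R by rewrite ler_nat.
rewrite XE in n0 s1.
have {}s1 : n.+1%:R^-1 * \sum_(p <- primes_in Y n) p%:R^-1 <= 29 / 8 * (micro R).
  rewrite mulrC ler_pdivrMr ?ltr0n // -(natr1 n) /micro.
  move: (n%:R : R) (\sum_(_ <- _) _) s1 n0 => N s s1 n0.
  lra.
rewrite -[194 / 100 / _ * _]mulrA.
move: (\sum_(p <- _) p%:R ^- 2) s2 (n.+1%:R^-1 * _) s1 => u hu v hv.
rewrite expr2 /micro in hu hv *; lra.
Qed.

Lemma prod2_le (m e : R) n : (Y <= n)%N -> 0 <= m -> 0 < e -> e <= 1 - m * (557 / 10 * (micro R)) ->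
  prod2 m (primes_in Y n) <= e^-1.
Proof.
move=> Yn m0 e0 he; apply: le_trans (prod_le_expR _ _) _.
  by move=> p; rewrite divr_ge0 ?exprn_ge0.
rewrite -mulr_sumr; apply: expR_le_inv => //; apply: le_trans he _.
by rewrite lerB // ler_wpM2l // S2_le.
Qed.

Lemma prod3_le (m : R) n : (Y <= n)%N -> 0 <= m ->
  prod3 m (primes_in Y n) <= expR (m * ((43 * 100 + 7) / (100 * 10) / (5 * 100))).
Proof.
move=> Yn m0; apply: le_trans (prod_le_expR _ _) _.
  by move=> p; rewrite divr_ge0 ?mulr_ge0 ?sqrtr_ge0.
by rewrite -mulr_sumr ler_expR ler_wpM2l // S3_le.
Qed.

Lemma prod3_127 n : (Y <= n)%N -> prod3 127 (primes_in Y n) <= (3 * 100 + 5) / 100 :> R.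
Proof.
move=> Yn; apply: le_trans (prod3_le Yn _) _; first by lra.
by apply: le_trans (expR_rankin R); rewrite ler_expR; lra.
Qed.

Lemma off_weight (m s c2 c3 : R) n : (Y <= n)%N -> 0 <= m ->
  prod2 m (primes_in Y n) <= c2 -> prod3 m (primes_in Y n) <= c3 ->
  0 < s -> s <= Num.sqrt n.+1%:R ->
  weight fdiv (off_bound n) m (primes_in Y n) n <=
    (micro R) + 13 / 400 * (c2 - 1) + 1372 / 1000 / s * (c3 - 1).
Proof.
move=> Yn m0 h2 h3 s0 hs; have mi := micro_gt0.
have n0 : (0 < n)%N by have := a_gt1 a1; lia.
apply: le_trans (@weight_rankin1 R m (off_bound n) (13 / 400) (1372 / 1000) (micro R) _ n m0 _ _ _ _ _ _ n0) _.
- lra.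
- lra.
- move=> z z0 zn; rewrite /off_bound (negPf zn) lerD2l.
  have t0 : 0 < Num.sqrt z.+1%:R :> R by rewrite sqrtr_gt0.
  (* z >= 1 gives sqrt(z + 1) >= 1.4142, and 1.94/1.4142 < 1.372. *)
  have t2 : (141 * 100 + 42) / (100 * 100) <= Num.sqrt z.+1%:R :> R.
    set c := _ / _; have c0 : 0 <= c by rewrite /c; lra.
    rewrite -[c]ger0_norm // -sqrtr_sqr ler_wsqrtr // (@le_trans _ _ 2%:R) //.
      by rewrite expr2 /c; lra.
    by rewrite ler_nat.
  have e := sqr_sqrtr (ler0n R z.+1).
  rewrite -[X in X <= _]/(_ / z.+1%:R) -[X in _ / X <= _]e; move: (Num.sqrt _) t0 t2 => t t0 t2.
  rewrite ler_pdivrMr ?exprn_gt0 // expr2 mulrA divfK ?gt_eqF //; lra.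
- by rewrite /off_bound eqxx.
- by rewrite /micro; lra.
- exact: primes_in_ge2.
have p2 : 1 <= prod2 m (primes_in Y n).
  by apply: prod_ge1 => p; rewrite divr_ge0 ?exprn_ge0.
have p3 : 1 <= prod3 m (primes_in Y n).
  by apply: prod_ge1 => p; rewrite divr_ge0 ?mulr_ge0 ?sqrtr_ge0.
have k0 : 0 <= 1372 / 1000 :> R by lra.
apply: lerD.
  by rewrite lerD2l; apply: ler_wpM2l; [lra | rewrite lerD2r].
apply: ler_pM.
- by apply: divr_ge0; [exact: k0 | exact: sqrtr_ge0].
- by rewrite subr_ge0.
- apply: ler_wpM2l; first exact: k0.
  by rewrite lef_pV2 // posrE ?(lt_le_trans s0).
- by rewrite lerD2r.
Qed.

Definition off_event n (t : R) : (nat -> R) -> bool :=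
  fun s => t <= `|chaos fdiv (off n) (primes_in Y n) s n|.

(** Here and in the next three range estimates r^k must fit below 2^-(131 + 2 N) when n + 2 <= 2^N.
    The pairs (k, r) are (128, 0.36), (64, 1/9), (64, 1/16), (320, 1/4) for N = 26, 33, 61, 225. *)
Lemma avg_low n : (X <= n)%N -> (n < Y * Y)%N ->
  avg (primes_in Y n) (fun s => (off_event n (8 / 100) s)%:R) <= quota n.
Proof.
move=> Xn nY; apply: le_trans (@off_tail 128 n (8 / 100) (9 / 25) _ _) _.
- lra.
- exact: weight_low.
apply: (@le_trans _ _ (2 ^- 184)); last first.
  apply: (@le_quota n 26) => //.
  apply: le_trans (_ : (Y * Y)%:R + 1 <= _); first by rewrite natr1 ler_nat.
  rewrite natrM (aE a1) (_ : 26%N = 13 * 2)%N // exprM.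
  rewrite (_ : 2 ^+ 13 = 81 * 100 + 92 :> R); last by rewrite -natrX; lra.
  rewrite expr2; lra.
exact: pow_low.
Qed.

(** 0.000233 covers 13/400 times the excess of [prod2] over 1, and 2.82 covers 1.372 times (3.05 -
    1). *)
Lemma weight127 n (s W : R) : (Y <= n)%N -> 0 < s -> s <= Num.sqrt n.+1%:R ->
  1 / (100 * 100 * 100) + 233 / (100 * 100 * 100) + 282 / 100 / s <= W ->
  weight fdiv (off_bound n) 127 (primes_in Y n) n <= W.
Proof.
move=> Yn s0 hs hW.
have p2 : prod2 127 (primes_in Y n) <= ((99 * 100 + 29) / (100 * 100))^-1 :> R.
  by apply: prod2_le => //; rewrite /micro; lra.
have m127 : 0 <= 127 :> R by lra.
apply: le_trans (off_weight Yn m127 p2 (prod3_127 Yn) s0 hs) (le_trans _ hW).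
have q : (100 * 100) / (99 * 100 + 29) <= 1 + 716 / (10 * 100 * 100) :> R.
  by rewrite ler_pdivrMr; lra.
rewrite invf_div; apply: lerD; first by rewrite /micro; move: (_ / _) q => z q; lra.
rewrite mulrAC ler_wpM2r ?invr_ge0 ?(ltW s0) //; lra.
Qed.

Lemma avg_mid1 n : (Y * Y <= n)%N -> n%:R < (2 : R) ^+ 32 ->
  avg (primes_in Y n) (fun s => (off_event n (8 / 100) s)%:R) <= quota n.
Proof.
move=> Yn n32; have Yn' : (Y <= n)%N by apply: leq_trans Yn; have := a_gt1 a1; nia.
apply: le_trans (@off_tail 64 n (8 / 100) (1 / 9) _ _) _; first by lra.
  apply: (@weight127 n (60 * 100)); [exact: Yn' | lra | | ].
    have c0 : 0 <= 60 * 100 :> R by lra.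
    rewrite -(ger0_norm c0) -sqrtr_sqr; apply: ler_wsqrtr.
    by rewrite expr2 -(aE a1) -natrM ler_nat; apply: leqW.
  rewrite expr2; lra.
apply: (@le_trans _ _ (2 ^- 200)); last first.
  by apply: (@le_quota n 33) => //; apply: natr_lt2.
exact: pow_mid.
Qed.

Lemma Y_le_pow2 n (N : nat) : (32 <= N)%N -> (2 : R) ^+ N <= n%:R -> (Y <= n)%N.
Proof.
move=> hN h; rewrite -(ler_nat R); apply: le_trans h; rewrite (aE a1).
apply: le_trans (_ : 2 ^+ 13 <= _); first by rewrite !exprS expr0; lra.
by rewrite ler_weXn2l ?ler1n //; apply: leq_trans hN.
Qed.

Lemma avg_mid2 n : (2 : R) ^+ 32 <= n%:R -> n%:R < (2 : R) ^+ 60 ->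
  avg (primes_in Y n) (fun s => (off_event n (8 / 100) s)%:R) <= quota n.
Proof.
move=> n32 n60; have Yn := Y_le_pow2 (leqnn 32) n32.
apply: le_trans (@off_tail 64 n (8 / 100) (2 ^- 4) _ _) _; first by lra.
  apply: (@weight127 n (2 ^+ 16)); [exact: Yn | by rewrite exprn_gt0 | | ].
    exact: (@sqrt_pow2_le n 16).
  rewrite (_ : 2 ^+ 16 = 256 * 256); last by rewrite !exprS expr0; lra.
  by rewrite !exprS expr0; lra.
by rewrite pow2_inv; apply: (@le_quota n 61) => //; apply: natr_lt2.
Qed.

(** The threshold 0.07 leaves a margin 0.01 from which the increments later start. The weight is now
    dominated by its constant part, so the smallness has to come from a larger k. *)
Lemma avg_mid3 n : (2 : R) ^+ 60 <= n%:R -> n%:R < (2 : R) ^+ 224 ->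
  avg (primes_in Y n) (fun s => (off_event n (7 / 100) s)%:R) <= quota n.
Proof.
move=> n32 n60; have Yn := Y_le_pow2 (isT : (32 <= 60)%N) n32.
apply: le_trans (@off_tail 320 n (7 / 100) (2 ^- 2) _ _) _; first by lra.
  rewrite (_ : 320.*2.-1%:R = 600 + 39); last by rewrite -natrD.
  have m0 : 0 <= 600 + 39 :> R by lra.
  have p2 : prod2 (600 + 39) (primes_in Y n) <= ((96 * 100 + 44) / (100 * 100))^-1 :> R.
    by apply: prod2_le => //; rewrite /micro; lra.
  have p3 : prod3 (600 + 39) (primes_in Y n) <= 3 ^+ 6 :> R.
    apply: le_trans (prod3_le Yn m0) _; apply: (@le_trans _ _ (expR 1 ^+ 6)).
      by rewrite -expRM_natl ler_expR; lra.
    by rewrite lerXn2r ?nnegrE ?expR_ge0 ?expR1_le3.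
  have s0 : 0 < 100 * 100 * (100 * 100) :> R by lra.
  have hs : 100 * 100 * (100 * 100) <= Num.sqrt n.+1%:R :> R.
    apply: le_trans (@sqrt_pow2_le n 30 n32).
    by rewrite (exprD _ 15 15) ler_pM //; rewrite ?exprS ?expr0; lra.
  apply: le_trans (off_weight Yn m0 p2 p3 s0 hs) _.
  have q : (100 * 100) / (96 * 100 + 44) <= 1 + (36 * 100 + 92) / (10 * 100 * 100) :> R.
    by rewrite ler_pdivrMr; lra.
  rewrite invf_div /micro; move: (_ / (96 * 100 + 44)) q => z q.
  by rewrite !exprS expr0; lra.
by rewrite pow2_inv; apply: (@le_quota n 225) => //; apply: natr_lt2.
Qed.

End Regimes.

(** * Increments *)

Section Increments.
Variable R : realType.
Implicit Types (x : R) (n p y : nat).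

Definition root4 x : R := Num.sqrt (Num.sqrt x).

Lemma root4_gt0 x : 0 < x -> 0 < root4 x. Proof. by move=> x0; rewrite !sqrtr_gt0. Qed.

Lemma root4M x (y : R) : 0 <= x -> root4 (x * y) = root4 x * root4 y.
Proof. by move=> x0; rewrite /root4 sqrtrM // sqrtrM ?sqrtr_ge0. Qed.

Lemma root4K x : 0 <= x -> root4 x ^+ 4 = x.
Proof. by move=> x0; rewrite (exprM _ 2 2) !sqr_sqrtr ?sqrtr_ge0. Qed.

Lemma le_root4 x (y : R) : x <= y -> root4 x <= root4 y.
Proof. by move=> xy; rewrite !ler_wsqrtr. Qed.

Lemma root4_ge (c x : R) : 0 <= c -> 0 <= x -> c ^+ 4 <= x -> c <= root4 x.
Proof.
move=> c0 x0 h; rewrite -(ler_pXn2r (isT : (0 < 4)%N)) ?nnegrE ?sqrtr_ge0 //.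
by rewrite root4K.
Qed.

Lemma root4_le (c x : R) : 0 <= c -> 0 <= x -> x <= c ^+ 4 -> root4 x <= c.
Proof.
move=> c0 x0 h; rewrite -(ler_pXn2r (isT : (0 < 4)%N)) ?nnegrE ?sqrtr_ge0 //.
by rewrite root4K.
Qed.

Lemma cube_root4_le_inv (c t : R) : 0 < c -> c <= t -> (t ^+ 3)^-1 <= (c ^+ 3)^-1.
Proof.
move=> c0 ct; have t0 := lt_le_trans c0 ct.
by rewrite lef_pV2 ?posrE ?exprn_gt0 // lerXn2r // nnegrE ltW.
Qed.

(** This is p^(-3/4): p^(-1) from the recursion times the p^(1/4) lost when (n/p + 1)^(-1/4) is
    compared with (n + 1)^(-1/4). *)
Definition cube_root4 p : R := (root4 p%:R ^+ 3)^-1.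

Lemma cube_root4E p : (0 < p)%N -> cube_root4 p = p%:R^-1 * root4 p%:R.
Proof.
move=> p0; have p0' : 0 < p%:R :> R by rewrite ltr0n.
have h := root4_gt0 p0'; rewrite -[in p%:R^-1](root4K (ltW p0')) /cube_root4.
by move: (root4 _) h => t h; field; rewrite gt_eqF.
Qed.

Lemma le_cube_root4 p q : (0 < p <= q)%N -> cube_root4 q <= cube_root4 p.
Proof.
move=> /andP[p0 pq]; have q0 := leq_trans p0 pq.
rewrite lef_pV2 ?posrE ?exprn_gt0 ?root4_gt0 ?ltr0n //.
rewrite ler_pXn2r ?nnegrE ?sqrtr_ge0 //.
by rewrite le_root4 // ler_nat.
Qed.

Lemma cube_root4_le p : (1 < p)%N -> cube_root4 p <= 3 / 5.
Proof.
move=> p1; apply: (le_trans (@le_cube_root4 2 p p1)).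
have c0 : 0 < (119 / 100 - 1 / 400) :> R by lra.
apply: le_trans (cube_root4_le_inv c0 (root4_ge (ltW c0) (ler0n _ _) _)) _.
  by rewrite !exprS expr0; lra.
rewrite -[leLHS]mul1r ler_pdivrMr; last exact: exprn_gt0.
by rewrite !exprS expr0; lra.
Qed.

Lemma cube_root4_le7 p : (6 < p)%N -> cube_root4 p <= 1 / 4.
Proof.
move=> p1; apply: (le_trans (@le_cube_root4 7 p p1)).
have c0 : 0 < (162 / 100) :> R by lra.
apply: le_trans (cube_root4_le_inv c0 (root4_ge (ltW c0) (ler0n _ _) _)) _.
  by rewrite !exprS expr0; lra.
rewrite -[leLHS]mul1r ler_pdivrMr; last exact: exprn_gt0.
by rewrite !exprS expr0; lra.
Qed.

(* Kprod is the Euler product forced by the recursion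
   A_p n = A_q n - A_p (n / p) / p (q the preceding prime) when increments are
   measured against (n + 1)^(-1/4). *)
Definition Kprod y : R := \prod_(0 <= p < y.+1 | prime p) (1 - cube_root4 p)^-1.

Lemma Kfactor_gt0 p : (1 < p)%N -> 0 < 1 - cube_root4 p.
Proof. by move=> /cube_root4_le; lra. Qed.

Lemma KprodS y : Kprod y.+1 = Kprod y * (if prime y.+1 then (1 - cube_root4 y.+1)^-1 else 1).
Proof.
rewrite /Kprod big_mkcond big_nat_recr // -big_mkcond //=.
Qed.

Lemma Kprod_gt0 y : 0 < Kprod y.
Proof.
apply: prodr_gt0 => p /prime_gt1 p1; rewrite invr_gt0; exact: Kfactor_gt0.
Qed.

Lemma root4_div_succ p n : (0 < p)%N ->
  (root4 (n %/ p).+1%:R)^-1 <= root4 p%:R / root4 n.+1%:R.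
Proof.
move=> p0; have p0' : 0 < p%:R :> R by rewrite ltr0n.
rewrite ler_pdivlMr ?root4_gt0 ?ltr0n //.
rewrite mulrC ler_pdivrMr ?root4_gt0 ?ltr0n // -root4M ?ler0n //.
by rewrite le_root4 // div_succ_ge.
Qed.

(** Induction on y and, when p = y + 1 is prime, on n: the old bound K_y and the recursive part
    p^(-3/4) K_p add up to exactly the new constant K_p. *)
Lemma lam_upto_increment y n n' : (n' <= n)%N ->
  `|log_sum (lam_upto R y) n - log_sum (lam_upto R y) n'| <= Kprod y / root4 n'.+1%:R.
Proof.
elim: y n n' => [|y IHy].
  have none q : prime q -> lam_upto R 0 q = Zero.
    by move=> /prime_gt0; rewrite /lam_upto; case: q.
  have K0 : Kprod 0 = 1 by rewrite /Kprod big_mkcond big_nat1.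
  move=> n [|n'] h.
    rewrite log_sum0 subr0 K0 /root4 !sqrtr1 divr1.
    case: n h => [|n] h; first by rewrite log_sum0 normr0.
    by rewrite log_sum_none ?normr1 // => q /none.
  rewrite !log_sum_none ?subrr ?normr0 //; try by move=> q /none.
    by rewrite divr_ge0 ?ltW ?Kprod_gt0 ?root4_gt0 ?ltr0n.
  exact: leq_trans h.
have [yp|ynp] := boolP (prime y.+1); last first.
  move=> n n' h; rewrite !lam_uptoS_nprime // KprodS (negPf ynp) mulr1; exact: IHy.
move=> n n'; elim/ltn_ind: n n' => n IHn n' h.
have [n0|n0] := posnP n.
  have -> : n' = 0%N by lia.
  by rewrite n0 subrr normr0 divr_ge0 ?ltW ?Kprod_gt0 ?root4_gt0 ?ltr0n.
rewrite (lam_uptoS_prime R n yp) (lam_uptoS_prime R n' yp).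
have lt : (n %/ y.+1 < n)%N by rewrite ltn_Pdiv ?prime_gt1.
have := IHn _ lt (n' %/ y.+1)%N (leq_div2r _ h); have {IHy} := IHy n n' h.
set a := log_sum _ n; set b := log_sum _ n'; set c := log_sum _ (n %/ _); set d := log_sum _ (n' %/ _).
move=> h1 h2.
have -> : a - y.+1%:R^-1 * c - (b - y.+1%:R^-1 * d) = (a - b) - y.+1%:R^-1 * (c - d) by ring.
apply: le_trans (ler_normB _ _) _; rewrite normrM ger0_norm ?invr_ge0 //.
have q0 : 0 < (root4 n'.+1%:R)^-1 by rewrite invr_gt0 root4_gt0 ?ltr0n.
have Kf := Kfactor_gt0 (prime_gt1 yp); have K0 := Kprod_gt0 y.
have K1 := Kprod_gt0 y.+1.
have KE : Kprod y = Kprod y.+1 * (1 - cube_root4 y.+1).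
  by rewrite KprodS yp divfK // gt_eqF.
have h3 : y.+1%:R^-1 * `|c - d| <= Kprod y.+1 * cube_root4 y.+1 / root4 n'.+1%:R.
  rewrite cube_root4E //; apply: (@le_trans _ _ (y.+1%:R^-1 * (Kprod y.+1 * (root4 y.+1%:R / root4 n'.+1%:R)))).
    rewrite ler_wpM2l ?invr_ge0 // (le_trans h2) // ler_wpM2l ?(ltW K1) //.
    exact: root4_div_succ.
  by rewrite le_eqVlt; apply/orP; left; apply/eqP; ring.
rewrite KE in h1; apply: le_trans (lerD h1 h3) _.
by rewrite -mulrDl -mulrDr subrK mulr1.
Qed.

Lemma Kfactor_le_expR p : (6 < p)%N -> (1 - cube_root4 p)^-1 <= expR (4 / 3 * cube_root4 p).
Proof.
move=> p6; have u := cube_root4_le7 p6; have u0 : 0 <= cube_root4 p.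
  by rewrite invr_ge0 exprn_ge0 // sqrtr_ge0.
move: (cube_root4 p) u u0 => c u u0.
apply: le_trans (_ : 1 + 4 / 3 * c <= _); last exact: expR_ge1Dx.
rewrite -[leLHS]mul1r ler_pdivrMr; last by lra.
have := mulr_ge0 u0 (_ : 0 <= 1 / 4 - c); rewrite subr_ge0 => /(_ u); lra.
Qed.

(** A primitive of 2 (6 x)^(-3/4) is 8 times 6^(-3/4) x^(1/4). *)
Lemma sum_cube_root4 a : (0 < a)%N ->
  \sum_(1 <= j < a.+1) 2 * cube_root4 (6 * j) <= 8 / root4 6 ^+ 3 * root4 a%:R.
Proof.
move=> a0; pose g j := 8 / root4 6 ^+ 3 * root4 j.-1%:R.
have s0 : 0 < root4 6 by apply: root4_gt0.
apply: le_trans (sum_telescope_le (g := g) _ _) _; first by [].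
  move=> [//|j] _; rewrite /g [_.+2.-1]/= [_.+1.-1]/= -mulrBr /cube_root4 natrM root4M //.
  have t0 : 0 < root4 j.+1%:R by rewrite root4_gt0 ?ltr0n.
  have u0 : 0 <= root4 j%:R by rewrite sqrtr_ge0.
  have e : root4 j.+1%:R ^+ 4 - root4 j%:R ^+ 4 = 1.
    by rewrite !root4K // -natr1 addrC addKr.
  have tu : root4 j%:R <= root4 j.+1%:R by rewrite le_root4 // ler_nat.
  move: (root4 6) (root4 j.+1%:R) (root4 j%:R) s0 t0 u0 e tu => s t u s0 t0 u0 e tu.
  have h : 1 <= (t - u) * (4 * t ^+ 3).
    rewrite -[leLHS]e (_ : t ^+ 4 - u ^+ 4 = (t - u) * (t ^+ 3 + t ^+ 2 * u + t * u ^+ 2 + u ^+ 3)); last by ring.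
    rewrite ler_wpM2l ?subr_ge0 //.
    have h1 : t ^+ 2 * u <= t ^+ 3 by rewrite [t ^+ 3]exprSr ler_wpM2l ?exprn_ge0 ?(ltW t0).
    have h2 : t * u ^+ 2 <= t ^+ 3 by rewrite [t ^+ 3]exprS ler_wpM2l ?(ltW t0) // lerXn2r ?nnegrE ?(ltW t0).
    have h3 : u ^+ 3 <= t ^+ 3 by rewrite lerXn2r ?nnegrE ?(ltW t0).
    lra.
  have st : 0 < (s * t) ^+ 3 by rewrite exprn_gt0 // mulr_gt0.
  rewrite ler_pdivrMr // (_ : _ * _ * _ = 2 * ((t - u) * (4 * t ^+ 3))); last first.
    by field; rewrite gt_eqF.
  lra.
rewrite /g [_.-1]/= gerBl /= mulr_ge0 ?divr_ge0 ?exprn_ge0 ?sqrtr_ge0 //.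
Qed.

Lemma Kprod_split a : (0 < a)%N -> Kprod (6 * a) <=
  (\prod_(0 <= p < 6 | prime p) (1 - cube_root4 p)^-1) *
  expR (4 / 3 * (8 / root4 6 ^+ 3 * root4 a%:R)).
Proof.
move=> a0; rewrite /Kprod (big_cat_nat (n := 6%N)) //=; last by lia.
rewrite ler_wpM2l //.
  by rewrite ltW // prodr_gt0 // => p /prime_gt1 p1; rewrite invr_gt0 Kfactor_gt0.
have e : \prod_(6 <= p < (6 * a).+1 | prime p) (1 - cube_root4 p)^-1 <=
         expR (4 / 3 * \sum_(6 <= p < (6 * a).+1 | prime p) cube_root4 p).
  rewrite mulr_sumr expR_sum big_nat_cond [leRHS]big_nat_cond.
  apply: ler_prod => p /andP[/andP[p6 _] pp].
  have p7 : (6 < p)%N by rewrite ltn_neqAle p6 andbT; apply: contraTneq pp => <-.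
  by rewrite Kfactor_le_expR // invr_ge0 ltW // Kfactor_gt0 // prime_gt1.
apply: le_trans e _; rewrite ler_expR ler_wpM2l ?divr_ge0 //.
apply: le_trans (sum_cube_root4 a0).
have c0 p : 0 <= cube_root4 p by rewrite invr_ge0 exprn_ge0 // sqrtr_ge0.
apply: le_trans (sum_primes_mod6 (a := 1) isT _ c0 le_cube_root4); last by lia.
rewrite muln1 [leRHS](big_cat_nat (n := (6 * a).+1)) /=; [|lia|lia].
by rewrite lerDl sumr_ge0.
Qed.

(** 2^35 splits as 2^8 for the primes below 6, with factors at most 5/2, and 2^27 >= 3^17 for the
    rest, whose exponential has exponent below 17. *)
Lemma Kprod_le a : (0 < a)%N -> a%:R <= 10 * 100 :> R -> Kprod (6 * a) <= 2 ^+ 35.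
Proof.
move=> a0 ha; apply: (le_trans (Kprod_split a0)).
have hp : \prod_(0 <= p < 6 | prime p) (1 - cube_root4 p)^-1 <= 2 ^+ 8.
  rewrite big_mkcond /=; apply: le_trans (_ : \prod_(0 <= p < 6) (5 / 2) <= _).
    apply: ler_prod => p _; case: ifP => [/prime_gt1 p1|_]; last by lra.
    have := Kfactor_gt0 p1; have := cube_root4_le p1 => h1 h2.
    rewrite invr_ge0 (ltW h2) /= -[leLHS]mul1r ler_pdivrMr //; lra.
  by rewrite prodr_const_nat !exprS expr0; lra.
have t6 : 156 / 100 <= root4 6.
  by apply: root4_ge; [lra | lra | rewrite !exprS expr0; lra].
have ta : root4 a%:R <= 564 / 100.
  by apply: root4_le; [lra | exact: ler0n | rewrite !exprS expr0; lra].
have t3 : 37 / 10 <= root4 6 ^+ 3.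
  apply: (@le_trans _ _ ((156 / 100) ^+ 3)); first by rewrite !exprS expr0; lra.
  by apply: lerXn2r t6; rewrite ?nnegrE ?sqrtr_ge0; lra.
have hE : expR (4 / 3 * (8 / root4 6 ^+ 3 * root4 a%:R)) <= 3 ^+ 17.
  apply: (@le_trans _ _ (expR 1 ^+ 17)); last first.
    by rewrite lerXn2r ?nnegrE ?expR_ge0 ?expR1_le3.
  rewrite -expRM_natl ler_expR.
  have : 8 / root4 6 ^+ 3 <= 8 / (37 / 10).
    by rewrite ler_wpM2l // lef_pV2 ?posrE //; lra.
  have : 0 <= 8 / root4 6 ^+ 3 by rewrite divr_ge0 ?exprn_ge0 ?sqrtr_ge0.
  have : 0 <= root4 a%:R by rewrite sqrtr_ge0.
  move: (8 / _) (root4 a%:R) ta => x y ta y0 x0 hx.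
  have : x * y <= 8 / (37 / 10) * (564 / 100) by rewrite ler_pM.
  lra.
rewrite (_ : 35 = 8 + 27)%N // exprD ler_pM ?expR_ge0 //.
  by apply: prodr_ge0 => p /prime_gt1 p1; rewrite invr_ge0 ltW // Kfactor_gt0.
apply: le_trans hE _.
pose x : R := 3 ^+ 2 / 2 ^+ 3.
have x0 : 0 <= x by rewrite divr_ge0 ?exprn_ge0.
have h1 : x ^+ 1 <= 9 / 8 by rewrite expr1 /x !exprS expr0; lra.
have h2 : x ^+ 2 <= 127 / 100 by apply: (sqrn_le x0 h1); lra.
have h4 : x ^+ 4 <= 162 / 100 by apply: (sqrn_le x0 h2); lra.
have h8 : x ^+ 8 <= 8 / 3 by apply: (sqrn_le x0 h4); lra.
have -> : 3 ^+ 17 = x ^+ 8 * 3 * 2 ^+ 24 :> R.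
  have -> : x ^+ 8 = 3 ^+ 16 / 2 ^+ 24 by rewrite expr_div_n -[(3 ^+ 2) ^+ 8]exprM -[(2 ^+ 3) ^+ 8]exprM.
  by rewrite mulrAC divfK; [rewrite [LHS]exprSr | rewrite gt_eqF ?exprn_gt0].
rewrite (_ : 27 = 3 + 24)%N // exprD ler_wpM2r ?exprn_ge0 // !exprS expr0; lra.
Qed.

Section Chain.
Variable a : nat.
Hypothesis a1 : a.-1%:R = 27 * 37 :> R.
Local Notation Y := (6 * a)%N.
Local Notation A := (log_sum (lam_upto R Y)).

Lemma Kprod_Y : Kprod Y <= 2 ^+ 35.
Proof.
have a2 := a_gt1 a1; apply: Kprod_le; first exact: ltnW.
have -> : a%:R = a.-1%:R + 1 :> R by rewrite natr1 prednK // ltnW.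
by rewrite a1; lra.
Qed.

Definition incr (z : nat) : R := A z - A (z %/ 256)%N.
Definition incr_bound (z : nat) : R := 2 ^+ 74 / Num.sqrt z.+1%:R.

Lemma incr_bound_gt0 z : 0 < incr_bound z.
Proof. by rewrite divr_gt0 ?exprn_gt0 ?sqrtr_gt0 ?ltr0n. Qed.

(** 2^74 is (2^35)^2 times sqrt 256: the increment is controlled at z / 256, and moving to z costs
    256^(1/4), squared here. *)
Lemma incr_le z : incr z ^+ 2 <= incr_bound z.
Proof.
have h := lam_upto_increment Y (leq_div z 256).
have K0 := Kprod_gt0 Y; have K1 := Kprod_Y.
rewrite -real_normK ?num_real //; apply: (@le_trans _ _ ((Kprod Y / root4 (z %/ 256).+1%:R) ^+ 2)).
  by rewrite lerXn2r ?nnegrE // divr_ge0 ?ltW // root4_gt0 ?ltr0n.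
rewrite expr_div_n sqr_sqrtr ?sqrtr_ge0 //.
apply: (@le_trans _ _ ((2 ^+ 35) ^+ 2 * (Num.sqrt 256%:R / Num.sqrt z.+1%:R))).
  rewrite ler_pM ?exprn_ge0 ?invr_ge0 ?sqrtr_ge0 ?(ltW K0) //; last exact: sqrt_div_succ.
  by rewrite lerXn2r ?nnegrE ?(ltW K0) ?exprn_ge0.
have -> : 256%:R = (2 ^+ 4) ^+ 2 :> R by rewrite -exprM -natrX.
rewrite sqrtr_sqr ger0_norm ?exprn_ge0 // mulrA -exprM -exprD.
by [].
Qed.

Definition incr_event n (t : R) : (nat -> R) -> bool :=
  fun s => t <= `|chaos fdiv incr (primes_in Y n) s n|.

(** Second moment over squared threshold at level e. With [prod3] <= 2^2 and 100^2 <= 2^14 the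
    exponent is 74 - 4 (27 + e) + 2 + 14 + 2 e = -18 - 2 e. *)
Lemma chain_ratio (e : nat) :
  2 ^+ 74 / 2 ^+ (4 * (27 + e)) * 2 ^+ 2 / (1 / 100 / 2 ^+ e) ^+ 2 <= 2 ^- (18 + 2 * e) :> R.
Proof.
have E0 : 0 < (2 : R) ^+ e by rewrite exprn_gt0.
have d0 : 0 < (2 : R) ^+ 14 by rewrite exprn_gt0.
have c0 : 0 < (2 : R) ^+ 18 by rewrite exprn_gt0.
have P0 : 0 < (2 : R) ^+ 74 by rewrite exprn_gt0.
have hd : 100 * 100 <= (2 : R) ^+ 14 by rewrite !exprS expr0; lra.
rewrite ler_pdivrMr ?exprn_gt0 ?divr_gt0 //.
have -> : (2 : R) ^+ (4 * (27 + e)) = 2 ^+ 74 * 2 ^+ 2 * (2 ^+ 18 * 2 ^+ 14) * (2 ^+ e) ^+ 4.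
  have -> : (4 * (27 + e) = 74 + 2 + (18 + 14) + e * 4)%N by clear; lia.
  by rewrite !exprD exprM.
have -> : (2 : R) ^+ (18 + 2 * e) = 2 ^+ 18 * (2 ^+ e) ^+ 2.
  by rewrite exprD mulnC exprM.
move: (2 ^+ e : R) (2 ^+ 14 : R) (2 ^+ 18 : R) (2 ^+ 74 : R) E0 d0 c0 P0 hd.
move=> E d c P E0 d0 c0 P0 hd.
have -> : P / (P * 2 ^+ 2 * (c * d) * E ^+ 4) * 2 ^+ 2 = (c * E ^+ 4)^-1 * d^-1.
  by field; rewrite !gt_eqF.
have -> : (c * E ^+ 2)^-1 * (1 / 100 / E) ^+ 2 = (c * E ^+ 4)^-1 * (100 * 100)^-1.
  by field; rewrite !gt_eqF.
rewrite ler_wpM2l ?invr_ge0 ?mulr_ge0 ?exprn_ge0 ?(ltW c0) ?(ltW E0) //.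
by rewrite lef_pV2 ?posrE //; lra.
Qed.

(** Without a constant part only the product [prod3] survives, and k = 64 serves every level: 64 (18
    + 2 e) exceeds the 131 + 16 (28 + e) + 2 bits that the quota requires. *)
Lemma avg_chain n (e : nat) : (0 < e)%N ->
  (2 : R) ^+ (8 * (27 + e)) <= n%:R -> n%:R < (2 : R) ^+ (8 * (28 + e)) ->
  avg (primes_in Y n) (fun s => (incr_event n (1 / 100 / 2 ^+ e) s)%:R) <= quota R n.
Proof.
move=> e0 h1 h2; have Yn : (Y <= n)%N by apply: (Y_le_pow2 a1 _ h1); lia.
have u : uniq (primes_in Y n) by rewrite filter_uniq // iota_uniq.
set t := 1 / 100 / 2 ^+ e; have t0 : 0 < t by rewrite divr_gt0 ?exprn_gt0 ?divr_gt0.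
apply: le_trans (chaos_tail fdiv incr_bound_gt0 incr_le 64 n u t0) _.
have -> : 64.*2.-1%:R = 127 :> R by [].
have n0 : (0 < n)%N by apply: leq_trans Yn; have := a_gt1 a1; lia.
have w0 : 0 < weight fdiv incr_bound 127 (primes_in Y n) n.
  by apply: (weight_gt0 fdiv incr_bound_gt0).
have ps1 : all (leq 1) (primes_in Y n).
  by apply: sub_all (primes_in_ge2 a n) => q; apply: ltnW.
have hw : weight fdiv incr_bound 127 (primes_in Y n) n <= 2 ^+ 74 / 2 ^+ (4 * (27 + e)) * 2 ^+ 2.
  have hb z : (0 < z)%N -> incr_bound z <= 0 + 2 ^+ 74 / Num.sqrt z.+1%:R by rewrite add0r.
  have m0 : 0 <= 127 :> R by [].
  apply: le_trans (weight_rankin m0 (lexx 0) (exprn_ge0 74 (ler0n R 2)) hb ps1 n0) _.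
  rewrite mul0r add0r ler_pM ?prod3_ge0 ?divr_ge0 ?exprn_ge0 ?sqrtr_ge0 //.
    rewrite ler_wpM2l ?exprn_ge0 // lef_pV2 ?posrE ?exprn_gt0 ?sqrtr_gt0 ?ltr0n //.
    by apply: sqrt_pow2_le; rewrite -muln2 mulnAC.
  by apply: le_trans (prod3_127 a1 Yn) _; rewrite expr2; lra.
have hr : weight fdiv incr_bound 127 (primes_in Y n) n / t ^+ 2 <= 2 ^- (18 + 2 * e).
  by apply: le_trans (chain_ratio e); rewrite ler_wpM2r // invr_ge0 exprn_ge0 // ltW.
apply: (@le_trans _ _ ((2 ^- (18 + 2 * e)) ^+ 64)).
  by rewrite lerXn2r ?nnegrE ?invr_ge0 ?exprn_ge0 // divr_ge0 ?(ltW w0) ?exprn_ge0 ?(ltW t0).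
rewrite pow2_inv; apply: (@le_quota R n (8 * (28 + e)).+1).
  exact: natr_lt2.
by lia.
Qed.
End Chain.

End Increments.

(** * The deterministic part of the argument *)

Section ChaosLogSum.
Variable R : realType.
Implicit Types (tau : nat -> local_type R) (s : nat -> R) (ps : seq nat) (n p : nat).

Definition add_sqf tau ps s : nat -> local_type R :=
  fun q => if q \in ps then Sqf (s q) else tau q.

(** The divisor c will be 1 or 256, so that T(n) and T(n/256) become polynomials over the same
    primes; this rests on (n/p)/c = (n/c)/p for floors. *)
Lemma chaos_log_sum tau ps s c n : uniq ps -> (0 < c)%N ->
  (forall p, p \in ps -> prime p /\ tau p = Zero) ->
  chaos fdiv (fun z => log_sum tau (z %/ c)) ps s n = log_sum (add_sqf tau ps s) (n %/ c).
Proof.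
move=> + c0; elim: ps n => [|p ps IH] n /=; first by [].
move=> /andP[pps ups] hps.
have [pp tp] := hps p (mem_head _ _).
have {}IH m : chaos fdiv (fun z => log_sum tau (z %/ c)) ps s m = log_sum (add_sqf tau ps s) (m %/ c).
  by apply: IH => // q hq; apply: hps; rewrite inE hq orbT.
transitivity (log_sum (upd (add_sqf tau ps s) p (Sqf (s p))) (n %/ c)); last first.
  by apply: eq_log_sum => q _ _; rewrite /upd /add_sqf inE; case: eqP => // ->.
have e m : log_sum (upd (add_sqf tau ps s) p Zero) m = log_sum (add_sqf tau ps s) m.
  by apply: log_sum_updE; rewrite /add_sqf (negPf pps).
rewrite log_sum_upd_sqf // !e IH; congr (_ + _).
rewrite /fdiv; case: leqP => pn; first by rewrite IH -!divnMA mulnC.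
by rewrite [(n %/ c %/ p)%N]divn_small ?log_sum0 ?mulr0 // (leq_ltn_trans (leq_div n c)).
Qed.

Lemma chaosB (g h : nat -> R) ps s n :
  chaos fdiv (fun z => g z - h z) ps s n = chaos fdiv g ps s n - chaos fdiv h ps s n.
Proof.
elim: ps n => [|p ps IH] n //=; rewrite IH.
by case: (fdiv p n) => [j|]; rewrite ?IH; ring.
Qed.

Lemma chaos_eq_fun (g h : nat -> R) ps s n : g =1 h ->
  chaos fdiv g ps s n = chaos fdiv h ps s n.
Proof.
move=> gh; elim: ps n => [|p ps IH] n //=; rewrite IH.
by case: (fdiv p n) => [j|]; rewrite ?IH.
Qed.

(** Every division strictly lowers z, so only the term b = 1 can meet the value at n. *)
Lemma chaos_single (c : R) ps s n z : all (leq 2) ps -> (z <= n)%N ->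
  chaos fdiv (fun z => if z == n then c else 0) ps s z = if z == n then c else 0.
Proof.
elim: ps z => [|p ps IH] z //= /andP[p2 hps] zn; rewrite IH //.
case E: (fdiv p z) => [j|]; last by rewrite addr0.
have [pz ->] := fdiv_some E.
have lt : (z %/ p < z)%N by rewrite ltn_Pdiv // (leq_trans _ pz) // (leq_trans _ p2).
rewrite IH ?(leq_trans (ltnW lt)) // (ltn_eqF (leq_trans lt zn)) mulr0 addr0 //.
Qed.

Lemma chaos_off (A : nat -> R) ps s n : all (leq 2) ps ->
  chaos fdiv (off A n) ps s n = chaos fdiv A ps s n - A n.
Proof.
move=> hps; have := @chaos_single (A n) ps s n n hps (leqnn n); rewrite eqxx => <-.
rewrite -chaosB; apply: chaos_eq_fun => z; rewrite /off.
by case: eqP => [->|_]; rewrite ?subrr ?subr0.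
Qed.
End ChaosLogSum.

(** * From the absence of bad events to positivity *)

Section Deterministic.
Variable R : realType.
Variables X a : nat.
Local Notation Y := (6 * a)%N.
Local Notation A := (log_sum (lam_upto R Y)).
Hypothesis a1 : a.-1%:R = 27 * 37 :> R.
Hypothesis aX : (Y <= X)%N.
Hypothesis XE : X%:R = 40 * 100 * 100 :> R.
Hypothesis A_sqr : forall n, A n ^+ 2 <= 13 / 400 + 194 / 100 / n.+1%:R.

(* For n >= 2 ^ 60 the thresholds leave room: there T n > 1 / 100, and beyond
   2 ^ 224 the loss from n / 256 to n is at most half of the current lower bound. *)
Definition bad n (s : nat -> R) : bool :=
  if n%:R < (2 : R) ^+ 60 then off_event A a n (8 / 100) s
  else if (trunc_log 256 n < 28)%N then off_event A a n (7 / 100) s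
  else incr_event a n (1 / 100 / 2 ^+ (trunc_log 256 n - 27)) s.

Lemma trunc_log_bound n : (0 < n)%N ->
  (2 : R) ^+ (8 * trunc_log 256 n) <= n%:R /\ n%:R < (2 : R) ^+ (8 * (trunc_log 256 n).+1).
Proof.
move=> n0; have /andP[h1 h2] := @trunc_log_bounds 256 n isT n0.
have e k : (2 : R) ^+ (8 * k) = (256 ^ k)%:R by rewrite natrX exprM -natrX.
by rewrite !e ler_nat ltr_nat.
Qed.

Lemma avg_bad n : (X <= n)%N -> avg (primes_in Y n) (fun s => (bad n s)%:R) <= quota R n.
Proof.
move=> Xn; rewrite /bad.
have n0 : (0 < n)%N by have := a_gt1 a1; lia.
have [h1 h2] := trunc_log_bound n0.
case: ltP => n60; last first.
  case: ltnP => l28.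
    apply: (avg_mid3 A_sqr a1 aX) => //.
    by apply: lt_le_trans h2 _; rewrite ler_weXn2l ?ler1n //; rewrite (_ : 224 = 8 * 28)%N // leq_mul2l.
  move: (trunc_log 256 n) l28 h1 h2 => l l28 h1 h2.
  have el : l = (27 + (l - 27))%N by lia.
  apply: (avg_chain a1) => //; first by rewrite subn_gt0.
    by rewrite -el.
  by rewrite (_ : 28 + (l - 27) = l.+1)%N //; rewrite [in RHS]el.
case: (ltP n%:R ((2 : R) ^+ 32)) => n32; last by apply: (avg_mid2 A_sqr a1 aX).
case: (ltnP n (Y * Y)) => nY; first by apply: (avg_low A_sqr a1 aX XE).
by apply: (avg_mid1 A_sqr a1 aX).
Qed.

Hypothesis XY : (X <= Y * Y)%N.
Hypothesis liouX : forall n, (0 < n < X)%N -> 0 < log_sum (fun=> Full (-1 : R)) n.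
Hypothesis A_ge : forall n, (X <= n)%N -> 8 / 100 <= A n.

Section Signs.
Variable s : nat -> R.
Hypothesis s_sign : forall p, prime p -> s p = 1 \/ s p = -1.
Hypothesis not_bad : forall n, (X <= n)%N -> ~~ bad n s.

(* The random function is compared with one having f p = -1 for p <= Y and
   vanishing at multiples of p ^ 2 for p > Y. *)
Definition sqf_above (q : nat) : local_type R := if (q <= Y)%N then Full (-1) else Sqf (s q).
Local Notation T := (log_sum sqf_above).

Lemma sum_eq_chaos n c : (0 < c)%N -> 
  T (n %/ c) = chaos fdiv (fun z => A (z %/ c)) (primes_in Y n) s n.
Proof.
move=> c0; rewrite chaos_log_sum ?filter_uniq ?iota_uniq //; last first.
  move=> p hp; have := primes_in_gt hp; rewrite mem_filter in hp.
  by move/andP: hp => [pp _]; rewrite /lam_upto ltnNge => /negbTE ->.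
apply: eq_log_sum => q qp qn; rewrite /sqf_above /add_sqf /lam_upto mem_filter qp mem_index_iota ltnS.
by rewrite (leq_trans qn (leq_div _ _)) andbT ltnNge; case: ifP.
Qed.

Lemma off_event_gt n t : (X <= n)%N -> ~~ off_event A a n t s -> 8 / 100 - t < T n.
Proof.
move=> Xn; rewrite /off_event -ltNge chaos_off ?primes_in_ge2 //.
have := @sum_eq_chaos n 1 isT; rewrite divn1 => ->.
rewrite (@chaos_eq_fun R (fun z => A (z %/ 1)) A) => [|z]; last by rewrite divn1.
have := A_ge Xn; rewrite ltr_norml => h /andP[h1 _]; lra.
Qed.

Lemma incr_event_gt n t : ~~ incr_event a n t s -> T (n %/ 256) - t < T n.
Proof.
rewrite /incr_event -ltNge /incr.
rewrite (@chaos_eq_fun R _ (fun z => A (z %/ 1) - A (z %/ 256))) => [|z]; last by rewrite divn1.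
rewrite chaosB -!sum_eq_chaos // divn1 ltr_norml => /andP[h1 _]; lra.
Qed.

(** Passing from n / 256 to n halves the guaranteed bound, and the threshold of the event is the
    half given away. Levels below 28 start from 0.08 - 0.07. *)
Lemma T_ge n : (2 : R) ^+ 60 <= n%:R -> 1 / 100 / 2 ^+ (trunc_log 256 n - 27) <= T n.
Proof.
elim/ltn_ind: n => n IH n60.
have Xn : (X <= n)%N.
  rewrite -(ler_nat R) XE; apply: le_trans n60; apply: le_trans (_ : 2 ^+ 20 <= _).
    by rewrite !exprS expr0; lra.
  by rewrite ler_weXn2l ?ler1n.
have := not_bad Xn; rewrite /bad ltNge n60 /=; case: ltnP => l28.
  move=> /(off_event_gt Xn) h.
  rewrite (_ : trunc_log 256 n - 27 = 0)%N; last by lia.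
  rewrite expr0; lra.
move=> /incr_event_gt; set l := trunc_log 256 n in l28 *.
have n0 : (0 < n)%N by rewrite -(ltr_nat R); apply: lt_le_trans n60; rewrite exprn_gt0.
have /andP[b1 b2] := @trunc_log_bounds 256 n isT n0.
have ll : trunc_log 256 (n %/ 256) = l.-1.
  apply: trunc_log_eq => //; rewrite leq_divRL // ltn_divLR // -!expnSr.
  by rewrite prednK ?b1 ?b2 // (leq_trans _ l28).
have n1 : (0 < n %/ 256)%N.
  rewrite divn_gt0 //; apply: leq_trans b1; rewrite -{1}[256%N]expn1 leq_exp2l //.
  by apply: leq_trans l28.
have [c1 _] := trunc_log_bound n1.
have := IH (n %/ 256)%N; rewrite ltn_Pdiv // ll => /(_ isT) h.
have {}h := h _; rewrite ll in c1.
have e : (l - 27 = (l.-1 - 27).+1)%N by lia.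
rewrite e exprS; have E0 : 0 < (2 : R) ^+ (l.-1 - 27) by rewrite exprn_gt0.
have -> : 1 / 100 / (2 * 2 ^+ (l.-1 - 27)) = 1 / 100 / 2 ^+ (l.-1 - 27) / 2 :> R.
  by field; rewrite gt_eqF.
have : 1 / 100 / 2 ^+ (l.-1 - 27) <= T (n %/ 256).
  (* A level l >= 28 puts n / 256 at 2^216 or more, still in the range of the induction
     hypothesis. *)
  apply: h; apply: le_trans c1; rewrite ler_weXn2l ?ler1n //; lia.
move: (1 / 100 / _) (T _) => x y; lra.
Qed.

(** Below X <= Y^2 no p^2 with p > Y occurs, so squarefree factors may be replaced by full ones and
    domination from the Liouville function applies. From X on the absence of bad events decides. *)
Lemma sqf_above_gt0 n : (0 < n)%N -> 0 < T n.
Proof.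
move=> n0; have [Xn|nX] := leqP X n.
  have := not_bad Xn; rewrite /bad; case: ltP => [_ /(off_event_gt Xn)|n60 _].
    by rewrite subrr.
  apply: lt_le_trans (T_ge n60); rewrite !divr_gt0 ?exprn_gt0 //.
have hX : (X.-1 < X)%N by lia.
have pos : pos_upto (fun q => if (q <= Y)%N then Full (-1) else Full (s q)) X.-1.
  apply: (@pos_upto_dominates _ (fun=> Full (-1))).
    move=> p pp _; case: ifP => _; first by constructor 1.
    by have [->|->] := s_sign pp; [constructor 2 | constructor 1].
  by move=> m /andP[m0 mX]; apply: liouX; rewrite m0 (leq_ltn_trans mX).
rewrite (@eq_log_sum_sqf_full_all _ _ (fun q => if (q <= Y)%N then Full (-1) else Full (s q)) X.-1); last 2 first.
- by lia.
- move=> p pp _; rewrite /sqf_above; case: (leqP p Y) => pY; [by left | right; split; last by exists (s p)].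
  by apply: leq_trans hX _; apply: (leq_trans XY); rewrite leq_mul // ltnW.
by apply: pos; rewrite n0; lia.
Qed.

Lemma full_sum_gt0 n : (0 < n)%N -> 0 < log_sum (fun q => Full (s q)) n.
Proof.
move=> n0; have : pos_upto sqf_above n by move=> m /andP[m0 _]; apply: sqf_above_gt0.
move=> /pos_upto_dominates h; apply: (h (fun q => Full (s q))); last by rewrite n0 /=.
move=> p pp _; rewrite /sqf_above; case: ifP => _.
  by have [->|->] := s_sign pp; [constructor 2 | constructor 1].
constructor 4; exists (s p) => //.
by have [->|->] := s_sign pp; rewrite ?mulr1 // mulrNN mulr1.
Qed.
End Signs.
End Deterministic.

(** * Probability *)

Local Open Scope classical_set_scope.
Local Open Scope ring_scope.

Section Probability.
Context (R : realType) (d : measure_display) (T : measurableType d).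
Variables (P : probability T R) (f : nat -> {RV P >-> R}).
Hypothesis hf : random_completely_multiplicative f.

Definition signs_on (ps : seq nat) (w : T) : nat -> R :=
  foldr (fun p s => upd s p (f p w)) (fun=> 0) ps.

Lemma signs_onE ps w : {in ps, signs_on ps w =1 fun p => f p w}.
Proof.
elim: ps => [//|p ps IH] q; rewrite inE /= /upd.
by case: eqP => [-> //|_ /= /IH].
Qed.

(** The event Q as a union over sign patterns, in the recursion order of [avg], so that
    measurability and the probability bound follow by the same induction. *)
Fixpoint cover (ps : seq nat) (Q : (nat -> R) -> bool) : set T :=
  if ps is p :: ps' then
    (f p @^-1` [set 1] `&` cover ps' (fun s => Q (upd s p 1)))
    `|` (f p @^-1` [set -1] `&` cover ps' (fun s => Q (upd s p (-1))))
  else if Q (fun=> 0) then setT else set0.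

Lemma coverE ps Q : all prime ps -> cover ps Q = [set w | Q (signs_on ps w)].
Proof.
elim: ps Q => [|p ps IH] Q /=.
  by move=> _; apply/seteqP; split=> w /=; case: ifP.
move=> /andP[pp hps]; rewrite !IH //; apply/seteqP; split=> w /=.
  by move=> [[-> h]|[-> h]].
by have [->|->] := rcm_sign hf w pp; [left|right].
Qed.

Lemma measurable_sign p (c : R) : measurable (f p @^-1` [set c]).
Proof. by apply: measurable_funPTI; exact: measurable_set1. Qed.

Lemma measurable_cover ps Q : measurable (cover ps Q).
Proof.
elim: ps Q => [|p ps IH] Q /=; first by case: ifP.
by apply: measurableU; apply: measurableI => //; exact: measurable_sign.
Qed.

Definition cyl (s : seq nat) (v : nat -> R) : set T :=
  \bigcap_(i in [set` s]) (f i @^-1` [set v i]).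

Lemma measurable_cyl s v : measurable (cyl s v).
Proof.
apply: fin_bigcap_measurable => //.
Qed.

Lemma prob_cyl s v : uniq s -> all prime s -> (forall p, p \in s -> v p = 1 \/ v p = -1) ->
  P (cyl s v) = (2^-1 ^+ size s)%:E.
Proof.
move=> us ps hv; rewrite /cyl (rcm_indep hf us) //; last first.
  by move=> i /(allP ps).
elim: s us ps hv => [|p s IH] /=; first by rewrite big_nil.
move=> /andP[_ us] /andP[pp ps] hv; rewrite big_cons IH //; last first.
  by move=> q qs; apply: hv; rewrite inE qs orbT.
rewrite exprS EFinM; congr (_ * _)%E.
by have [->|->] := hv p (mem_head _ _); [exact: (rcm_prob1 hf pp)|exact: (rcm_probN1 hf pp)].
Qed.

Lemma cyl_cons p s v c : p \notin s -> f p @^-1` [set c] `&` cyl s v = cyl (p :: s) (upd v p c).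
Proof.
move=> ps; apply/seteqP; split=> w.
  move=> [h1 h2] i /=; rewrite inE /upd; case: eqP => [-> _ //|_ /= si].
  by apply: h2.
move=> h; split; first by have := h p; rewrite /= /upd inE !eqxx /=; apply.
move=> i /= si; have := h i; rewrite /= inE si orbT /upd => /(_ isT).
by case: eqP => // ip; rewrite -ip si in ps.
Qed.

(** [s] lists the primes whose signs are already fixed to v; independence gives their cylinder
    probability 2^(-|s|), and each further prime splits the event in two. *)
Lemma prob_cover s v ps Q : uniq (s ++ ps) -> all prime (s ++ ps) ->
  (forall p, p \in s -> v p = 1 \/ v p = -1) ->
  (P (cyl s v `&` cover ps Q) <= (2^-1 ^+ size s * avg ps (fun t => (Q t)%:R))%:E)%E.
Proof.
elim: ps s v Q => [|p ps IH] s v Q /=.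
  rewrite cats0 => us ps hv; case: ifP => _; last by rewrite setI0 measure0 mulr0.
  by rewrite setIT mulr1 prob_cyl.
move=> us hps hv.
have us' : uniq ((p :: s) ++ ps) by rewrite (perm_uniq (_ : perm_eq _ (s ++ p :: ps))) // perm_sym -cat1s perm_catCA.
have hps' : all prime ((p :: s) ++ ps).
  by move: hps; rewrite /= !all_cat /= => /and3P[-> -> ->].
have ps' : p \notin s by move: us'; rewrite /= mem_cat negb_or -andbA => /andP[].
have hv' c : c = 1 \/ c = -1 -> forall q, q \in p :: s -> upd v p c q = 1 \/ upd v p c q = -1.
  by move=> hc q; rewrite inE /upd; case: eqP => //= _; apply: hv.
rewrite setIUr !setIA ![cyl s v `&` _]setIC !cyl_cons //.
have m c Q' : measurable (cyl (p :: s) (upd v p c) `&` cover ps Q').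
  by apply: measurableI; [exact: measurable_cyl | exact: measurable_cover].
apply: le_trans (measureU2 _ _ _) _; [exact: m|exact: m|].
have h1 := IH (p :: s) (upd v p 1) (fun t => Q (upd t p 1)) us' hps' (hv' 1 (or_introl erefl)).
have h2 := IH (p :: s) (upd v p (-1)) (fun t => Q (upd t p (-1))) us' hps' (hv' (-1) (or_intror erefl)).
apply: le_trans (leeD h1 h2) _.
rewrite -EFinD lee_fin /= exprS le_eqVlt; apply/orP; left; apply/eqP; by field.
Qed.

Lemma prob_signs ps (Q : (nat -> R) -> bool) : uniq ps -> all prime ps ->
  measurable [set w | Q (signs_on ps w)] /\
  (P [set w | Q (signs_on ps w)] <= (avg ps (fun t => (Q t)%:R))%:E)%E.
Proof.
move=> us hps; rewrite -coverE //; split; first exact: measurable_cover.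
have := @prob_cover [::] (fun=> 0) ps Q us hps (fun _ _ => ltac:(done)).
have -> : cyl [::] (fun=> 0) = setT by apply/seteqP; split=> w // _ i.
by rewrite setTI /= mul1r.
Qed.
Lemma primes_in_prime y n : all prime (primes_in y n).
Proof. by apply/allP => p; rewrite mem_filter => /andP[]. Qed.

Lemma primes_in_uniq y n : uniq (primes_in y n).
Proof. by rewrite filter_uniq // iota_uniq. Qed.

Lemma eq_bad a n (s s' : nat -> R) : {in primes_in (6 * a) n, s =1 s'} -> bad a n s = bad a n s'.
Proof.
by move=> h; rewrite /bad /off_event /incr_event !(eq_chaos _ _ _ h).
Qed.

Section Union.
Variables X a : nat.
Hypothesis a1 : a.-1%:R = 27 * 37 :> R.
Hypothesis aX : (6 * a <= X)%N.
Hypothesis XE : X%:R = 40 * 100 * 100 :> R.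
Hypothesis A_sqr : forall n, log_sum (lam_upto R (6 * a)) n ^+ 2 <= 13 / 400 + 194 / 100 / n.+1%:R.

Definition bad_set n : set T := [set w | @bad R a n (fun p => f p w)].

Lemma prob_bad n : (X <= n)%N ->
  measurable (bad_set n) /\ (P (bad_set n) <= (quota R n)%:E)%E.
Proof.
move=> Xn; have [m h] := prob_signs (@bad R a n) (primes_in_uniq (6 * a) n) (primes_in_prime (6 * a) n).
have -> : bad_set n = [set w | @bad R a n (signs_on (primes_in (6 * a) n) w)].
  by apply/seteqP; split=> w /=; rewrite (eq_bad (signs_onE w)).
split=> //; apply: le_trans h _; rewrite lee_fin.
exact: (avg_bad a1 aX XE A_sqr).
Qed.

Lemma sum_quota m k : \sum_(0 <= i < k) quota R (i + m) <= 2 ^- 131 / m.+1%:R.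
Proof.
pose g i : R := - (2 ^- 131 / (i + m).+1%:R).
apply: le_trans (sum_telescope_le (g := g) _ _) _; first by [].
  move=> i _; rewrite /g /quota addSn le_eqVlt; apply/orP; left; apply/eqP.
  have h : (i + m).+2%:R = (i + m).+1%:R + 1 :> R by rewrite natr1.
  have h0 : 0 < (i + m).+1%:R :> R by [].
  rewrite h; move: ((i + m).+1%:R : R) (2 ^- 131 : R) h0 => x c x0.
  by field; rewrite !gt_eqF //; lra.
by rewrite /g opprK addrC gerBl divr_ge0.
Qed.

Lemma prob_union_bad : measurable (\bigcup_n bad_set (n + X)) /\
  (P (\bigcup_n bad_set (n + X)) <= (2 ^- 131 / X.+1%:R)%:E)%E.
Proof.
have h n := prob_bad (leq_addl n X).
have mB n : measurable (bad_set (n + X)) by have [] := h n.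
split; first by apply: bigcup_measurable => n _.
apply: le_trans (measure_sigma_subadditive P mB _ _) _ => //.
  exact: bigcup_measurable.
apply: lime_le; first by apply: is_cvg_nneseries => n _ _.
near=> k; apply: le_trans (_ : \sum_(0 <= i < k) (quota R (i + X))%:E <= _)%E.
  by apply: lee_sum => i _; have [] := h i.
by rewrite sumEFin lee_fin sum_quota.
Unshelve. all: by end_near.
Qed.
End Union.
(** As 10^45 = 2^45 5^45 and 400000 = 2^7 5^5, it is enough that 5^40 <= 2^93, that is (5/4)^40 <=
    2^13. *)
Lemma le_pow10 : 2 ^- 131 / ((40 * 100 * 100) + 1) <= 10 ^- 45 :> R.
Proof.
have h5 : (5 / 4) ^+ 40 <= 2 ^+ 13 :> R.
  have x0 : 0 <= 5 / 4 :> R by lra.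
  have g5 : (5 / 4) ^+ 5 <= 306 / 100 :> R by rewrite !exprS expr0; lra.
  have g10 : (5 / 4) ^+ 10 <= 94 / 10 :> R by apply: (sqrn_le x0 g5); lra.
  have g20 : (5 / 4) ^+ 20 <= 89 :> R by apply: (sqrn_le x0 g10); lra.
  apply: (sqrn_le x0 g20); rewrite !exprS expr0; lra.
have h : 5 ^+ 40 <= 2 ^+ 93 :> R.
  have -> : 5 ^+ 40 = (5 / 4) ^+ 40 * 2 ^+ 80 :> R.
    have -> : 2 ^+ 80 = 4 ^+ 40 :> R by rewrite (exprM _ 2 40); congr (_ ^+ _); rewrite expr2; ring.
    by rewrite -exprMn divfK //; lra.
  by rewrite (_ : 93 = 13 + 80)%N // exprD ler_wpM2r ?exprn_ge0.
apply: (@le_trans _ _ (2 ^- 131 / (40 * 100 * 100))).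
  by rewrite ler_wpM2l ?invr_ge0 ?exprn_ge0 // lef_pV2 ?posrE; lra.
have e1 : 10 ^+ 45 = 2 ^+ 45 * (5 ^+ 40 * 5 ^+ 5) :> R.
  by rewrite -exprD -exprMn; congr (_ ^+ _); lra.
have e2 : 40 * 100 * 100 = 2 ^+ 7 * 5 ^+ 5 :> R by rewrite !exprS !expr0; lra.
have e3 : 2 ^+ 131 = 2 ^+ 45 * 2 ^+ 86 :> R by rewrite -exprD.
have e4 : 2 ^+ 93 = 2 ^+ 86 * 2 ^+ 7 :> R by rewrite -exprD.
rewrite -invfM e1 e2 e3; rewrite e4 in h.
have := exprn_gt0 45 (ltr0n R 2); have := exprn_gt0 5 (ltr0n R 5).
have := exprn_gt0 86 (ltr0n R 2); have := exprn_gt0 7 (ltr0n R 2); have := exprn_gt0 40 (ltr0n R 5).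
move: (5 ^+ 40 : R) (2 ^+ 86 : R) (2 ^+ 7 : R) (2 ^+ 45 : R) (5 ^+ 5 : R) h => u v x y z h u0 x0 v0 z0 y0.
rewrite lef_pV2 ?posrE ?mulr_gt0 // -mulrA ler_pM2l // mulrA ler_pM2r //.
Qed.
End Probability.

Lemma prime_cutE : prime_cut = (6 * (10 * 100))%N.
Proof. by rewrite /prime_cut; lia. Qed.

Theorem theorem1p1 (R : realType) (d : measure_display) (T : measurableType d)
    (P : probability T R) (f : nat -> {RV P >-> R})
    (hf : random_completely_multiplicative f) :
  ((1 - 10 ^- 45)%:E <=
   P [set w : T | forall x : R, (1 <= x)%R ->
        (0 < \sum_(1 <= n < (Num.truncn x).+1) f n w / n%:R)%R])%E.
Proof.
pose S n w := \sum_(1 <= i < n.+1) f i w / i%:R.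
pose G : set T := \bigcap_n [set w | 0 < S n.+1 w].
have SE n w : log_sum (fun q => Full (f q w)) n = S n w.
  apply: (log_sum_cmul (f := fun i => f i w)); first exact: (rcm1 hf).
  by move=> m k m0 k0; apply: (rcmM hf).
have -> : [set w : T | forall x : R, (1 <= x)%R ->
    (0 < \sum_(1 <= n < (Num.truncn x).+1) f n w / n%:R)%R] = G.
  apply/seteqP; split=> w /= h.
    move=> n _ /=; have := h n.+1%:R; rewrite ler1n natrK; exact.
  move=> x x1; have t0 : (0 < Num.truncn x)%N by rewrite truncn_gt0.
  by have := h (Num.truncn x).-1 I; rewrite /= /S prednK.
have mS n : measurable_fun setT (S n).
  apply: measurable_sum => i; apply: measurable_funM; first exact: measurable_funP.
  exact: measurable_cst.
have mG : measurable G.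
  apply: bigcapT_measurable => n.
  rewrite (_ : [set w | 0 < S n.+1 w] = setT `&` (fun w => cst 0 w < S n.+1 w) @^-1` [set true]).
    by apply: measurable_fun_ltr.
  by apply/seteqP; split=> w /=; [split | case].
have a1 : (10 * 100)%N.-1%:R = 27 * 37 :> R.
  by rewrite (_ : (10 * 100).-1 = 27 * 37)%N ?natrM.
have aX : (6 * (10 * 100) <= tail_start)%N by rewrite /tail_start; lia.
have XY : (tail_start <= 6 * (10 * 100) * (6 * (10 * 100)))%N by rewrite /tail_start; lia.
have XE : tail_start%:R = 40 * 100 * 100 :> R.
  by rewrite /tail_start natrM; lra.
have hA n : [/\ 0 <= log_sum (lam_upto R (6 * (10 * 100))) n,
    log_sum (lam_upto R (6 * (10 * 100))) n ^+ 2 <= 13 / 400 + 194 / 100 / n.+1%:R &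
    (tail_start <= n)%N -> 8 / 100 <= log_sum (lam_upto R (6 * (10 * 100))) n].
  by have := lam_upto_cut_facts R n; rewrite /A_Y prime_cutE.
have liou n : (0 < n < tail_start)%N -> 0 < log_sum (fun=> Full (-1 : R)) n.
  exact: liouville_sum_gt0.
(* From here the two numerals are variables known only through these equations and inequalities. *)
move: tail_start (10 * 100)%N a1 aX XY XE hA liou => X a a1 aX XY XE hA liou.
have A_sqr n : log_sum (lam_upto R (6 * a)) n ^+ 2 <= 13 / 400 + 194 / 100 / n.+1%:R by case: (hA n).
have [mB PB] := prob_union_bad hf a1 aX XE A_sqr.
set B := \bigcup_n _ in mB PB.
apply: (@le_trans _ _ (P (~` B))).
  rewrite probability_setC // EFinB leeB // (le_trans PB) // lee_fin.
  by have := le_pow10 R; rewrite -(natr1 X) XE.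
apply: le_measure; rewrite ?inE //; first exact: measurableC.
move=> w /= hw n _ /=; rewrite -SE.
have A_ge m : (X <= m)%N -> 8 / 100 <= log_sum (lam_upto R (6 * a)) m by case: (hA m).
apply: (@full_sum_gt0 R X a aX XE XY liou A_ge (fun q => f q w)) => //.
  by move=> p; exact: (rcm_sign hf).
move=> m Xm; apply/negP => hb; apply: hw; exists (m - X)%N => //.
by rewrite /bad_set /= subnK.
Qed.
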